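(* Let $\mathcal{G}$ be the group functor on commutative rings sending $A$ to the group of continuous $A$-algebra automorphisms of $A((t))$. The explicit formula $$\hat{B}(\varphi_1,\varphi_2)=\mathrm{CC}\bigl(\tau(\varphi_1),\,\varphi_1(\tau(\varphi_2))\bigr)=\mathrm{CC}\bigl(\widetilde{\varphi_1}',\ \widetilde{\varphi_2}'\circ\widetilde{\varphi_1}\bigr),$$ where $\varphi_1,\varphi_2\in\mathcal{G}(A)$ and $A$ is any commutative ring, gives a well-defined $2$-cocycle $\hat{B}$ (the formal Bott-Thurston cocycle) on the group functor $\mathcal{G}$ with coefficients in the group functor $\mathbb{G}_m$, on which $\mathcal{G}$ acts trivially.
   Context: **The group functor $\mathcal{G}$.** $A((t))=A[[t]][t^{-1}]$ has the topology with base of neighbourhoods of zero $t^nA[[t]]$, $n\in\mathbb{Z}$. $\mathcal{G}(A)$ is the group of $A$-algebra automorphisms of $A((t))$ that are homeomorphisms, under composition. $\varphi\in\mathcal{G}(A)$ is determined by $\widetilde\varphi=\varphi(t)$ via $\varphi(\sum a_it^i)=\sum a_i\widetilde\varphi^{\,i}$; the possible $\widetilde\varphi$ are exactly the series $\sum_{i\ge -n}a_it^i$ with $a_1\in A^*$ and $a_i$ nilpotent for $i\le0$. Functoriality in $A$ is on coefficients of $\widetilde\varphi$. For $f=\sum b_it^i$, $f\circ\widetilde\varphi=\sum b_i\widetilde\varphi^{\,i}$. Put $\tau(\varphi)=\widetilde\varphi'=\frac{\partial\widetilde\varphi}{\partial t}\in A((t))^*$. **Contou-Carrère symbol.** For $f\in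 A((t))^*$ there is a unique decomposition $f=\prod_{i<0}(1-a_it^i)\cdot a_0t^{\nu(f)}\prod_{i>0}(1-a_it^i)$ with $\nu(f)$ a locally constant $\mathbb{Z}$-valued function on $\operatorname{Spec}A$, $a_0\in A^*$, $a_i$ nilpotent for $i<0$ and the product over $i<0$ finite (powers with locally constant exponents are defined factor by factor on the corresponding finite product decomposition of $A$). If $g$ has the analogous decomposition with $b_j$, then (with $(i,j)$ the greatest common divisor) $$\mathrm{CC}(f,g)=(-1)^{\nu(f)\nu(g)}\frac{a_0^{\nu(g)}\prod_{i>0}\prod_{j>0}\bigl(1-a_i^{j/(i,j)}b_{-j}^{i/(i,j)}\bigr)^{(i,j)}}{b_0^{\nu(f)}\prod_{i>0}\prod_{j>0}\bigl(1-a_{-i}^{j/(i,j)}b_{j}^{i/(i,j)}\bigr)^{(i,j)}}\in A^*$$ (only finitely many factors differ from $1$). **Cocycles.** $\mathbb{G}_m(A)=A^*$. A $2$-cocycle on $\mathcal{G}$ with coefficients in $\mathbb{G}_m$ (trivial action) is a morphism of set-valued functors $c:\mathcal{G}\times\mathcal{G}\to\mathbb{G}_m$ such that for every commutative ring $A$ and all $g_1,g_2,g_3\in\mathcal{G}(A)$: $c(g_2,g_3)\,c(g_1g_2,g_3)^{-1}\,c(g_1,g_2g_3)\,c(g_1,g_2)^{-1}=1$. *)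

(* Defs.v *)
From HB Require Import structures.
From mathcomp Require Import all_boot all_order all_algebra.
From mathcomp Require Import all_classical topology.
From mathcomp Require Import zify.

Set Implicit Arguments.
Unset Strict Implicit.
Unset Printing Implicit Defensive.

Import Order.TTheory GRing.Theory Num.Theory.

Local Open Scope classical_set_scope.
Local Open Scope ring_scope.

(* Commutative rings are [comPzRingType]s, so that the zero ring is allowed. *)

Section Laurent.
Variable A : comPzRingType.

Definition bounded_below (f : int -> A) : Prop :=
  exists m : int, forall i, i < m -> f i = 0.

Record laurent := Laurent {
  lcoef :> int -> A;
  _ : `[< bounded_below lcoef >] }.

HB.instance Definition _ := [isSub for lcoef].
HB.instance Definition _ := [Choice of laurent by <:].

Lemma laurentP (f g : laurent) : f =1 g <-> f = g.
Proof. by split=> [e|->//]; apply: val_inj; apply/funext. Qed.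

Lemma laurent_bound (f : laurent) : bounded_below f.
Proof. by case: f => f /= /asboolP. Qed.

Lemma laurent_boundN (f : laurent) :
  exists M : nat, forall i, i < - M%:Z -> f i = 0.
Proof.
by have [m fm] := laurent_bound f; exists `|m|%N => i im; apply: fm; lia.
Qed.

Definition mkLaurent (f : int -> A) (hf : bounded_below f) : laurent :=
  Laurent (asboolT hf).

Fact add_subproof (f g : laurent) : bounded_below (fun i => f i + g i).
Proof.
have [m fm] := laurent_bound f; have [k gk] := laurent_bound g.
by exists (Num.min m k) => i im; rewrite fm ?gk ?addr0 //; lia.
Qed.

Fact opp_subproof (f : laurent) : bounded_below (fun i => - f i).
Proof.
by have [m fm] := laurent_bound f; exists m => i im; rewrite fm ?oppr0.
Qed.

Fact zero_subproof : bounded_below (fun=> 0).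
Proof. by exists 0. Qed.

Fact mul_subproof (f g : laurent) :
  bounded_below (fun n => \sum_(i \in [set: int]) f i * g (n - i)).
Proof.
have [m fm] := laurent_bound f; have [k gk] := laurent_bound g.
exists (m + k) => n nmk; apply: fsbig1 => i _.
have [im|im] := ltP i m; first by rewrite fm ?mul0r.
by rewrite gk ?mulr0 //; lia.
Qed.

Fact monom_subproof (a : A) (n : int) :
  bounded_below (fun i => a *+ (i == n)).
Proof. by exists n => i ni; rewrite lt_eqF ?mulr0n. Qed.

Fact scale_subproof (a : A) (f : laurent) : bounded_below (fun i => a * f i).
Proof.
by have [m fm] := laurent_bound f; exists m => i im; rewrite fm ?mulr0.
Qed.

Fact deriv_subproof (f : laurent) :
  bounded_below (fun i => f (i + 1) *~ (i + 1)).
Proof.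
have [m fm] := laurent_bound f.
by exists (m - 1) => i im; rewrite fm ?mul0rz //; lia.
Qed.

Definition ladd f g := mkLaurent (add_subproof f g).
Definition lopp f := mkLaurent (opp_subproof f).
Definition lzero := mkLaurent zero_subproof.
Definition lmul f g := mkLaurent (mul_subproof f g).
Definition lscale a f := mkLaurent (scale_subproof a f).

(* a t^n *)
Definition monom (a : A) (n : int) : laurent := mkLaurent (monom_subproof a n).

Definition lderiv (f : laurent) : laurent := mkLaurent (deriv_subproof f).

Fact laddA : associative ladd.
Proof. by move=> f g h; apply/laurentP => i /=; rewrite addrA. Qed.
Fact laddC : commutative ladd.
Proof. by move=> f g; apply/laurentP => i /=; rewrite addrC. Qed.
Fact ladd0 : left_id lzero ladd.
Proof. by move=> f; apply/laurentP => i /=; rewrite add0r. Qed.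
Fact laddN : left_inverse lzero lopp ladd.
Proof. by move=> f; apply/laurentP => i /=; rewrite addNr. Qed.

HB.instance Definition _ :=
  GRing.isZmodule.Build laurent laddA laddC ladd0 laddN.

Lemma fsum_window (F : int -> A) (M K : nat) :
    (forall i, i < - M%:Z -> F i = 0) ->
    (forall i, K%:Z - M%:Z <= i -> F i = 0) ->
  \sum_(i \in [set: int]) F i = \sum_(k < K) F (k%:Z - M%:Z).
Proof.
move=> Fl Fr.
rewrite (fsbigE [seq k%:Z - M%:Z | k <- iota 0 K]) //=.
- rewrite big_map -[X in iota X]/0%N.
  rewrite (eq_bigl xpredT) => [|i]; last by rewrite in_setT.
  by rewrite -[K in iota 0 K]subn0 big_mkord.
- by rewrite map_inj_uniq ?iota_uniq // => i j; lia.
- move=> i _ /mapP iK; have [im|im] := ltP i (- M%:Z); first exact: Fl.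
  have [iKM|iKM] := lerP (K%:Z - M%:Z) i; first exact: Fr.
  by case: iK; exists (absz (i + M%:Z)); rewrite ?mem_iota; lia.
Qed.

Fact lmulC : commutative lmul.
Proof.
move=> f g; apply/laurentP => n /=.
rewrite (reindex_fsbigT (fun i : int => n - i)) /=; last first.
  by exists (fun i => n - i) => i; lia.
by apply: eq_fsbigr => i _; rewrite mulrC; congr (g _ * _); lia.
Qed.

Fact lmulA : associative lmul.
Proof.
move=> f g h; apply/laurentP => n /=.
have [Mf fM] := laurent_boundN f; have [Mg gM] := laurent_boundN g.
have [Mh hM] := laurent_boundN h.
have [M [Mf_le Mg_le Mh_le]] : exists M, [/\ Mf <= M, Mg <= M & Mh <= M]%N.
  by exists (Mf + Mg + Mh)%N; split; lia.
have {}fM i : i < - M%:Z -> f i = 0 by move=> ?; apply: fM; lia.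
have {}gM i : i < - M%:Z -> g i = 0 by move=> ?; apply: gM; lia.
have {}hM i : i < - M%:Z -> h i = 0 by move=> ?; apply: hM; lia.
pose K1 := (`|n| + 3 * M + 1)%N; pose K2 := (K1 + `|n| + 5 * M + 1)%N.
have fgM i : i < - (M + M)%:Z -> \sum_(j \in [set: int]) f j * g (i - j) = 0.
  move=> im; apply: fsbig1 => j _.
  have [jm|jm] := ltP j (- M%:Z); first by rewrite fM ?mul0r.
  by rewrite gM ?mulr0 //; lia.
have ghM i : i < - (M + M)%:Z -> \sum_(j \in [set: int]) g j * h (i - j) = 0.
  move=> im; apply: fsbig1 => j _.
  have [jm|jm] := ltP j (- M%:Z); first by rewrite gM ?mul0r.
  by rewrite hM ?mulr0 //; lia.
rewrite (@fsum_window _ M K2); last 2 first.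
- by move=> i im; rewrite fM ?mul0r.
- by move=> i im; rewrite ghM ?mulr0 //; lia.
rewrite (@fsum_window (fun i => (\sum_(j \in [set: int]) f j * g (i - j)) *
   h (n - i)) (M + M)%N K1); last 2 first.
- by move=> i im; rewrite fgM ?mul0r.
- by move=> i im; rewrite hM ?mulr0 //; lia.
under [RHS]eq_bigr => i _.
  rewrite (@fsum_window _ M K2); last 2 first.
  - by move=> j im; rewrite fM ?mul0r.
  - by move=> j im; rewrite gM ?mulr0 //; have := ltn_ord i; lia.
  rewrite mulr_suml; over.
rewrite exchange_big /=; apply: eq_bigr => j _.
under [RHS]eq_bigr => i _ do rewrite -mulrA.
rewrite -mulr_sumr; congr (_ * _).
pose F i := g (i - (j%:Z - M%:Z)) * h (n - i).
rewrite -(@fsum_window F (M + M)%N K1); last 2 first.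
- by move=> i im; rewrite /F gM ?mul0r //; lia.
- by move=> i im; rewrite /F hM ?mulr0 //; lia.
rewrite [RHS](reindex_fsbigT (fun i : int => i + (j%:Z - M%:Z))) /=; last first.
  by exists (fun i => i - (j%:Z - M%:Z)) => i; lia.
by apply: eq_fsbigr => i _; rewrite /F; congr (g _ * h _); lia.
Qed.

Fact lmul1 : left_id (monom 1 0) lmul.
Proof.
move=> f; apply/laurentP => n /=; have [M fM] := laurent_boundN f.
rewrite (@fsum_window _ 0 1); last 2 first.
- by move=> i im; rewrite lt_eqF ?mulr0n ?mul0r.
- by move=> i im; rewrite gt_eqF ?mulr0n ?mul0r //; lia.
by rewrite big_ord1 /= mulr1n mul1r; congr (f _); lia.
Qed.

Fact lmulDl : left_distributive lmul ladd.
Proof.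
move=> f g h; apply/laurentP => n /=.
have [Mf fM] := laurent_boundN f; have [Mg gM] := laurent_boundN g.
have [Mh hM] := laurent_boundN h.
pose M := (Mf + Mg)%N; pose K := (`|n| + M + Mh + 1)%N.
have hK i : K%:Z - M%:Z <= i -> h (n - i) = 0 by move=> ?; apply: hM; lia.
have {}fM i : i < - M%:Z -> f i = 0 by move=> ?; apply: fM; lia.
have {}gM i : i < - M%:Z -> g i = 0 by move=> ?; apply: gM; lia.
rewrite !(@fsum_window _ M K).
- by rewrite -big_split /=; apply: eq_bigr => i _; rewrite mulrDl.
all: move=> i im; rewrite ?(hK _ im) ?mulr0 // ?fM ?gM ?addr0 ?mul0r //.
Qed.

HB.instance Definition _ :=
  GRing.Zmodule_isComPzRing.Build laurent lmulA lmulC lmul1 lmulDl.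

Fact lscaleA a b f : lscale a (lscale b f) = lscale (a * b) f.
Proof. by apply/laurentP => i /=; rewrite mulrA. Qed.
Fact lscale1 : left_id 1 lscale.
Proof. by move=> f; apply/laurentP => i /=; rewrite mul1r. Qed.
Fact lscaleDr : right_distributive lscale +%R.
Proof. by move=> a f g; apply/laurentP => i /=; rewrite mulrDr. Qed.
Fact lscaleDl f : {morph lscale^~ f : a b / a + b}.
Proof. by move=> a b; apply/laurentP => i /=; rewrite mulrDl. Qed.

HB.instance Definition _ := GRing.Zmodule_isLmodule.Build A laurent
  lscaleA lscale1 lscaleDr lscaleDl.

(* f \in t^n A[[t]]; these are the basic neighbourhoods of zero. *)
Definition in_tpow (n : int) (f : laurent) : Prop := forall i, i < n -> f i = 0.

Definition laurent_nbhs (f : laurent) : set_system laurent :=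
  filter_from [set: int] (fun n => [set g | in_tpow n (g - f)]).

HB.instance Definition _ := isPointed.Build laurent 0.
HB.instance Definition _ := hasNbhs.Build laurent laurent_nbhs.

Fact laurent_nbhs_filter (f : laurent) : ProperFilter (nbhs f).
Proof.
apply: filter_from_proper; last first.
  by move=> n _; exists f => i _ /=; rewrite subrr.
apply: filter_from_filter; first by exists 0.
move=> m n _ _; exists (Num.max m n) => // g /= gf.
by split=> i im; apply: gf; lia.
Qed.

Fact laurent_nbhs_singleton (f : laurent) (U : set laurent) : nbhs f U -> U f.
Proof. by move=> [n _]; apply => i _ /=; rewrite subrr. Qed.

Fact laurent_nbhs_nbhs (f : laurent) (U : set laurent) :
  nbhs f U -> nbhs f (nbhs^~ U).
Proof.
move=> [n _ nU]; exists n => // g /= gf; exists n => // h /= hg.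
apply: nU => i ni; have -> : h - f = (h - g) + (g - f) by rewrite addrA subrK.
by rewrite -[LHS]/((h - g) i + (g - f) i) hg ?gf ?addr0.
Qed.

HB.instance Definition _ := Nbhs_isNbhsTopological.Build laurent
  laurent_nbhs_filter laurent_nbhs_singleton laurent_nbhs_nbhs.

End Laurent.

Section Gm.
Variable A : comPzRingType.

Definition invertible (x : A) : Prop := exists y, x * y = 1.

Record Gm := MkGm { gm_val : A; _ : `[< invertible gm_val >] }.

HB.instance Definition _ := [isSub for gm_val].
HB.instance Definition _ := [Choice of Gm by <:].

Lemma gm_invertible (x : Gm) : invertible (gm_val x).
Proof. by case: x => x /= /asboolP. Qed.

Definition toGm (x : A) (hx : invertible x) : Gm := MkGm (asboolT hx).

Fact gm_inv_subproof (x : Gm) : exists y : Gm, gm_val x * gm_val y = 1.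
Proof.
have [y xy] := gm_invertible x.
have hy : invertible y by exists (gm_val x); rewrite mulrC.
by exists (toGm hy).
Qed.

Fact invertible1 : invertible 1.
Proof. by exists 1; rewrite mulr1. Qed.

Fact invertibleM (x y : A) : invertible x -> invertible y -> invertible (x * y).
Proof. by move=> [x' xx] [y' yy]; exists (x' * y'); rewrite mulrACA xx yy mulr1. Qed.

Fact invertibleN1 : invertible (- 1).
Proof. by exists (- 1); rewrite mulrNN mulr1. Qed.

Definition gm_one := toGm invertible1.
Definition gm_mul (x y : Gm) :=
  toGm (invertibleM (gm_invertible x) (gm_invertible y)).
Definition gm_inv (x : Gm) : Gm := sval (cid (gm_inv_subproof x)).

Fact gm_mulA : associative gm_mul.
Proof. by move=> x y z; apply: val_inj; rewrite /= mulrA. Qed.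
Fact gm_mulC : commutative gm_mul.
Proof. by move=> x y; apply: val_inj; rewrite /= mulrC. Qed.
Fact gm_mul1g : left_id gm_one gm_mul.
Proof. by move=> x; apply: val_inj; rewrite /= mul1r. Qed.
Fact gm_mulg1 : right_id gm_one gm_mul.
Proof. by move=> x; apply: val_inj; rewrite /= mulr1. Qed.
Fact gm_mulgV : right_inverse gm_one gm_inv gm_mul.
Proof. by move=> x; apply: val_inj; rewrite /= /gm_inv; case: cid. Qed.
Fact gm_mulVg : left_inverse gm_one gm_inv gm_mul.
Proof. by move=> x; rewrite gm_mulC gm_mulgV. Qed.

HB.instance Definition _ :=
  isGroup.Build Gm gm_mulA gm_mul1g gm_mulg1 gm_mulVg gm_mulgV.

Definition gm_opp1 : Gm := toGm invertibleN1.

Definition nilpotent (x : A) : Prop := exists n : nat, x ^+ n = 0.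

Lemma invertible_1Bnil (x : A) : nilpotent x -> invertible (1 - x).
Proof.
move=> [n xn0]; exists (\sum_(i < n) x ^+ i).
suff -> : (1 - x) * (\sum_(i < n) x ^+ i) = 1 - x ^+ n by rewrite xn0 subr0.
elim: n {xn0} => [|n IHn]; first by rewrite big_ord0 mulr0 subrr.
by rewrite big_ord_recr mulrDr IHn mulrBl mul1r -exprS addrA subrK.
Qed.

Lemma nilpotent_mulXr (x y : A) (m n : nat) :
  (0 < n)%N -> nilpotent y -> nilpotent (x ^+ m * y ^+ n).
Proof.
move=> n0 [k yk0]; exists k.
by rewrite exprMn -[(y ^+ n) ^+ k]exprM mulnC exprM yk0 expr0n eqn0Ngt n0 mulr0.
Qed.

End Gm.

Section GmMap.
Variables (A B : comPzRingType) (h : {rmorphism A -> B}).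

Fact gm_map_subproof (x : Gm A) : invertible (h (gm_val x)).
Proof.
by have [y xy] := gm_invertible x; exists (h y); rewrite -rmorphM xy rmorph1.
Qed.

Definition Gm_map (x : Gm A) : Gm B := toGm (gm_map_subproof x).
End GmMap.

Definition zpow (G : groupType) (x : G) (n : int) : G :=
  match n with Posz k => (x ^+ k)%g | Negz k => (x ^- k.+1)%g end.

Section TVar.
Variable A : comPzRingType.

Fact tvar_subproof : invertible (monom (1 : A) 1).
Proof.
exists (monom 1 (- 1)); apply/laurentP => n.
rewrite [LHS](@fsum_window _ _ 0 2); last 2 first.
- by move=> i im; rewrite /= lt_eqF ?mulr0n ?mul0r //; lia.
- by move=> i im; rewrite /= gt_eqF ?mulr0n ?mul0r //; lia.
rewrite !big_ord_recl big_ord0 /= mulr0n mul0r add0r addr0 mulr1n mul1r.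
by rewrite -[RHS]/(1 *+ (n == 0)); congr (1 *+ nat_of_bool _); rewrite /bump /=; lia.
Qed.

Definition tvar : Gm (laurent A) := toGm tvar_subproof.
End TVar.

Record Spec (A : comPzRingType) := PrimeIdeal {
  prime_mem :> A -> Prop;
  prime_mem0 : prime_mem 0;
  prime_memD : forall x y, prime_mem x -> prime_mem y -> prime_mem (x + y);
  prime_memMl : forall a x, prime_mem x -> prime_mem (a * x);
  prime_mem1 : ~ prime_mem 1;
  prime_memM : forall x y, prime_mem (x * y) -> prime_mem x \/ prime_mem y }.

(* Local constancy for the Zariski topology, tested on its base of principal
   open sets D(s) = {q | s \notin q}. *)
Definition locally_constant (A : comPzRingType) (nu : Spec A -> int) : Prop :=
  forall p : Spec A,
    exists s : A, ~ p s /\ forall q : Spec A, ~ q s -> nu q = nu p.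

(* The complete systems of orthogonal idempotents (e_0, ..., e_(k-1)) are the
   finite product decompositions A = \prod_i e_i A, and Spec (e_i A) is D(e_i). *)
Definition orth_idempotents (A : comPzRingType) (k : nat) (e : 'I_k -> A) :
    Prop :=
  [/\ \sum_i e i = 1, forall i, e i * e i = e i
    & forall i j, i != j -> e i * e j = 0].

(* [lcpow iota nu x] is x^nu for x in R^*, where iota : A -> R is the structure
   map of the A-algebra R: it is x^(m_i) on the factor e_i R if nu is the
   constant m_i on Spec (e_i A). *)
Definition is_lcpow (A R : comPzRingType) (iota : A -> R) (nu : Spec A -> int)
    (x y : Gm R) : Prop :=
  exists (k : nat) (e : 'I_k -> A) (m : 'I_k -> int),
    [/\ orth_idempotents e,
        forall (i : 'I_k) (p : Spec A), ~ p (e i) -> nu p = m i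
      & gm_val y = \sum_i iota (e i) * gm_val (zpow x (m i))].

Definition lcpow (A R : comPzRingType) (iota : A -> R) (nu : Spec A -> int)
    (x : Gm R) : Gm R :=
  xget 1%g [set y | is_lcpow iota nu x y].

Section ContouCarrere.
Variable A : comPzRingType.

(* f = \prod_(i < 0) (1 - a_i t^i) * a_0 t^nu * \prod_(i > 0) (1 - a_i t^i).
   The coefficient a_0 is [cf_lead]; the value [cf_coef 0] is not used. *)
Record factorization (f : laurent A) := Factorization {
  cf_nu : Spec A -> int;
  cf_lead : Gm A;
  cf_coef : int -> A;
  cf_nu_lc : locally_constant cf_nu;
  cf_nil : forall i, i < 0 -> nilpotent (cf_coef i);
  cf_fin : finite_set [set i : int | i < 0 /\ cf_coef i <> 0];
  cf_eq : f = \big[*%R/1]_(i \in [set i : int | i < 0]) (1 - monom (cf_coef i) i)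
          * (gm_val cf_lead *:
             gm_val (lcpow (fun a => monom a 0) cf_nu (tvar A)))
          * lim ((fun N : nat =>
                  \prod_(1 <= i < N) (1 - monom (cf_coef i%:Z) i%:Z)) @ \oo) }.

Section Half.
Variables (f g : laurent A) (a : factorization f) (b : factorization g).

Fact cc_factor_subproof (i j : nat) :
  let: d := gcdn i.+1 j.+1 in
  nilpotent (cf_coef a i.+1%:Z ^+ (j.+1 %/ d) *
             cf_coef b (- j.+1%:Z) ^+ (i.+1 %/ d)).
Proof.
apply: nilpotent_mulXr; last by apply: cf_nil; lia.
by rewrite divn_gt0 ?gcdn_gt0 // dvdn_leq ?dvdn_gcdl.
Qed.

(* \prod_(i > 0, j > 0) (1 - a_i^(j/(i,j)) b_(-j)^(i/(i,j)))^((i,j)), with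
   indices shifted by one. Only finitely many factors differ from 1. *)
Definition cc_half : Gm A :=
  \big[*%g/1%g]_(ij \in [set: nat * nat])
    (toGm (invertible_1Bnil (cc_factor_subproof ij.1 ij.2))
       ^+ gcdn ij.1.+1 ij.2.+1)%g.

End Half.

(* The product in the denominator of the symbol is [cc_half b a] with the names
   of its two indices exchanged. *)
Definition CC_formula (f g : laurent A)
    (a : factorization f) (b : factorization g) : Gm A :=
  (lcpow idfun (fun p => (cf_nu a p * cf_nu b p)%R) (gm_opp1 A)
   * ((lcpow idfun (cf_nu b) (cf_lead a) * cc_half a b)
      / (lcpow idfun (cf_nu a) (cf_lead b) * cc_half b a)))%g.

Definition is_CC (f g : laurent A) (c : Gm A) : Prop :=
  exists (a : factorization f) (b : factorization g), c = CC_formula a b.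

Definition CC (f g : laurent A) : Gm A := xget 1%g [set c | is_CC f g c].

End ContouCarrere.

Section ContAut.
Variable A : comPzRingType.

Definition is_cont_aut (phi : laurent A -> laurent A) : Prop :=
  [/\ linear phi, monoid_morphism phi
    & exists psi : laurent A -> laurent A,
        [/\ cancel phi psi, cancel psi phi, continuous phi & continuous psi]].

Record contAut := ContAut {
  ca_fun :> laurent A -> laurent A;
  _ : `[< is_cont_aut ca_fun >] }.

HB.instance Definition _ := [isSub for ca_fun].
HB.instance Definition _ := [Choice of contAut by <:].

Lemma contAut_prop (phi : contAut) : is_cont_aut phi.
Proof. by case: phi => phi /= /asboolP. Qed.

Definition mkContAut (phi : laurent A -> laurent A) (h : is_cont_aut phi) :
  contAut := ContAut (asboolT h).

Fact is_cont_aut_id : is_cont_aut idfun.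
Proof. by split=> //; exists idfun; split=> // x; exact: cvg_id. Qed.

Fact is_cont_aut_comp (phi psi : contAut) : is_cont_aut (phi \o psi).
Proof.
have [lf [f1 fM] [f' [fK f'K cf cf']]] := contAut_prop phi.
have [lg [g1 gM] [g' [gK g'K cg cg']]] := contAut_prop psi.
split.
- by move=> a u v /=; rewrite lg lf.
- by split=> [|u v] /=; rewrite ?g1 ?f1 // gM fM.
- exists (g' \o f'); split.
  + exact: can_comp.
  + exact: can_comp.
  + by move=> x; apply: continuous_comp; [exact: cg | exact: cf].
  + by move=> x; apply: continuous_comp; [exact: cf' | exact: cg'].
Qed.

Fact is_cont_aut_inv (phi : contAut) :
  exists psi : contAut, cancel phi psi /\ cancel psi phi.
Proof.
have [lf [f1 fM] [f' [fK f'K cf cf']]] := contAut_prop phi.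
have h : is_cont_aut f'.
  split; last by exists phi.
  - by move=> a u v; apply: (can_inj fK); rewrite lf !f'K.
  - by split=> [|u v]; apply: (can_inj fK); rewrite ?fM !f'K ?f1.
by exists (mkContAut h).
Qed.

Definition ca_one := mkContAut is_cont_aut_id.
Definition ca_mul phi psi := mkContAut (is_cont_aut_comp phi psi).
Definition ca_inv phi := sval (cid (is_cont_aut_inv phi)).

Fact ca_mulA : associative ca_mul.
Proof. by move=> f g h; apply: val_inj. Qed.
Fact ca_mul1g : left_id ca_one ca_mul.
Proof. by move=> f; apply: val_inj. Qed.
Fact ca_mulg1 : right_id ca_one ca_mul.
Proof. by move=> f; apply: val_inj. Qed.
Fact ca_mulVg : left_inverse ca_one ca_inv ca_mul.
Proof.
move=> f; apply: val_inj; apply/funext => x /=.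
by rewrite /ca_inv; case: cid => g [fK gK] /=; rewrite fK.
Qed.
Fact ca_mulgV : right_inverse ca_one ca_inv ca_mul.
Proof.
move=> f; apply: val_inj; apply/funext => x /=.
by rewrite /ca_inv; case: cid => g [fK gK] /=; rewrite gK.
Qed.

HB.instance Definition _ :=
  isGroup.Build contAut ca_mulA ca_mul1g ca_mulg1 ca_mulVg ca_mulgV.

Fact tilde_subproof (phi : contAut) : invertible (phi (gm_val (tvar A))).
Proof.
have [_ [f1 fM] _] := contAut_prop phi.
by have [y ty] := gm_invertible (tvar A); exists (phi y); rewrite -fM ty f1.
Qed.

Definition tilde (phi : contAut) : Gm (laurent A) := toGm (tilde_subproof phi).

Definition tau (phi : contAut) : laurent A := lderiv (gm_val (tilde phi)).

(* Partial sums of f o u = \sum_i f_i u^i. *)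
Definition lcomp_partial (f : laurent A) (u : Gm (laurent A)) (N : nat) :
    laurent A :=
  \sum_(0 <= k < N) f k%:Z *: gm_val (zpow u k%:Z) +
  \sum_(1 <= k < N) f (- k%:Z) *: gm_val (zpow u (- k%:Z)).

Definition lcomp (f : laurent A) (u : Gm (laurent A)) : laurent A :=
  lim (lcomp_partial f u @ \oo).

End ContAut.

(* The map G(A) -> G(B) induced by h, as a graph: h is applied to the
   coefficients of [tilde phi], and [tilde psi] determines [psi]. *)
Definition base_change (A B : comPzRingType) (h : {rmorphism A -> B})
    (phi : contAut A) (psi : contAut B) : Prop :=
  forall i : int, gm_val (tilde psi) i = h (gm_val (tilde phi) i).

Definition natural_cochain
    (c : forall A : comPzRingType, contAut A -> contAut A -> Gm A) : Prop :=
  forall (A B : comPzRingType) (h : {rmorphism A -> B})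
         (phi1 phi2 : contAut A) (psi1 psi2 : contAut B),
    base_change h phi1 psi1 -> base_change h phi2 psi2 ->
    c B psi1 psi2 = Gm_map h (c A phi1 phi2).

Definition is_two_cocycle
    (c : forall A : comPzRingType, contAut A -> contAut A -> Gm A) : Prop :=
  natural_cochain c /\
  forall (A : comPzRingType) (g1 g2 g3 : contAut A),
    (c A g2 g3 * (c A (g1 * g2) g3)^-1 * c A g1 (g2 * g3) * (c A g1 g2)^-1
     = 1)%g.

Definition Bhat (A : comPzRingType) (phi1 phi2 : contAut A) : Gm A :=
  CC (tau phi1) (phi1 (tau phi2)).

(* Main.v *)
Require Import Defs.
From HB Require Import structures.
From mathcomp Require Import all_boot all_order all_algebra.
From mathcomp Require Import all_classical topology.
From mathcomp Require Import zify ring.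

Set Implicit Arguments.
Unset Strict Implicit.
Unset Printing Implicit Defensive.

Import Order.TTheory GRing.Theory Num.Theory.

Local Open Scope classical_set_scope.
Local Open Scope ring_scope.

(* By the chain rule tau (g1 g2) = tau g1 * g1 (tau g2), the cocycle identity
   follows from the bimultiplicativity of CC and from CC (g f) (g f') = CC f f'
   for every continuous automorphism g.

   Bimultiplicativity: let h be in 1 + t A[[t]] and m = \prod_k (1 - r_k / t)
   with r_k nilpotent; such a splitting of m exists after a faithful extension
   of the ring. The double product of the symbol of h and m is then
   \prod_k h(r_k): its factors reduce to the case of two binomials, where the
   exponents gcd(i, j) come out of Euclid's algorithm. The values h(r_k) are
   multiplicative in h, and the product over k is multiplicative in m.

   Invariance: the series g(t) is q o p for a power series p and some q whose
   only nonzero terms are t and nilpotent multiples of negative powers of t, so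
   that it suffices to substitute p and q. Idempotents make all orders constant.
   After an extension of the ring, every invertible series is, up to a factor on
   which the symbols at hand are trivial, a product of constants and of series
   1 - a t, t - b with b nilpotent, or of their inverses. On the images 1 - a u
   and u - b of these the symbol is computed from explicit Birkhoff
   factorizations. *)

(** The classical route writes the symbol as exp Res(log f dg/g) and inherits invariance from the
    residue. Over a ring with torsion, exp and log have denominators that make no sense, and the
    double product of the definition shows neither multiplicativity nor invariance; hence the detour
    through roots. Every identity sought is an equation in [A], so it may be checked after any
    injective ring morphism, and a monic p has a root in A[X]/(p), which is free over [A]. The
    pairing is specified over all extensions at once, so that base change is built in and a single
    splitting extension gives uniqueness. Two finiteness facts replace convergence: finitely many
    nilpotents generate a nilpotent ideal, so approximation along its powers stops; and for fixed g
    the symbol is trivial on 1 + t^N A[[t]] for N large, so infinite products can be truncated. A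
    substitution is split into p and q because with p all minus parts that occur, and with q all
    plus parts, have degree at most one. What remains cancels by the symmetry of divided differences
    in their two points. *)

(** * Nilpotent elements and powers of finitely generated ideals *)

Section Nilpotents.
Variable A : comPzRingType.
Implicit Types (x y a : A).

Lemma nilpotent0 : nilpotent (0 : A).
Proof. by exists 1%N; rewrite expr1. Qed.

Lemma nilpotentMl a x : nilpotent x -> nilpotent (a * x).
Proof. by move=> [n xn]; exists n; rewrite exprMn xn mulr0. Qed.

Lemma nilpotentMr x a : nilpotent x -> nilpotent (x * a).
Proof. by rewrite mulrC; exact: nilpotentMl. Qed.

Lemma nilpotentN x : nilpotent x -> nilpotent (- x).
Proof. by rewrite -mulN1r; exact: nilpotentMl. Qed.

Lemma expr_nilpotent x n m : x ^+ n = 0 -> (n <= m)%N -> x ^+ m = 0.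
Proof. by move=> xn /subnKC <-; rewrite exprD xn mul0r. Qed.

Lemma nilpotentD x y : nilpotent x -> nilpotent y -> nilpotent (x + y).
Proof.
move=> [m xm] [n yn]; exists (m + n)%N; rewrite exprDn big1 // => i _.
have [ni|ni] := leqP n i; first by rewrite (expr_nilpotent yn ni) mulr0 mul0rn.
by rewrite (expr_nilpotent xm) ?mul0r ?mul0rn //; lia.
Qed.

Lemma nilpotent_sum (I : Type) (r : seq I) (P : pred I) (F : I -> A) :
  (forall i, P i -> nilpotent (F i)) -> nilpotent (\sum_(i <- r | P i) F i).
Proof.
by move=> nF; apply: big_ind => //; [exact: nilpotent0 | exact: nilpotentD].
Qed.

Lemma nilpotent_of_exp x n : nilpotent (x ^+ n) -> nilpotent x.
Proof. by move=> [k]; rewrite -exprM; exists (n * k)%N. Qed.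

Lemma invertible_mull x y : invertible (x * y) -> invertible x.
Proof. by move=> [z xyz]; exists (y * z); rewrite mulrA. Qed.

Lemma invertible_nilpD x y : invertible x -> nilpotent y -> invertible (x + y).
Proof.
move=> [x' xx'] ny; have -> : x + y = x * (1 - - (x' * y)).
  by rewrite opprK mulrDr mulr1 mulrA xx' mul1r.
apply: invertibleM; first by exists x'.
by apply: invertible_1Bnil; apply/nilpotentN/nilpotentMl.
Qed.

Lemma invertible1D x : nilpotent x -> invertible (1 + x).
Proof. exact/invertible_nilpD/invertible1. Qed.

Lemma inv_uniq x y z : x * y = 1 -> x * z = 1 -> y = z.
Proof. by move=> xy xz; rewrite -[y]mulr1 -xz mulrCA mulrA xy mul1r. Qed.

Lemma invertible_mulI x y z : invertible x -> x * y = x * z -> y = z.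
Proof.
by move=> [x' xx'] e; rewrite -[y]mul1r -[z]mul1r -xx' ![x * x']mulrC -!mulrA e.
Qed.

(* The k-th power of the ideal generated by the list s. *)
Inductive ideal_pow (s : seq A) : nat -> A -> Prop :=
  | ideal_pow_all x : ideal_pow s 0 x
  | ideal_pow_gen k c x : c \in s -> ideal_pow s k x -> ideal_pow s k.+1 (c * x)
  | ideal_pow_0 k : ideal_pow s k 0
  | ideal_pow_add k x y :
      ideal_pow s k x -> ideal_pow s k y -> ideal_pow s k (x + y)
  | ideal_pow_mul k a x : ideal_pow s k x -> ideal_pow s k (a * x).

Section IdealPow.
Variable s : seq A.
Notation J := (ideal_pow s).

Lemma ideal_powS k x : J k.+1 x -> J k x.
Proof.
suff gen m y : J m y -> forall l, m = l.+1 -> J l y by move=> /gen; apply.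
elim=> {m y} //.
- by move=> m c y cs Jy _ _ [<-]; apply: ideal_pow_mul.
- by move=> *; exact: ideal_pow_0.
- by move=> m y z _ IH1 _ IH2 l e; apply: ideal_pow_add; [exact: IH1|exact: IH2].
- by move=> m a y _ IH l e; apply/ideal_pow_mul/IH.
Qed.

Lemma ideal_pow_le k l x : (l <= k)%N -> J k x -> J l x.
Proof.
move=> /subnKC <-; elim: (k - l)%N x => [|n IHn] x; first by rewrite addn0.
by rewrite addnS => /ideal_powS/IHn.
Qed.

Lemma ideal_powM k l x y : J k x -> J l y -> J (k + l)%N (x * y).
Proof.
move=> + Jy; elim=> {k x}.
- by move=> z; apply: ideal_pow_mul.
- by move=> i c z cs _ IH; rewrite -mulrA addSn; apply: ideal_pow_gen.
- by move=> i; rewrite mul0r; apply: ideal_pow_0.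
- by move=> i z t _ IH1 _ IH2; rewrite mulrDl; apply: ideal_pow_add.
- by move=> i a z _ IH; rewrite -mulrA; apply: ideal_pow_mul.
Qed.

Lemma ideal_powMr k x a : J k x -> J k (x * a).
Proof. by rewrite mulrC; exact: ideal_pow_mul. Qed.

Lemma ideal_powN k x : J k x -> J k (- x).
Proof. by rewrite -mulN1r; exact: ideal_pow_mul. Qed.

Lemma ideal_powB k x y : J k x -> J k y -> J k (x - y).
Proof. by move=> Jx Jy; apply/ideal_pow_add/ideal_powN. Qed.

Lemma ideal_pow1 c : c \in s -> J 1 c.
Proof.
by move=> cs; rewrite -[c]mulr1; apply: ideal_pow_gen => //; exact: ideal_pow_all.
Qed.

End IdealPow.

Lemma ideal_pow_nil k x : ideal_pow [::] k.+1 x -> x = 0.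
Proof.
suff gen m y : ideal_pow [::] m y -> forall l, m = l.+1 -> y = 0.
  by move=> /gen; apply.
elim=> {m y} //.
- by move=> m y z _ IH1 _ IH2 l e; rewrite (IH1 l) // (IH2 l) // addr0.
- by move=> m a y _ IH l e; rewrite (IH l) // mulr0.
Qed.

(** Sorting by powers of [c]: the coefficient of c^a still lies in the (k - a)-th power of the ideal
    of [s], and the powers from c^K on disappear. *)
Lemma ideal_pow_cons c s K k x : c ^+ K = 0 -> ideal_pow (c :: s) k x ->
  exists y : nat -> A, (forall i : nat, ideal_pow s (k - i) (y i)) /\
    x = \sum_(a < K) c ^+ a * y a.
Proof.
move=> cK; elim=> {k x}.
- move=> x; case: K cK => [|K] cK.
    exists (fun=> 0); split=> [a|]; first exact: ideal_pow_0.
    by rewrite big_ord0 -[x]mul1r -(expr0 c) cK mul0r.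
  exists (fun i : nat => if i is 0%N then x else 0); split=> [[|a]|].
  + exact: ideal_pow_all.
  + exact: ideal_pow_0.
  + by rewrite big_ord_recl expr0 mul1r big1 ?addr0 // => i _; rewrite mulr0.
- move=> k d x; rewrite inE => /orP[/eqP->{d}|ds] _ [y [Jy ->]].
  (* A further factor [c] shifts the coefficients by one; the last one is lost to c^K = 0. *)
  + exists (fun i : nat => if i is b.+1 then y b else 0); split=> [[|a]|].
    * exact: ideal_pow_0.
    * by rewrite subSS.
    * case: K cK => [|K] cK; first by rewrite !big_ord0 mulr0.
      rewrite [RHS]big_ord_recl /= mulr0 add0r [X in c * X]big_ord_recr /= mulrDr mulrA -exprS cK.
      by rewrite mul0r addr0 mulr_sumr; apply: eq_bigr => i _; rewrite exprS mulrA.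
  + exists (fun i => d * y i); split=> [a|].
    * have [ka|ak] := leqP a k; first by rewrite subSn //; apply: ideal_pow_gen.
      by rewrite (_ : k.+1 - a = 0)%N ?subn_eq0; [exact: ideal_pow_all | lia].
    * by rewrite mulr_sumr; apply: eq_bigr => i _; rewrite mulrCA.
- move=> k; exists (fun=> 0); split=> [a|]; first exact: ideal_pow_0.
  by rewrite big1 // => i _; rewrite mulr0.
- move=> k x z _ [y [Jy ->]] _ [w [Jw ->]].
  exists (fun i => y i + w i); split=> [a|]; first exact: ideal_pow_add.
  by rewrite -big_split; apply: eq_bigr => i _; rewrite mulrDr.
- move=> k d x _ [y [Jy ->]].
  exists (fun i => d * y i); split=> [a|]; first exact: ideal_pow_mul.
  by rewrite mulr_sumr; apply: eq_bigr => i _; rewrite mulrCA.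
Qed.

(** The exponent N + K works: in each term c^a y_a with a < K, the factor y_a still lies in the N-th
    power of the smaller ideal. All successive approximations below terminate by this bound. *)
Lemma ideal_pow_nilpotent (s : seq A) : (forall c, c \in s -> nilpotent c) ->
  exists N, forall x, ideal_pow s N x -> x = 0.
Proof.
elim: s => [|c s IHs] nils; first by exists 1%N => x /ideal_pow_nil.
have [|N JN] := IHs; first by move=> d ds; apply: nils; rewrite inE ds orbT.
have [|K cK] := nils c; first exact: mem_head.
exists (N + K)%N => x /(ideal_pow_cons cK)[y [Jy ->]].
rewrite big1 // => i _; rewrite [y i]JN ?mulr0 //.
by apply: ideal_pow_le (Jy i); have := ltn_ord i; lia.
Qed.

Lemma nilpotent_seq (s : seq A) : (forall c, c \in s -> nilpotent c) ->
  exists N, forall c, c \in s -> c ^+ N = 0.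
Proof.
move=> /ideal_pow_nilpotent[N JN]; exists N => c cs; apply: JN.
elim: N => [|N IHN]; first exact: ideal_pow_all.
by rewrite exprS; exact: ideal_pow_gen.
Qed.

Lemma ideal_pow1_nilpotent (s : seq A) x : (forall c, c \in s -> nilpotent c) ->
  ideal_pow s 1 x -> nilpotent x.
Proof.
move=> nils.
suff gen m y : ideal_pow s m y -> m = 1%N -> nilpotent y by move=> /gen; apply.
elim=> {m y} //.
- by move=> m c y cs _ _ _; apply/nilpotentMr/nils.
- by move=> *; exact: nilpotent0.
- by move=> m y z _ IH1 _ IH2 e; apply: nilpotentD; [exact: IH1|exact: IH2].
- by move=> m a y _ IH e; apply/nilpotentMl/IH.
Qed.

End Nilpotents.

(** * Prime ideals and the nilradical *)

Section Primes.
Variable A : comPzRingType.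

Definition is_ideal (I : set A) : Prop :=
  [/\ I 0, forall x y, I x -> I y -> I (x + y) & forall a x, I x -> I (a * x)].

(** An ideal that is maximal among those containing [I] and avoiding all powers of [s] is prime. *)
Lemma exists_prime (I : set A) (s : A) : is_ideal I ->
    (forall n, ~ I (s ^+ n)) ->
  exists p : Spec A, I `<=` p /\ ~ p s.
Proof.
move=> [I0 ID IM] Is.
(* The conditions bear on the union of [X] with [I], so that the union of the empty chain, which is
   empty, satisfies them too. *)
pose P (X : set A) :=
  [/\ I `<=` X `|` I, is_ideal (X `|` I) & forall n, ~ (X `|` I) (s ^+ n)].
have [F FP totF|p [[Ip [p0 pD pM] ps] pmax]] := @Zorn_bigcup A P.
  split.
  - by move=> x Ix; right.
  - split; first by right.
    + move=> x y [[X FX Xx]|Ix] [[Y FY Yy]|Iy]; last by right; apply: ID.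
      * have [XY|YX] := totF _ _ FX FY.
          have [_ [_ YD _] _] := FP _ FY.
          have [||?|?] := YD x y; [by left; apply: XY|by left| |by right].
          by left; exists Y.
        have [_ [_ XD _] _] := FP _ FX.
        have [||?|?] := XD x y; [by left|by left; apply: YX| |by right].
        by left; exists X.
      * have [_ [_ XD _] _] := FP _ FX.
        have [||?|?] := XD x y; [by left|by right| |by right].
        by left; exists X.
      * have [_ [_ YD _] _] := FP _ FY.
        have [||?|?] := YD x y; [by right|by left| |by right].
        by left; exists Y.
    + move=> a x [[X FX Xx]|Ix]; last by right; apply: IM.
      have [_ [_ _ XM] _] := FP _ FX.
      by have [|?|?] := XM a x; [by left|left; exists X|by right].
  - move=> n [[X FX Xs]|]; last exact: Is.
    by have [_ _ /(_ n)] := FP _ FX; apply; left.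
have pIp : I `<=` p.
  apply: contrapT => nIp.
  apply: (pmax (p `|` I)).
    split; first by move=> x; left.
    by move=> pI; apply: nIp => x Ix; apply: pI; right.
  by split; rewrite -?setUA setUid.
have pE : p `|` I = p by apply/setUidPl.
rewrite pE in p0 pD pM ps.
(* [Q a] is the ideal p + a A; for [a] outside [p], maximality forces it to meet the powers of
   [s]. *)
pose Q a : set A := [set x | exists b y, p y /\ x = a * b + y].
have Qid a : is_ideal (Q a).
  split.
  - by exists 0, 0; rewrite mulr0 addr0.
  - move=> x y [b [z [pz ->]]] [b' [z' [pz' ->]]].
    by exists (b + b'), (z + z'); split; [exact: pD | ring].
  - move=> c x [b [z [pz ->]]].
    by exists (c * b), (c * z); split; [exact: pM | ring].
have big a : ~ p a -> exists n b y, p y /\ s ^+ n = a * b + y.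
  move=> pa; apply: contrapT => nex; apply: (pmax (Q a)).
    split; first by move=> x px; exists 0, x; rewrite mulr0 add0r.
    by move=> /(_ a); apply: contra_not pa => Qp; apply: Qp; exists 1, 0;
      rewrite mulr1 addr0.
  have QI : Q a `|` I = Q a.
    by apply/setUidPl => x /pIp px; exists 0, x; rewrite mulr0 add0r.
  split; rewrite ?QI //; first by rewrite -QI => x; right.
  by move=> n [b [y [py e]]]; apply: nex; exists n, b, y.
have prim x y : p (x * y) -> p x \/ p y.
  move=> pxy; apply: contrapT => /not_orP[/big[n [b [z [pz e]]]]].
  move=> /big[n' [b' [z' [pz' e']]]]; apply: (ps (n + n')%N).
  rewrite exprD e e'.
  have -> : (x * b + z) * (y * b' + z') =
    b * b' * (x * y) + ((x * b) * z' + (y * b' + z') * z) by ring.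
  by apply: (pD _ _ (pM _ _ pxy)); apply: pD; apply: pM.
exists (PrimeIdeal p0 pD pM (ps 0%N) prim); split=> //=.
exact: ps 1%N.
Qed.

Lemma prime_sum (p : Spec A) (I : Type) (r : seq I) (P : pred I) (F : I -> A) :
  (forall i, P i -> p (F i)) -> p (\sum_(i <- r | P i) F i).
Proof.
move=> pF; apply: big_ind => //; first exact: prime_mem0.
by move=> *; exact: prime_memD.
Qed.

Lemma primeN (p : Spec A) x : p x -> p (- x).
Proof. by rewrite -mulN1r; exact: prime_memMl. Qed.

Lemma primeB (p : Spec A) x y : p x -> p y -> p (x - y).
Proof. by move=> px py; apply/prime_memD/primeN. Qed.

Lemma nilpotent_prime (p : Spec A) x : nilpotent x -> p x.
Proof.
move=> [n]; elim: n => [|n IHn] xn.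
  by case: (@prime_mem1 _ p); rewrite -(expr0 x) xn; exact: prime_mem0.
have := prime_mem0 p; rewrite -xn exprS => /prime_memM[//|].
by elim: n {IHn xn} => [/prime_mem1//|n IHn]; rewrite exprS => /prime_memM[//|].
Qed.

Lemma nilpotentP x : nilpotent x <-> forall p : Spec A, p x.
Proof.
split=> [nx p|px]; first exact: nilpotent_prime.
apply: contrapT => nx.
have [|n xn|p [_ /(_ (px p))//]] := @exists_prime [set 0] x.
  by split=> // [y z -> ->|a z ->]; rewrite /= ?addr0 ?mulr0.
by apply: nx; exists n.
Qed.

Lemma prime_invertible (p : Spec A) x : invertible x -> ~ p x.
Proof.
move=> [y xy] px; apply: (@prime_mem1 _ p).
by rewrite -xy mulrC; exact: prime_memMl.
Qed.

End Primes.

(** * Laurent series *)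

Section LaurentBasics.
Variable A : comPzRingType.
Implicit Types (f g h : laurent A) (a b : A) (i j m n : int).

Lemma lcoefD f g i : (f + g) i = f i + g i. Proof. by []. Qed.
Lemma lcoefN f i : (- f) i = - f i. Proof. by []. Qed.
Lemma lcoefB f g i : (f - g) i = f i - g i. Proof. by []. Qed.
Lemma lcoef1 i : (1 : laurent A) i = (i == 0)%:R. Proof. by []. Qed.
Lemma lcoefZ a f i : (a *: f) i = a * f i. Proof. by []. Qed.
Lemma lcoef_monom a m i : monom a m i = a *+ (i == m). Proof. by []. Qed.
Lemma lcoef_deriv f i : lderiv f i = f (i + 1) *~ (i + 1). Proof. by []. Qed.
Lemma lcoefM f g i :
  (f * g) i = \sum_(j \in [set: int]) f j * g (i - j). Proof. by []. Qed.

Lemma lcoef_sum (I : Type) (r : seq I) (P : pred I) (F : I -> laurent A) i :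
  (\sum_(k <- r | P k) F k) i = \sum_(k <- r | P k) F k i.
Proof. by elim/big_rec2: _ => // k x y _ <-. Qed.

Lemma lcoefM_ind (P : A -> Prop) f g i : P 0 ->
    (forall x y, P x -> P y -> P (x + y)) ->
    (forall j, P (f j * g (i - j))) ->
  P ((f * g) i).
Proof. by move=> P0 PD Pfg; rewrite lcoefM; apply: big_ind. Qed.

Lemma lcoefM_window f g (M N K : nat) i :
    (forall j, j < - M%:Z -> f j = 0) -> (forall j, j < - N%:Z -> g j = 0) ->
    i + M%:Z + N%:Z < K%:Z ->
  (f * g) i = \sum_(k < K) f (k%:Z - M%:Z) * g (i - (k%:Z - M%:Z)).
Proof.
move=> fM gN iK; rewrite lcoefM (@fsum_window _ _ M K) //.
  by move=> j jM; rewrite fM ?mul0r.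
by move=> j jK; rewrite gN ?mulr0 //; lia.
Qed.

Lemma lcoefM_single f g i m :
  (forall j, j != m -> f j * g (i - j) = 0) -> (f * g) i = f m * g (i - m).
Proof.
move=> fg; rewrite lcoefM -(@fsbig_widen _ _ _ _ [set m]) ?fsbig_set1 //.
by move=> j [_ /= /eqP jm]; exact: fg.
Qed.

Lemma lcoef_monomM a m f i : (monom a m * f) i = a * f (i - m).
Proof.
rewrite (lcoefM_single (m := m)); first by rewrite lcoef_monom eqxx.
by move=> j /negPf jm; rewrite lcoef_monom jm mulr0n mul0r.
Qed.

Lemma monomM a b m n : monom a m * monom b n = monom (a * b) (m + n).
Proof.
apply/laurentP => i; rewrite lcoef_monomM !lcoef_monom -mulrnAr.
by congr (_ * (_ *+ nat_of_bool _)); lia.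
Qed.

Lemma monom1 : monom 1 0 = 1 :> laurent A. Proof. by []. Qed.

Lemma monom0 m : monom 0 m = 0 :> laurent A.
Proof. by apply/laurentP => i; rewrite lcoef_monom mul0rn. Qed.

Lemma monomD a b m : monom (a + b) m = monom a m + monom b m.
Proof. by apply/laurentP => i; rewrite /= mulrnDl. Qed.

Lemma monomN a m : monom (- a) m = - monom a m.
Proof. by apply/laurentP => i; rewrite /= mulNrn. Qed.

Lemma monomX a m k : monom a m ^+ k = monom (a ^+ k) (m *+ k).
Proof.
elim: k => [|k IHk]; first by rewrite !expr0 mulr0n.
by rewrite !exprS IHk monomM mulrS.
Qed.

Lemma scale_monom a b m : a *: monom b m = monom (a * b) m.
Proof. by apply/laurentP => i; rewrite /= mulrnAr. Qed.

Lemma scale_monomM a f : a *: f = monom a 0 * f.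
Proof. by apply/laurentP => i; rewrite lcoef_monomM subr0. Qed.

Lemma lscalerAl a f g : a *: (f * g) = a *: f * g.
Proof. by rewrite !scale_monomM mulrA. Qed.

Lemma monomE a m : monom a m = a *: monom 1 m.
Proof. by rewrite scale_monom mulr1. Qed.

Lemma invertible_monom a m : invertible a -> invertible (monom a m).
Proof. by move=> [b ab]; exists (monom b (- m)); rewrite monomM ab subrr. Qed.

Definition lconst a : laurent A := monom a 0.

Fact lconst_is_zmod_morphism : zmod_morphism lconst.
Proof. by move=> a b; rewrite /lconst monomD monomN. Qed.
Fact lconst_is_monoid_morphism : monoid_morphism lconst.
Proof. by split=> // a b; rewrite /lconst monomM. Qed.

HB.instance Definition _ := GRing.isZmodMorphism.Build A (laurent A) lconst
  lconst_is_zmod_morphism.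
HB.instance Definition _ := GRing.isMonoidMorphism.Build A (laurent A) lconst
  lconst_is_monoid_morphism.

Lemma lcoef_monomMK a m f i : (monom a m * f) (i + m) = a * f i.
Proof. by rewrite lcoef_monomM addrK. Qed.

Lemma in_tpow0 n : in_tpow n (0 : laurent A). Proof. by []. Qed.
Lemma in_tpowD n f g : in_tpow n f -> in_tpow n g -> in_tpow n (f + g).
Proof. by move=> fn gn i ni; rewrite lcoefD fn // gn // addr0. Qed.
Lemma in_tpowN n f : in_tpow n f -> in_tpow n (- f).
Proof. by move=> fn i ni; rewrite lcoefN fn // oppr0. Qed.
Lemma in_tpowB n f g : in_tpow n f -> in_tpow n g -> in_tpow n (f - g).
Proof. by move=> fn gn; apply/in_tpowD/in_tpowN. Qed.
Lemma in_tpowW m n f : m <= n -> in_tpow n f -> in_tpow m f.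
Proof. by move=> mn fn i im; apply: fn; lia. Qed.
Lemma in_tpowM m n f g : in_tpow m f -> in_tpow n g -> in_tpow (m + n) (f * g).
Proof.
move=> fm gn i imn; apply: (lcoefM_ind (P := fun x => x = 0)) => //.
  by move=> x y -> ->; rewrite addr0.
move=> j; have [jm|jm] := ltP j m; first by rewrite fm ?mul0r.
by rewrite gn ?mulr0 //; lia.
Qed.
Lemma in_tpowMl n f g : in_tpow 0 f -> in_tpow n g -> in_tpow n (f * g).
Proof. by move=> f0 gn; rewrite -[n]add0r; exact: in_tpowM. Qed.
Lemma in_tpowMr n f g : in_tpow n f -> in_tpow 0 g -> in_tpow n (f * g).
Proof. by move=> f0 gn; rewrite -[n]addr0; exact: in_tpowM. Qed.
Lemma in_tpowZ n a f : in_tpow n f -> in_tpow n (a *: f).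
Proof. by move=> fn i ni; rewrite lcoefZ fn // mulr0. Qed.
Lemma in_tpow_sum n (I : Type) (r : seq I) (P : pred I) (F : I -> laurent A) :
  (forall k, P k -> in_tpow n (F k)) -> in_tpow n (\sum_(k <- r | P k) F k).
Proof.
by move=> nF; apply: big_ind; [exact: in_tpow0|exact: in_tpowD|].
Qed.
Lemma in_tpow_monom a m n : n <= m -> in_tpow n (monom a m).
Proof. by move=> nm i ni; rewrite lcoef_monom lt_eqF ?mulr0n //; lia. Qed.
Lemma in_tpow1 : in_tpow 0 (1 : laurent A).
Proof. exact: in_tpow_monom. Qed.
Lemma in_tpow_prod (I : Type) (r : seq I) (P : pred I) (F : I -> laurent A) :
  (forall k, P k -> in_tpow 0 (F k)) -> in_tpow 0 (\prod_(k <- r | P k) F k).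
Proof.
by move=> nF; apply: big_ind; [exact: in_tpow1|move=> *; exact: in_tpowMl|].
Qed.
Lemma in_tpowX n f k : in_tpow n f -> in_tpow (n *+ k) (f ^+ k).
Proof.
move=> fn; elim: k => [|k IHk]; first by rewrite mulr0n expr0; exact: in_tpow1.
by rewrite exprS mulrS; exact: in_tpowM.
Qed.

Lemma in_tpow_bound f : exists m, in_tpow m f.
Proof. exact: laurent_bound. Qed.

Lemma in_tpow_all f : (forall n, in_tpow n f) -> f = 0.
Proof. by move=> fn; apply/laurentP => i; apply: (fn (i + 1)); lia. Qed.

Lemma in_tpow_sym n f g : in_tpow n (f - g) -> in_tpow n (g - f).
Proof. by move=> fg; rewrite -opprB; exact: in_tpowN. Qed.

Lemma in_tpow_trans n g f h :
  in_tpow n (f - g) -> in_tpow n (g - h) -> in_tpow n (f - h).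
Proof. by move=> fg gh; rewrite -(subrKA g); exact: in_tpowD. Qed.

Lemma lcoef_lead m n f g : in_tpow m f -> in_tpow n g ->
  (f * g) (m + n) = f m * g n.
Proof.
move=> fm gn; rewrite (lcoefM_single (m := m)).
  by congr (_ * g _); lia.
move=> j jm; have [jlm|jlm] := ltP j m; first by rewrite fm ?mul0r.
by rewrite gn ?mulr0 //; lia.
Qed.

Lemma monom_shift n f : f = monom 1 n * (monom 1 (- n) * f).
Proof. by rewrite mulrA monomM mulr1 subrr mul1r. Qed.

Lemma in_tpow_shift n m f : in_tpow m f -> in_tpow (m + n) (monom 1 n * f).
Proof. by move=> fm; rewrite addrC; apply: in_tpowM => //; exact: in_tpow_monom. Qed.

(** Consecutive differences suffice because the topology is non-archimedean. Coefficient [i] is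
    stable from index [K (i + 1)] on, and comparison with [s (K 0)] bounds the limit below. *)
Lemma laurent_complete (s : nat -> laurent A) :
    (forall n, exists K, forall k, (K <= k)%N -> in_tpow n (s k.+1 - s k)) ->
  exists L, forall n, exists K, forall k, (K <= k)%N -> in_tpow n (s k - L).
Proof.
move=> /choice[K sK].
have sKl n k l : (K n <= k)%N -> (k <= l)%N -> in_tpow n (s l - s k).
  move=> Kk /subnKC <-; elim: (l - k)%N => [|d IHd]; first by rewrite addn0 subrr.
  by rewrite addnS; apply: in_tpow_trans IHd; apply: sK; lia.
have sKm m n k i : (K m <= k)%N -> i < m -> i < n -> s k i = s (K n) i.
  move=> Kk im inn; have [kn|nk] := leqP k (K n).
    by apply/esym/eqP; rewrite -subr_eq0 -lcoefB (sKl m) // ?lexx.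
  by apply/eqP; rewrite -subr_eq0 -lcoefB (sKl n) // ltnW.
have bL : bounded_below (fun i => s (K (i + 1)) i).
  have [m sm] := laurent_bound (s (K 0)).
  exists (Num.min m 0) => i im; rewrite -(sKm 0 _ (K 0)) //; last 2 first.
  - lia.
  - lia.
  by apply: sm; lia.
exists (mkLaurent bL) => n; exists (K n) => k Kk i ni.
by rewrite lcoefB /= (sKm n (i + 1) k) ?subrr //; lia.
Qed.

Lemma invertible_1Btpow f : in_tpow 1 f ->
  exists g, [/\ (1 - f) * g = 1, in_tpow 0 g & g 0 = 1].
Proof.
move=> f1; have fX k : in_tpow k%:Z (f ^+ k).
  by rewrite -natz; apply: in_tpowX.
have [|g gE] := @laurent_complete (fun k => \sum_(i < k) f ^+ i).
  move=> n; exists `|n|%N => k nk; rewrite big_ord_recr /= addrAC subrr add0r.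
  by apply: in_tpowW (fX k); lia.
have e k : (1 - f) * (\sum_(i < k) f ^+ i) = 1 - f ^+ k.
  elim: k => [|k IHk]; first by rewrite big_ord0 mulr0 subrr.
  by rewrite big_ord_recr mulrDr IHk mulrBl mul1r -exprS addrA subrK.
have g0 : in_tpow 0 g.
  have [K /(_ K (leqnn K)) gK] := gE 0.
  rewrite -[g](subKr (\sum_(i < K) f ^+ i)); apply: in_tpowB => //.
  by apply: in_tpow_sum => i _; apply: in_tpowW (fX i); lia.
exists g; split=> //.
  apply/eqP; rewrite -subr_eq0; apply/eqP/in_tpow_all => n.
  have [K gK] := gE n; pose k := (K + `|n|)%N.
  have -> : (1 - f) * g - 1 = - ((1 - f) * (\sum_(i < k) f ^+ i - g) + f ^+ k).
    by rewrite mulrBr e; ring.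
  apply/in_tpowN/in_tpowD; last by apply: in_tpowW (fX k); lia.
  apply: in_tpowMl; last by apply: gK; lia.
  by apply: in_tpowB; [exact: in_tpow1 | apply: in_tpowW f1].
have [K gK] := gE 1; pose k := K.+1.
have -> : g 0 = (\sum_(i < k) f ^+ i) 0.
  by apply/esym/eqP; rewrite -subr_eq0 -lcoefB gK //; lia.
rewrite lcoef_sum big_ord_recl expr0 lcoef1 eqxx big1 ?addr0 // => i _.
by apply: (fX (lift ord0 i)); rewrite /= /bump; lia.
Qed.

Lemma unit_pseries f : in_tpow 0 f -> invertible (f 0) ->
  exists g, [/\ f * g = 1, in_tpow 0 g & f 0 * g 0 = 1].
Proof.
move=> f0 [c fc].
have [|g [fg g0 gE]] := @invertible_1Btpow (1 - c *: f).
  move=> i i1; rewrite lcoefB lcoef1 lcoefZ; case: eqP => [->|/eqP i0].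
    by rewrite mulrC fc subrr.
  by rewrite f0 ?mulr0 ?subrr //; lia.
exists (c *: g); split.
- by rewrite mulrC -lscalerAl mulrC lscalerAl -[c *: f](subKr 1).
- exact: in_tpowZ.
- by rewrite lcoefZ gE mulr1.
Qed.

(** The filtration of A((t)) by the powers of the ideal of [s]. An error vanishes once it has been
    pushed far enough into it. *)
Definition coef_in (s : seq A) (k : nat) f := forall i, ideal_pow s k (f i).

Section CoefIn.
Variable s : seq A.

Lemma coef_in0 k : coef_in s k 0. Proof. by move=> i; exact: ideal_pow_0. Qed.
Lemma coef_in_all f : coef_in s 0 f. Proof. by move=> i; exact: ideal_pow_all. Qed.
Lemma coef_inD k f g : coef_in s k f -> coef_in s k g -> coef_in s k (f + g).
Proof. by move=> fk gk i; apply: ideal_pow_add. Qed.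
Lemma coef_inN k f : coef_in s k f -> coef_in s k (- f).
Proof. by move=> fk i; apply: ideal_powN. Qed.
Lemma coef_inB k f g : coef_in s k f -> coef_in s k g -> coef_in s k (f - g).
Proof. by move=> fk gk i; apply: ideal_powB. Qed.
Lemma coef_inM k l f g :
  coef_in s k f -> coef_in s l g -> coef_in s (k + l) (f * g).
Proof.
move=> fk gl i; apply: lcoefM_ind; first exact: ideal_pow_0.
  by move=> x y; exact: ideal_pow_add.
by move=> j; exact: ideal_powM.
Qed.
Lemma coef_inMr k f g : coef_in s k f -> coef_in s k (f * g).
Proof. by move=> fk; rewrite -[k]addn0; apply: coef_inM => //; exact: coef_in_all. Qed.
Lemma coef_inMl k f g : coef_in s k g -> coef_in s k (f * g).
Proof. by rewrite mulrC; exact: coef_inMr. Qed.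
Lemma coef_in_le k l f : (l <= k)%N -> coef_in s k f -> coef_in s l f.
Proof. by move=> lk fk i; exact: ideal_pow_le (fk i). Qed.
Lemma coef_inX k f (n : nat) : coef_in s k f -> coef_in s (n * k) (f ^+ n).
Proof.
move=> fk; elim: n => [|n IHn]; first exact: coef_in_all.
by rewrite exprS mulSn; exact: coef_inM.
Qed.
Lemma coef_in_sum k (I : Type) (r : seq I) (P : pred I) (F : I -> laurent A) :
  (forall l, P l -> coef_in s k (F l)) -> coef_in s k (\sum_(l <- r | P l) F l).
Proof.
by move=> nF; apply: big_ind; [exact: coef_in0|exact: coef_inD|].
Qed.
Lemma coef_in_monom k a m : ideal_pow s k a -> coef_in s k (monom a m).
Proof.
move=> ak i; rewrite lcoef_monom; case: eqP => // _; exact: ideal_pow_0.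
Qed.
Lemma coef_in_nilpotent f : (forall c, c \in s -> nilpotent c) ->
  coef_in s 1 f -> nilpotent f.
Proof.
move=> nils f1; have [N JN] := ideal_pow_nilpotent nils.
exists N; apply/laurentP => i.
by apply: JN; have := coef_inX N f1; rewrite muln1; apply.
Qed.
End CoefIn.

Definition nil_tpow n f := forall i, i < n -> nilpotent (f i).

Lemma nil_tpowD n f g : nil_tpow n f -> nil_tpow n g -> nil_tpow n (f + g).
Proof. by move=> fn gn i ni; apply: nilpotentD; [exact: fn | exact: gn]. Qed.
Lemma nil_tpowN n f : nil_tpow n f -> nil_tpow n (- f).
Proof. by move=> fn i ni; apply/nilpotentN/fn. Qed.
Lemma nil_tpowB n f g : nil_tpow n f -> nil_tpow n g -> nil_tpow n (f - g).
Proof. by move=> fn gn; apply/nil_tpowD/nil_tpowN. Qed.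
Lemma nil_tpowW m n f : m <= n -> nil_tpow n f -> nil_tpow m f.
Proof. by move=> mn fn i im; apply: fn; lia. Qed.
Lemma nil_tpowM m n f g :
  nil_tpow m f -> nil_tpow n g -> nil_tpow (m + n) (f * g).
Proof.
move=> fm gn i imn; apply: (lcoefM_ind (P := @nilpotent A)).
- exact: nilpotent0.
- exact: nilpotentD.
move=> j; have [jm|jm] := ltP j m; first by apply/nilpotentMr/fm.
by apply/nilpotentMl/gn; lia.
Qed.
Lemma nil_tpow_sum n (I : Type) (r : seq I) (P : pred I) (F : I -> laurent A) :
  (forall k, P k -> nil_tpow n (F k)) -> nil_tpow n (\sum_(k <- r | P k) F k).
Proof.
move=> nF; apply: big_ind => //; last exact: nil_tpowD.
by move=> i _; exact: nilpotent0.
Qed.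
Lemma in_nil_tpow n f : in_tpow n f -> nil_tpow n f.
Proof. by move=> fn i ni; rewrite fn //; exact: nilpotent0. Qed.

(** A Laurent series has only finitely many nonzero coefficients below a given degree, so they
    generate an ideal to which [ideal_pow_nilpotent] applies. *)
Lemma nil_tpow_list n f : nil_tpow n f ->
  exists2 s : seq A, forall c, c \in s -> nilpotent c
    & forall i, i < n -> ideal_pow s 1 (f i).
Proof.
move=> fn; have [M fM] := laurent_boundN f.
exists [seq f (k%:Z - M%:Z) | k <- iota 0 (absz (Num.max 0 (n + M%:Z)))].
  by move=> c /mapP[k]; rewrite mem_iota => kn ->; apply: fn; lia.
move=> i ni; have [iM|iM] := ltP i (- M%:Z).
  by rewrite fM //; exact: ideal_pow_0.
apply: ideal_pow1; apply/mapP; exists (absz (i + M%:Z)); last by congr (f _); lia.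
by rewrite mem_iota; lia.
Qed.

(** The support is bounded on both sides: infinitely many nilpotent coefficients without a common
    exponent need not give a nilpotent series. *)
Lemma nil_laurent n f : in_tpow n f -> (forall i, nilpotent (f i)) ->
  (exists m, forall i, m <= i -> f i = 0) -> nilpotent f.
Proof.
move=> fn fnil [m fm].
have [|s nils fs] := @nil_tpow_list m f; first by move=> i _.
apply: (@coef_in_nilpotent s) => // i; have [im|im] := ltP i m; first exact: fs.
by rewrite fm //; exact: ideal_pow_0.
Qed.

End LaurentBasics.

(** * Limits in the t-adic topology *)

Section LaurentTopology.
Variable A : comPzRingType.
Implicit Types (f g L : laurent A) (s : nat -> laurent A).

Definition tadic_lim s L : Prop :=
  forall n, exists K, forall k, (K <= k)%N -> in_tpow n (s k - L).

Lemma tadic_cvgP s L : s @ \oo --> L <-> tadic_lim s L.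
Proof.
split=> [sL n|sL U [n _ nU]].
  have : nbhs L [set g | in_tpow n (g - L)] by exists n.
  by move=> /sL [K _ KP]; exists K => k Kk; apply: KP.
have [K KP] := sL n; exists K => // k /= Kk; apply: nU; exact: KP.
Qed.

Lemma tadic_lim_uniq s L L' : tadic_lim s L -> tadic_lim s L' -> L = L'.
Proof.
move=> sL sL'; apply/eqP; rewrite -subr_eq0; apply/eqP/in_tpow_all => n.
have [K KP] := sL n; have [K' KP'] := sL' n.
apply: (@in_tpow_trans _ _ (s (K + K')%N)); last by apply: KP'; lia.
by apply/in_tpow_sym/KP; lia.
Qed.

Lemma tadic_limE s L : tadic_lim s L -> lim (s @ \oo) = L.
Proof.
move=> sL; have cL : s @ \oo --> L by apply/tadic_cvgP.
by apply: (@tadic_lim_uniq s) => //; apply/tadic_cvgP; exact: (cvgP L cL).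
Qed.

Lemma tadic_lim_ext s s' L :
  (exists K, forall k, (K <= k)%N -> s k = s' k) -> tadic_lim s L -> tadic_lim s' L.
Proof.
move=> [K sK] sL n; have [K' K'P] := sL n; exists (K + K')%N => k Kk.
by rewrite -sK; [apply: K'P|]; lia.
Qed.

Lemma tadic_limM s s' L L' :
  tadic_lim s L -> tadic_lim s' L' -> tadic_lim (fun k => s k * s' k) (L * L').
Proof.
move=> sL sL' n.
have [m Lm] := in_tpow_bound L; have [m' Lm'] := in_tpow_bound L'.
pose N := (`|n| + `|m| + `|m'|)%N.
have [K KP] := sL N%:Z; have [K' KP'] := sL' N%:Z; exists (K + K')%N => k Kk.
have -> : s k * s' k - L * L' =
  (s k - L) * (s' k - L') + (s k - L) * L' + L * (s' k - L') by ring.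
have K1 : in_tpow N%:Z (s k - L) by apply: KP; lia.
have K2 : in_tpow N%:Z (s' k - L') by apply: KP'; lia.
apply: in_tpowD; [apply: in_tpowD|].
- by apply: in_tpowW (in_tpowM K1 K2); lia.
- by apply: in_tpowW (in_tpowM K1 Lm'); lia.
- by apply: in_tpowW (in_tpowM Lm K2); lia.
Qed.

Lemma tadic_lim_cst L : tadic_lim (fun=> L) L.
Proof. by move=> n; exists 0%N => k _; rewrite subrr. Qed.

Lemma tadic_limD s s' L L' :
  tadic_lim s L -> tadic_lim s' L' -> tadic_lim (fun k => s k + s' k) (L + L').
Proof.
move=> sL sL' n; have [K KP] := sL n; have [K' KP'] := sL' n.
exists (K + K')%N => k Kk; rewrite opprD addrACA.
by apply: in_tpowD; [apply: KP | apply: KP']; lia.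
Qed.

Lemma tadic_limZ s a L : tadic_lim s L -> tadic_lim (fun k => a *: s k) (a *: L).
Proof.
move=> sL n; have [K KP] := sL n; exists K => k Kk.
by rewrite -scalerBr; apply/in_tpowZ/KP.
Qed.

Lemma tadic_lim_in_tpow s L n :
  tadic_lim s L -> (exists K, forall k, (K <= k)%N -> in_tpow n (s k)) -> in_tpow n L.
Proof.
move=> sL [K sn]; have [K' K'P] := sL n.
rewrite -[L](subKr (s (K + K')%N)); apply: in_tpowB; first by apply: sn; lia.
by apply: K'P; lia.
Qed.

End LaurentTopology.

(** * Base change of Laurent series *)

Section LaurentMap.
Variables (A B : comPzRingType) (i : {rmorphism A -> B}).
Implicit Types (f g : laurent A).

Fact lmap_subproof f : bounded_below (fun n => i (f n)).
Proof. by have [m fm] := laurent_bound f; exists m => n nm; rewrite fm ?rmorph0. Qed.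

Definition lmap f : laurent B := mkLaurent (lmap_subproof f).

Lemma lcoef_map f n : lmap f n = i (f n). Proof. by []. Qed.

Fact lmap_is_zmod_morphism : zmod_morphism lmap.
Proof. by move=> f g; apply/laurentP => n; rewrite /= rmorphB. Qed.

Fact lmap_is_monoid_morphism : monoid_morphism lmap.
Proof.
split=> [|f g]; apply/laurentP => n; first by rewrite lcoef_map !lcoef1 rmorph_nat.
have [M fM] := laurent_boundN f; have [N gN] := laurent_boundN g.
rewrite lcoef_map.
rewrite (@lcoefM_window _ f g M N (`|n| + M + N + 1)) //; last lia.
rewrite (@lcoefM_window _ (lmap f) _ M N (`|n| + M + N + 1)) //; last first.
- lia.
- by move=> j jN; rewrite lcoef_map gN ?rmorph0.
- by move=> j jN; rewrite lcoef_map fM ?rmorph0.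
by rewrite rmorph_sum; apply: eq_bigr => k _; rewrite rmorphM.
Qed.

HB.instance Definition _ := GRing.isZmodMorphism.Build (laurent A) (laurent B)
  lmap lmap_is_zmod_morphism.
HB.instance Definition _ := GRing.isMonoidMorphism.Build (laurent A) (laurent B)
  lmap lmap_is_monoid_morphism.

Lemma lmap_monom a n : lmap (monom a n) = monom (i a) n.
Proof. by apply/laurentP => k; rewrite /= rmorphMn. Qed.

Lemma lmapZ a f : lmap (a *: f) = i a *: lmap f.
Proof. by apply/laurentP => k; rewrite /= rmorphM. Qed.

Lemma lmap_tpow n f : in_tpow n f -> in_tpow n (lmap f).
Proof. by move=> fn k kn; rewrite lcoef_map fn // rmorph0. Qed.

Lemma lmap_deriv f : lmap (lderiv f) = lderiv (lmap f).
Proof. by apply/laurentP => k; rewrite /= rmorphMz. Qed.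

Lemma nilpotent_map a : nilpotent a -> nilpotent (i a).
Proof. by move=> [n an]; exists n; rewrite -rmorphXn an rmorph0. Qed.

Lemma invertible_map a : invertible a -> invertible (i a).
Proof. by move=> [b ab]; exists (i b); rewrite -rmorphM ab rmorph1. Qed.

Lemma lmap_lim s L : tadic_lim s L -> tadic_lim (fun k => lmap (s k)) (lmap L).
Proof.
move=> sL n; have [K KP] := sL n; exists K => k Kk.
by rewrite -rmorphB; apply/lmap_tpow/KP.
Qed.

End LaurentMap.

(** * Plus and minus parts: Birkhoff factorization and Witt coordinates *)

Section Halves.
Variable A : comPzRingType.
Implicit Types (f g h m : laurent A) (a b c : A).

(* A[t^-1] *)
Definition in_zpoly f : Prop := forall i, 0 < i -> f i = 0.

Lemma in_zpoly0 : in_zpoly 0. Proof. by []. Qed.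
Lemma in_zpoly_monom a (n : int) : n <= 0 -> in_zpoly (monom a n).
Proof. by move=> n0 i i0; rewrite lcoef_monom gt_eqF ?mulr0n //; lia. Qed.
Lemma in_zpoly1 : in_zpoly 1. Proof. exact: in_zpoly_monom. Qed.
Lemma in_zpolyD f g : in_zpoly f -> in_zpoly g -> in_zpoly (f + g).
Proof. by move=> f0 g0 i i0; rewrite lcoefD f0 // g0 // addr0. Qed.
Lemma in_zpolyN f : in_zpoly f -> in_zpoly (- f).
Proof. by move=> f0 i i0; rewrite lcoefN f0 // oppr0. Qed.
Lemma in_zpolyB f g : in_zpoly f -> in_zpoly g -> in_zpoly (f - g).
Proof. by move=> f0 g0; apply/in_zpolyD/in_zpolyN. Qed.
Lemma in_zpolyZ a f : in_zpoly f -> in_zpoly (a *: f).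
Proof. by move=> f0 i i0; rewrite lcoefZ f0 // mulr0. Qed.
Lemma in_zpolyM f g : in_zpoly f -> in_zpoly g -> in_zpoly (f * g).
Proof.
move=> f0 g0 i i0; apply: (lcoefM_ind (P := fun x => x = 0)) => //.
  by move=> x y -> ->; rewrite addr0.
move=> j; have [jp|jn] := ltP 0 j; first by rewrite f0 ?mul0r.
by rewrite g0 ?mulr0 //; lia.
Qed.
Lemma in_zpoly_prod (I : Type) (r : seq I) (P : pred I) (F : I -> laurent A) :
  (forall k, P k -> in_zpoly (F k)) -> in_zpoly (\prod_(k <- r | P k) F k).
Proof.
by move=> nF; apply: big_ind; [exact: in_zpoly1|move=> *; exact: in_zpolyM|].
Qed.
Lemma in_zpoly_sum (I : Type) (r : seq I) (P : pred I) (F : I -> laurent A) :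
  (forall k, P k -> in_zpoly (F k)) -> in_zpoly (\sum_(k <- r | P k) F k).
Proof.
by move=> nF; apply: big_ind; [exact: in_zpoly0|move=> *; exact: in_zpolyD|].
Qed.
Lemma in_zpolyX f k : in_zpoly f -> in_zpoly (f ^+ k).
Proof.
move=> f0; elim: k => [|k IHk]; first exact: in_zpoly1.
by rewrite exprS; exact: in_zpolyM.
Qed.
Lemma zpoly_coef0M f g : in_zpoly f -> in_zpoly g -> (f * g) 0 = f 0 * g 0.
Proof.
move=> f0 g0; rewrite (lcoefM_single (m := 0)) ?subr0 // => j j0.
have [jp|jn] := ltP 0 j; first by rewrite f0 ?mul0r.
by rewrite g0 ?mulr0 //; lia.
Qed.
Lemma zpoly_pseries f : in_zpoly f -> in_tpow 0 f -> f = lconst (f 0).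
Proof.
move=> fz f0; apply/laurentP => i; rewrite lcoef_monom.
case: (ltgtP i 0) => [i0|i0|->] //; [exact: f0 | exact: fz].
Qed.

(* 1 + t A[[t]] *)
Definition is_pos h : Prop := in_tpow 0 h /\ h 0 = 1.

(* 1 + t^-1 Nil(A)[t^-1] *)
Definition is_neg m : Prop :=
  [/\ in_zpoly m, m 0 = 1 & forall i, i < 0 -> nilpotent (m i)].

Lemma is_pos1 : is_pos 1.
Proof. by split; [exact: in_tpow1 | rewrite lcoef1]. Qed.

Lemma pseries_coef0M f g : in_tpow 0 f -> in_tpow 0 g -> (f * g) 0 = f 0 * g 0.
Proof. by move=> f0 g0; rewrite -[0 in LHS]addr0 lcoef_lead. Qed.

Lemma is_posM f g : is_pos f -> is_pos g -> is_pos (f * g).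
Proof.
move=> [f0 f1] [g0 g1]; split; first exact: in_tpowMl.
by rewrite pseries_coef0M // f1 g1 mulr1.
Qed.

Lemma is_posV h : is_pos h -> exists2 h', is_pos h' & h * h' = 1.
Proof.
move=> [h0 h1]; have [|h' [hh' h'0 e]] := unit_pseries h0.
  by rewrite h1; exact: invertible1.
by exists h' => //; split=> //; rewrite -e h1 mul1r.
Qed.

Lemma is_pos_invertible h : is_pos h -> invertible h.
Proof. by move=> /is_posV[h' _ e]; exists h'. Qed.

Lemma is_pos_monom a (i : nat) : (0 < i)%N -> is_pos (1 - monom a i%:Z).
Proof.
move=> i0; split; first by apply: in_tpowB; apply: in_tpow_monom.
by rewrite lcoefB lcoef1 lcoef_monom eqxx lt_eqF ?subr0.
Qed.

Lemma is_neg1 : is_neg 1.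
Proof.
split; [exact: in_zpoly1 | by [] |] => i i0.
by rewrite lcoef1 lt_eqF //; exact: nilpotent0.
Qed.

Lemma is_negM f g : is_neg f -> is_neg g -> is_neg (f * g).
Proof.
move=> [fz f1 fn] [gz g1 gn]; split; first exact: in_zpolyM.
  by rewrite zpoly_coef0M // f1 g1 mulr1.
by rewrite -[0]addr0; exact: nil_tpowM.
Qed.

Lemma is_neg_nilpotent m : is_neg m -> nilpotent (1 - m).
Proof.
move=> [mz m1 mn]; have [k mk] := in_tpow_bound m.
apply: (@nil_laurent _ (Num.min k 0)).
- apply: in_tpowB; first by apply: in_tpowW (in_tpow1 _); lia.
  by apply: in_tpowW mk; lia.
- move=> i; rewrite lcoefB lcoef1; case: (ltgtP i 0) => [i0|i0|->].
  + by rewrite sub0r; apply/nilpotentN/mn.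
  + by rewrite mz ?subrr //; exact: nilpotent0.
  + by rewrite m1 subrr; exact: nilpotent0.
- by exists 1 => i i1; rewrite lcoefB lcoef1 mz ?subr0; last lia; case: eqP => //; lia.
Qed.

Lemma is_negV m : is_neg m -> exists2 m', is_neg m' & m * m' = 1.
Proof.
move=> mneg; have [K nK] := is_neg_nilpotent mneg; have [mz m1 mn] := mneg.
pose n := 1 - m; have m'z k : in_zpoly (n ^+ k).
  by apply/in_zpolyX/in_zpolyB => //; exact: in_zpoly1.
have e : m * (\sum_(i < K) n ^+ i) = 1.
  have -> : m = 1 - n by rewrite /n subKr.
  suff -> : (1 - n) * (\sum_(i < K) n ^+ i) = 1 - n ^+ K by rewrite nK subr0.
  elim: K {nK} => [|k IHk]; first by rewrite big_ord0 mulr0 subrr.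
  by rewrite big_ord_recr mulrDr IHk mulrBl mul1r -exprS addrA subrK.
have zs : in_zpoly (\sum_(i < K) n ^+ i) by apply: in_zpoly_sum => i _.
exists (\sum_(i < K) n ^+ i) => //; split=> //.
  by have := zpoly_coef0M mz zs; rewrite e m1 mul1r lcoef1.
apply: nil_tpow_sum => i _; elim: (i : nat) => [|k IHk].
  by rewrite expr0; have [_ _] := is_neg1.
rewrite exprS -[0]addr0; apply: nil_tpowM => //; apply: nil_tpowB => //.
by have [_ _] := is_neg1.
Qed.

Lemma is_neg_invertible m : is_neg m -> invertible m.
Proof. by move=> /is_negV[m' _ e]; exists m'. Qed.

Lemma is_neg_monom b (j : nat) : (0 < j)%N -> nilpotent b ->
  is_neg (1 - monom b (- j%:Z)).
Proof.
move=> j0 nb; split.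
- by apply: in_zpolyB; apply: in_zpoly_monom; lia.
- by rewrite lcoefB lcoef1 lcoef_monom eqxx gt_eqF ?subr0 //; lia.
- move=> i i0; rewrite lcoefB lcoef1 lcoef_monom lt_eqF // sub0r.
  by apply: nilpotentN; case: eqP => // _; exact: nilpotent0.
Qed.

Lemma is_neg_prod (I : eqType) (r : seq I) (F : I -> laurent A) :
  (forall k, k \in r -> is_neg (F k)) -> is_neg (\prod_(k <- r) F k).
Proof.
move=> nF; rewrite big_seq.
by apply: big_ind; [exact: is_neg1|exact: is_negM|].
Qed.

Lemma birkhoff_uniq m m' c c' h h' :
    is_neg m -> is_neg m' -> invertible c -> is_pos h -> is_pos h' ->
    m * (c *: h) = m' * (c' *: h') ->
  [/\ m = m', c = c' & h = h'].
Proof.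
move=> mn mn' [d cd] hp hp' e.
have [n [nz n0 nn] mm'] := is_negV mn'; have [g [gp g0] hh'] := is_posV hp.
have [mz m1 _] := mn; have [h'p h'1] := hp'.
have qE : m * n = c' *: h' * (d *: g).
  have cdE : c *: h * (d *: g) = 1.
    rewrite !scale_monomM mulrACA hh' mulr1 -[_ * _]/(lconst c * lconst d).
    by rewrite -rmorphM cd rmorph1.
  by rewrite -[m]mulr1 -cdE mulrA e mulrAC -mulrA mulrA [_ * n]mulrAC mm' mul1r.
have mn1 : m * n = 1.
  rewrite (@zpoly_pseries (m * n)).
  - by rewrite zpoly_coef0M // m1 n0 mulr1 rmorph1.
  - exact: in_zpolyM.
  - by rewrite qE; apply: in_tpowMl; apply: in_tpowZ.
have em : m = m'.
  by apply: (@inv_uniq _ n); rewrite mulrC.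
have ech : c *: h = c' *: h'.
  by move: e; rewrite em; apply/invertible_mulI/is_neg_invertible.
have ec : c = c'.
  have := congr1 (fun f : laurent A => f 0) ech.
  by rewrite /= (proj2 hp) h'1 !mulr1.
split=> //; move: ech; rewrite -ec => /(congr1 (fun f => d *: f)).
by rewrite !scalerA [d * c]mulrC cd !scale1r.
Qed.

Fact lcut_subproof (n : int) f : bounded_below (fun i => if i < n then 0 else f i).
Proof. by exists n => i ->. Qed.
Definition lcut n f := mkLaurent (lcut_subproof n f).

Lemma lcoef_cut n f i : lcut n f i = if i < n then 0 else f i. Proof. by []. Qed.

Lemma lcut_tpow n f : in_tpow n (lcut n f).
Proof. by move=> i ni; rewrite lcoef_cut ni. Qed.

Lemma lcut_in n s k f : coef_in s k f -> coef_in s k (lcut n f).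
Proof.
by move=> fk i; rewrite lcoef_cut; case: ifP => // _; exact: ideal_pow_0.
Qed.

Lemma lcoef_cutN n f i : (f - lcut n f) i = if i < n then f i else 0.
Proof. by rewrite lcoefB lcoef_cut; case: ifP; rewrite ?subr0 ?subrr. Qed.

(** Successive approximation f = m (1 + x) g, with [x] in growing powers of the ideal of the
    nilpotent coefficients: the polar part of [x] is moved into [m], the rest into [g]. *)
Lemma birkhoff f : nil_tpow 0 f -> invertible (f 0) ->
  exists m c h, [/\ is_neg m, invertible c, is_pos h & f = m * (c *: h)].
Proof.
move=> fnil f0; have [s nils fs] := nil_tpow_list fnil.
suff [m [g [mn g0 gu ->]]] : exists m g,
    [/\ is_neg m, in_tpow 0 g, invertible (g 0) & f = m * g].
  have [d gd] := gu; exists m, (g 0), (d *: g); split=> //.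
    by split; [exact: in_tpowZ | rewrite lcoefZ mulrC].
  by rewrite scalerA gd scale1r.
have [N JN] := ideal_pow_nilpotent nils.
suff H k : exists m g x, [/\ is_neg m, in_tpow 0 g, invertible (g 0),
    coef_in s k.+1 x & f = m * (1 + x) * g].
  have [m [g [x [mn g0 gu xN ->]]]] := H N; exists m, g; split=> //.
  have -> : x = 0 by apply/laurentP => i; apply/JN/ideal_powS/xN.
  by rewrite addr0 mulr1.
elim: k => [|k [m [g [x [mn g0 gu xk ->]]]]].
  have [|g' [gg' g'0 _]] := unit_pseries (@lcut_tpow 0 f); first by [].
  (* At the start [g] is the power series part of [f], and the error is the polar part divided by
     [g]. *)
  exists 1, (lcut 0 f), ((f - lcut 0 f) * g'); split.
  - exact: is_neg1.
  - exact: lcut_tpow.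
  - by [].
  - apply: coef_inMr => i; rewrite lcoef_cutN; case: ifP => [|_]; first exact: fs.
    exact: ideal_pow_0.
  - by rewrite mul1r mulrDl mul1r -mulrA [g' * _]mulrC gg' mulr1 addrC subrK.
pose xp := lcut 0 x; pose xn := x - xp.
have nx i : nilpotent (x i).
  by apply: ideal_pow1_nilpotent nils _; apply: ideal_pow_le (xk i).
have xnn : is_neg (1 + xn).
  split.
  - apply: in_zpolyD; first exact: in_zpoly1.
    by move=> i i0; rewrite lcoef_cutN ifF //; lia.
  - by rewrite lcoefD lcoef_cutN lcoef1 eqxx ltxx addr0.
  - by move=> i i0; rewrite lcoefD lcoef_cutN i0 lcoef1 lt_eqF // add0r.
have xp0 : in_tpow 0 (1 + xp).
  by apply: in_tpowD; [exact: in_tpow1 | exact: lcut_tpow].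
have xpu : invertible ((1 + xp) 0).
  by rewrite lcoefD lcoef1 lcoef_cut ltxx; exact: invertible1D.
have [v [xpv v0 _]] := unit_pseries xp0 xpu.
have [u un xnu] := is_negV xnn.
(* The product (1 + xn)(1 + xp) exceeds 1 + x by xn xp; dividing by both factors gives the new
   error, which lies in the power 2(k + 1). *)
exists (m * (1 + xn)), ((1 + xp) * g), (- (xn * xp) * (u * v)); split.
- exact: is_negM.
- exact: in_tpowMl.
- by rewrite pseries_coef0M //; exact: invertibleM.
- apply/coef_inMr/coef_inN; apply: (@coef_in_le _ _ (k.+1 + k.+1)); first lia.
  apply: coef_inM; last exact: lcut_in.
  by apply: coef_inB => //; exact: lcut_in.
rewrite -!mulrA; congr (_ * _); rewrite !mulrA; congr (_ * g).
have -> : (1 + xn) * (1 + - (xn * xp) * u * v) * (1 + xp) =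
  (1 + xn) * (1 + xp) - xn * xp * ((1 + xn) * u) * ((1 + xp) * v) by ring.
by rewrite xnu xpv !mulr1 /xn; ring.
Qed.

(** First-order expansion: all factors are 1 modulo the ideal, so every mixed term gains one more
    power of it. *)
Lemma prod_perturb s (I : Type) (r : seq I) (x e : I -> laurent A) (k : nat) :
    (0 < k)%N -> (forall i, coef_in s 1 (x i - 1)) -> (forall i, coef_in s k (e i)) ->
  coef_in s 1 (\prod_(i <- r) (x i + e i) - 1) /\
  coef_in s k.+1 (\prod_(i <- r) (x i + e i) - \prod_(i <- r) x i
                  - \sum_(i <- r) e i).
Proof.
move=> k0 x1 ek; elim: r => [|i r [IH1 IH2]].
  by rewrite !big_nil !subrr; split; exact: coef_in0.
rewrite !big_cons; set P := \prod_(j <- r) _ in IH1 IH2 *.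
set Q := \prod_(j <- r) _ in IH2 *; set S := \sum_(j <- r) _ in IH2 *.
split.
  have -> : (x i + e i) * P - 1 = (x i - 1) * P + (P - 1) + e i * P by ring.
  apply: coef_inD; [apply: coef_inD => //; exact: coef_inMr|].
  by apply: coef_inMr; apply: coef_in_le (ek i).
have -> : (x i + e i) * P - x i * Q - (e i + S) =
  x i * (P - Q - S) + (x i - 1) * S + e i * (P - 1) by ring.
apply: coef_inD; first apply: coef_inD; first exact: coef_inMl.
  by rewrite -add1n; apply: coef_inM => //; exact: coef_in_sum.
by rewrite -addn1; apply: coef_inM.
Qed.

(** Each round subtracts from [b j] the coefficient of degree -j of the error m - P. By
    [prod_perturb] this cancels the error up to the next power of the ideal. *)
Lemma witt_neg m : is_neg m -> exists (b : nat -> A) (L : nat),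
  [/\ forall j, nilpotent (b j), forall j, (L <= j)%N -> b j = 0
    & m = \prod_(1 <= j < L) (1 - monom (b j) (- j%:Z))].
Proof.
move=> mneg; have [mz m1 mn] := mneg.
have [s nils ms] := nil_tpow_list mn.
have [N JN] := ideal_pow_nilpotent nils.
suff H k : exists (b : nat -> A) (L : nat), [/\ forall j, ideal_pow s 1 (b j),
    forall j, (L <= j)%N -> b j = 0
    & coef_in s k.+1 (m - \prod_(1 <= j < L) (1 - monom (b j) (- j%:Z)))].
  have [b [L [b1 bL mb]]] := H N; exists b, L; split=> // [j|].
    exact: ideal_pow1_nilpotent nils (b1 j).
  apply/eqP; rewrite -subr_eq0; apply/eqP/laurentP => i.
  exact/JN/ideal_powS/mb.
elim: k => [|k [b [L [b1 bL mb]]]].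
  exists (fun=> 0), 1%N; split=> // [j|]; first exact: ideal_pow_0.
  rewrite big_geq // => i; rewrite lcoefB lcoef1.
  case: (ltgtP i 0) => [i0|i0|->]; first by rewrite subr0; exact: ms.
    by rewrite mz ?subr0 //; exact: ideal_pow_0.
  by rewrite m1 subrr; exact: ideal_pow_0.
set P := \prod_(1 <= j < L) _ in mb; pose e := m - P.
have Pn : is_neg P.
  rewrite /P big_nat; apply: big_ind; [exact: is_neg1|exact: is_negM|].
  move=> j /andP[j1 _]; apply: is_neg_monom => //.
  exact: ideal_pow1_nilpotent nils (b1 j).
have [Pz P1 _] := Pn.
have ez : in_zpoly e by exact: in_zpolyB.
have e0 : e 0 = 0 by rewrite lcoefB m1 P1 subrr.
have [K eK] := laurent_boundN e; pose L' := (L + K).+1.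
(* In the bound [L'], [L] accounts for the old coordinates and [K] for the error; index 0 lies
   outside the product. *)
exists (fun j => if j is 0 then 0 else b j - e (- j%:Z)), L'; split.
- by case=> [|j]; [exact: ideal_pow_0 | apply: ideal_powB => //; exact: ideal_pow_le (mb _)].
- case=> [//|j] Lj; rewrite bL; last lia.
  by rewrite eK ?subr0 //; lia.
pose x j := 1 - monom (b j) (- j%:Z); pose ee j := monom (e (- j%:Z)) (- j%:Z).
have PE : P = \prod_(1 <= j < L') x j.
  have [L0|L1] := leqP 1 L.
    rewrite (@big_cat_nat _ _ _ L) //=; last by lia.
    rewrite [X in _ * X]big1_seq ?mulr1 // => j.
    rewrite /= mem_index_iota => /andP[Lj _].
    by rewrite /x bL // monom0 subr0.
  rewrite /P big_geq; last lia.
  rewrite big_nat big1 // => j /andP[Lj _].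
  by rewrite /x bL ?monom0 ?subr0 //; lia.
have -> : \prod_(1 <= j < L') (1 - monom (if j is 0 then 0 else b j - e (- j%:Z)) (- j%:Z))
  = \prod_(1 <= j < L') (x j + ee j).
  rewrite [LHS]big_nat [RHS]big_nat; apply: eq_bigr => -[//|j] _.
  by rewrite /x /ee monomD monomN opprB addrA addrAC.
have eE : e = \sum_(1 <= j < L') ee j.
  apply/laurentP => i; rewrite lcoef_sum.
  case: (ltP i 0) => [i0|i0]; last first.
    rewrite big_nat big1 => [|j /andP[j1 _]]; last first.
      by rewrite lcoef_monom gt_eqF //; lia.
    by have [->//|i0'] := eqVneq i 0; apply: ez; lia.
  have [iK|iK] := ltP i (- K%:Z).
    rewrite eK // big_nat big1 // => j _; rewrite lcoef_monom.
    by case: eqP => // <-; rewrite eK.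
  rewrite (bigD1_seq `|i|%N) /=; last exact: iota_uniq; last first.
    by rewrite mem_index_iota; lia.
  rewrite big1 ?addr0 => [|j ji]; last by rewrite /= [i == _]negbTE //; lia.
  have -> : - (`|i|%N)%:Z = i by lia.
  by rewrite eqxx.
have [|||_] := @prod_perturb s _ (index_iota 1 L') x ee k.+1 => //.
- move=> j; rewrite /x addrAC subrr add0r; apply/coef_inN/coef_in_monom/b1.
- by move=> j; apply/coef_in_monom/mb.
rewrite -PE -eE => Hp.
have -> : m - \prod_(1 <= j < L') (x j + ee j) =
   - (\prod_(1 <= j < L') (x j + ee j) - P - e) by rewrite /e; ring.
exact: coef_inN.
Qed.

(** That [h] is the infinite product of the 1 - a_i t^i, expressed by congruences modulo t^n for its
    finite subproducts instead of a limit. *)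
Definition witt_coords (a : nat -> A) h : Prop :=
  forall n : nat, in_tpow n%:Z (\prod_(1 <= i < n) (1 - monom (a i) i%:Z) - h).

Lemma witt_pos h : is_pos h -> exists a : nat -> A, witt_coords a h.
Proof.
move=> hp; pose linv f : laurent A := xget 0 [set g | f * g = 1].
(* [R n] is [h] divided by its first [n] factors. It is 1 modulo t^(n+1), and its coefficient in
   that degree is minus the next coordinate. *)
pose R := fix R n := if n is n'.+1 then R n' * linv (1 + monom (R n' n%:Z) n%:Z)
                     else h.
have Rstep n : is_pos (R n) -> in_tpow n.+1%:Z (R n - 1) ->
    is_pos (R n.+1) /\ in_tpow n.+2%:Z (R n.+1 - 1) /\
    R n = (1 - monom (- R n n.+1%:Z) n.+1%:Z) * R n.+1.
  move=> Rp Rn; pose c := R n n.+1%:Z; pose q := 1 + monom c n.+1%:Z.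
  have qp : is_pos q.
    have -> : q = 1 - monom (- c) n.+1%:Z by rewrite monomN opprK.
    exact: is_pos_monom.
  have [q' q'p qq'] := is_posV qp.
  have qE : linv q = q'.
    have e : q * linv q = 1 by rewrite /linv; case: xgetP => [//|/(_ q')].
    exact: inv_uniq e qq'.
  have RE : R n.+1 = R n * q' by rewrite /= -/q qE.
  have RM : R n = q * R n.+1 by rewrite RE mulrCA qq' mulr1.
  split; first by rewrite RE; exact: is_posM.
  split; last by rewrite monomN opprK.
  have -> : R n.+1 - 1 = (R n - q) * q' by rewrite RE mulrBl qq'.
  apply: in_tpowMr; last by case: q'p.
  move=> i ni; rewrite /q opprD addrA lcoefB lcoef_monom.
  case: (ltgtP i n.+1%:Z) => [lin|lin|->].
  - by rewrite Rn // subr0.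
  - lia.
  - by rewrite lcoefB lcoef1 subr0 subrr.
have Rp n : is_pos (R n) /\ in_tpow n.+1%:Z (R n - 1).
  elim: n => [|n [IH1 IH2]]; last by have [? []] := Rstep n IH1 IH2.
  split=> // i i1; rewrite lcoefB lcoef1; case: eqP => [->|/eqP i0].
    by rewrite (proj2 hp) subrr.
  by rewrite subr0 (proj1 hp) //; lia.
exists (fun i => - R i.-1 i%:Z) => -[|n].
  rewrite big_geq //; apply: in_tpowB; [exact: in_tpow1 | exact: (proj1 hp)].
set P := \prod_(1 <= i < n.+1) _.
have [hE Ppos] : h = P * R n /\ is_pos P.
  rewrite /P; elim: n {P} => [|n [IH1 IH2]].
    by rewrite big_geq // mul1r; split=> //; exact: is_pos1.
  rewrite big_nat_recr //=; split; last by apply: is_posM => //; exact: is_pos_monom.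
  have [_ [_ e]] := Rstep n (proj1 (Rp n)) (proj2 (Rp n)).
  by rewrite -mulrA -[X in _ * (_ * X)]/(R n.+1) -e.
rewrite [X in _ - X]hE -{1}[P]mulr1 -mulrBr.
apply: in_tpowMl; first by case: Ppos.
by apply: in_tpow_sym; exact: (proj2 (Rp n)).
Qed.

End Halves.

(** * Values at nilpotent elements and roots of binomials *)

Section Evaluation.
Variable A : comPzRingType.
Implicit Types (f g h m q : laurent A) (a b c : A).

Lemma lcoef_const a i : lconst a i = a *+ (i == 0). Proof. by []. Qed.

Definition nilord b : nat := xget 0%N [set K : nat | b ^+ K = 0].

Lemma nilordP b : nilpotent b -> b ^+ nilord b = 0.
Proof. by move=> [K bK]; rewrite /nilord; case: xgetP => [//|/(_ K)]. Qed.

(* f(b), for b nilpotent; 0 otherwise. *)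
Definition ev b f : A := \sum_(k < nilord b) f k%:Z * b ^+ k.

(* (f(t) - f(b)) / (t - b) *)
Fact divdiff_subproof b f : bounded_below (fun i => if i < 0 then 0 else
  \sum_(l < nilord b) f (i + l%:Z + 1) * b ^+ l).
Proof. by exists 0 => i ->. Qed.

Definition divdiff b f := mkLaurent (divdiff_subproof b f).

Lemma lcoef_divdiff b f i : divdiff b f i =
  if i < 0 then 0 else \sum_(l < nilord b) f (i + l%:Z + 1) * b ^+ l.
Proof. by []. Qed.

Lemma divdiff_tpow b f : in_tpow 0 (divdiff b f).
Proof. by move=> i i0; rewrite lcoef_divdiff i0. Qed.

Lemma evP b f : nilpotent b -> in_tpow 0 f ->
  f - lconst (ev b f) = (monom 1 1 - lconst b) * divdiff b f.
Proof.
move=> nb f0; apply/laurentP => i.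
rewrite mulrBl lcoefB lcoefB !lcoef_monomM mul1r subr0 lcoef_monom.
(* A telescoping sum whose last term contains b^K = 0 for K = [nilord b]. If K = 0, the ring is
   zero. *)
have key (k : int) : 0 <= k -> f k = \sum_(l < nilord b) f (k + l%:Z) * b ^+ l -
    b * \sum_(l < nilord b) f (k + l%:Z + 1) * b ^+ l.
  move=> k0; have := nilordP nb; case: (nilord b) => [|K] bK.
    by rewrite !big_ord0 mulr0 subr0 -[f k]mulr1 -[1](expr0 b) bK mulr0.
  rewrite [X in _ = X - _]big_ord_recl [X in _ = _ - _ * X]big_ord_recr /=.
  rewrite expr0 mulr1 addr0 mulrDr [b * (_ * b ^+ K)]mulrCA -exprS bK !mulr0 addr0.
  rewrite mulr_sumr -[LHS]addr0 -addrA; congr (_ + _).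
  rewrite -sumrB big1 // => l _; rewrite mulrCA -exprS.
  by rewrite (_ : k + _ = k + l%:Z + 1) ?subrr // /bump /=; lia.
have [i0|i0|->] := ltgtP i 0.
- by rewrite f0 // !lcoef_divdiff !ifT ?mulr0 ?subrr //; lia.
- rewrite subr0 [LHS]key ?(ltW i0) // !lcoef_divdiff !ifF; [|lia|lia].
  by congr (_ - _); apply: eq_bigr => l _; congr (f _ * _); lia.
- rewrite !lcoef_divdiff /= sub0r mulr1n [f 0]key //.
  rewrite /ev; under [X in X - _ - _]eq_bigr do rewrite add0r.
  by rewrite addrAC subrr sub0r.
Qed.

(** The value at [b] is the remainder modulo t - b, so that later each rule for [ev] needs only a
    quotient. For uniqueness let d = (t - b) r with d constant and b^(K+1) = 0. Multiplication by
    the sum of the t^(K-i) b^i gives t^(K+1) r on one side, and the coefficients of t^K say d =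
    0. *)
Lemma ev_uniq b c f q : nilpotent b -> in_tpow 0 f -> in_tpow 0 q ->
  f - lconst c = (monom 1 1 - lconst b) * q -> ev b f = c.
Proof.
move=> nb f0 q0 e; have := evP nb f0; have := divdiff_tpow b f.
move: (divdiff b f) (ev b f) => q' c' q'0 e'; apply/eqP; rewrite -subr_eq0.
have {e e'} : lconst (c' - c) = (monom 1 1 - lconst b) * (q - q').
  by rewrite mulrBr -e -e' rmorphB; ring.
have : in_tpow 0 (q - q') by exact: in_tpowB.
move: (c' - c) (q - q') => d r r0 e.
have [[|K] bK] := nb; first by rewrite -[d]mulr1 -(expr0 b) bK mulr0.
have := subrXX (monom 1 1) (lconst b) K.+1.
rewrite -rmorphXn bK rmorph0 subr0 => tK.
have : monom 1 1 ^+ K.+1 * r =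
    lconst d * (\sum_(i < K.+1) monom 1 1 ^+ (K - i) * lconst b ^+ i).
  by rewrite tK e /=; ring.
move=> /(congr1 (fun f : laurent A => f K%:Z)).
rewrite monomX expr1n natz lcoef_monomM mul1r r0; last lia.
rewrite lcoef_monomM subr0 lcoef_sum big_ord_recl big1 ?addr0 => [|i _].
  by rewrite subn0 expr0 mulr1 monomX expr1n lcoef_monom natz eqxx mulr1 => <-.
rewrite monomX expr1n natz lcoef_monomM mul1r -rmorphXn lcoef_const gt_eqF //.
by rewrite lift0; have := ltn_ord i; lia.
Qed.

Lemma ev_const b c : nilpotent b -> ev b (lconst c) = c.
Proof.
move=> nb; apply: (@ev_uniq _ _ _ 0) => //; first exact: in_tpow_monom.
by rewrite subrr mulr0.
Qed.

Lemma evD b f g : nilpotent b -> in_tpow 0 f -> in_tpow 0 g ->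
  ev b (f + g) = ev b f + ev b g.
Proof.
move=> nb f0 g0; apply: (@ev_uniq _ _ _ (divdiff b f + divdiff b g)) => //.
- exact: in_tpowD.
- by apply: in_tpowD; exact: divdiff_tpow.
- by rewrite mulrDr -!evP // rmorphD; ring.
Qed.

Lemma evM b f g : nilpotent b -> in_tpow 0 f -> in_tpow 0 g ->
  ev b (f * g) = ev b f * ev b g.
Proof.
move=> nb f0 g0.
apply: (@ev_uniq _ _ _ (divdiff b f * g + lconst (ev b f) * divdiff b g)) => //.
- exact: in_tpowMl.
- apply: in_tpowD; apply: in_tpowMl => //; try exact: divdiff_tpow.
  exact: in_tpow_monom.
- rewrite mulrDr mulrA -evP // [lconst _ * divdiff b g]mulrC mulrA -evP // rmorphM.
  by ring.
Qed.

Lemma evN b f : nilpotent b -> in_tpow 0 f -> ev b (- f) = - ev b f.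
Proof.
move=> nb f0; apply: (@ev_uniq _ _ _ (- divdiff b f)) => //.
- exact: in_tpowN.
- by apply: in_tpowN; exact: divdiff_tpow.
- by rewrite mulrN -evP // rmorphN; ring.
Qed.

Lemma ev1 b : nilpotent b -> ev b 1 = 1.
Proof. by move=> nb; rewrite -[1 in LHS](rmorph1 (@lconst A)) ev_const. Qed.

Lemma ev_t b : nilpotent b -> ev b (monom 1 1) = b.
Proof.
move=> nb; apply: (@ev_uniq _ _ _ 1) => //; last by rewrite mulr1.
  exact: in_tpow_monom.
exact: in_tpow1.
Qed.

Lemma ev_monom b a (i : nat) : nilpotent b -> ev b (monom a i%:Z) = a * b ^+ i.
Proof.
move=> nb; rewrite -[a in LHS]mulr1 -[i%:Z]add0r -monomM evM //; last first.
- exact: in_tpow_monom.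
- exact: in_tpow_monom.
rewrite -/(lconst a) ev_const //; congr (_ * _).
elim: i => [|i IHi]; first by rewrite expr0 -/(lconst 1) ev_const.
rewrite exprS -IHi -[X in _ = X * _](ev_t nb) -evM //; [|exact: in_tpow_monom..].
by rewrite monomM mul1r; congr (ev b (monom _ _)); lia.
Qed.

Lemma ev_1Bmonom b a (i : nat) : nilpotent b ->
  ev b (1 - monom a i%:Z) = 1 - a * b ^+ i.
Proof.
move=> nb; rewrite evD //; [|exact: in_tpow1|apply: in_tpowN; exact: in_tpow_monom].
by rewrite evN ?ev1 ?ev_monom //; exact: in_tpow_monom.
Qed.

Lemma ev_prod b (I : Type) (r : seq I) (F : I -> laurent A) :
    nilpotent b -> (forall i, in_tpow 0 (F i)) ->
  ev b (\prod_(i <- r) F i) = \prod_(i <- r) ev b (F i).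
Proof.
move=> nb F0; elim: r => [|i r IHr]; first by rewrite !big_nil ev1.
by rewrite !big_cons evM // ?IHr //; exact: in_tpow_prod.
Qed.

Lemma ev_tpow b f (K : nat) : b ^+ K = 0 -> in_tpow K%:Z f -> ev b f = 0.
Proof.
move=> bK fK; have nb : nilpotent b by exists K.
rewrite (monom_shift K%:Z f) evM ?ev_monom ?bK ?mulr0 ?mul0r //.
  exact: in_tpow_monom.
by rewrite -[0](subrr K%:Z); exact: in_tpow_shift.
Qed.

(** Both sides are the double sum of f_(k+l+1) b^l c^k. In [pseries_generic] this symmetry makes two
    pairings cancel. *)
Lemma divdiff_sym b c f : ev c (divdiff b f) = ev b (divdiff c f).
Proof.
rewrite /ev; under eq_bigr do rewrite lcoef_divdiff /= mulr_suml.
rewrite exchange_big /=; apply: eq_bigr => l _.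
rewrite mulr_suml; apply: eq_bigr => k _.
by rewrite mulrAC; congr (f _ * _ * _); lia.
Qed.

(* Elements of A[t^-1] are polynomials in z = t^-1; [zev a m] is the value of m
   at z = a. *)
Definition zord m : nat :=
  xget 0%N [set K : nat | forall k : nat, (K <= k)%N -> m (- k%:Z) = 0].

Lemma zordP m (k : nat) : (zord m <= k)%N -> m (- k%:Z) = 0.
Proof.
rewrite /zord; case: xgetP => [K _ mK /mK//|no _].
have [M mM] := laurent_boundN m; case: (no M.+1) => l Ml.
by apply: mM; lia.
Qed.

Definition zev a m : A := \sum_(k < zord m) m (- k%:Z) * a ^+ k.

(** The series is the quotient of m - m(a) by z - a, where z = t^-1. Here [a] is arbitrary, since
    [m] will be a polynomial in z. *)
Fact zdivdiff_subproof a m : bounded_below (fun i => if 0 < i then 0 else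
  \sum_(l < zord m) m (i - l%:Z - 1) * a ^+ l).
Proof.
have [M mM] := laurent_boundN m; exists (- M%:Z) => i iM.
case: ifP => // _; rewrite big1 // => l _.
by rewrite mM ?mul0r //; lia.
Qed.

Definition zdivdiff a m := mkLaurent (zdivdiff_subproof a m).

Lemma lcoef_zdivdiff a m i : zdivdiff a m i =
  if 0 < i then 0 else \sum_(l < zord m) m (i - l%:Z - 1) * a ^+ l.
Proof. by []. Qed.

Lemma zdivdiff_zpoly a m : in_zpoly (zdivdiff a m).
Proof. by move=> i i0; rewrite lcoef_zdivdiff i0. Qed.

Lemma zord_sum a m (n : nat) (K : nat) : (zord m <= K)%N ->
  \sum_(l < K) m (- (n + l)%:Z) * a ^+ l = \sum_(l < zord m) m (- (n + l)%:Z) * a ^+ l.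
Proof.
move=> mK; rewrite -(big_mkord xpredT (fun l => m (- (n + l)%:Z) * a ^+ l)).
rewrite (@big_cat_nat _ _ _ (zord m)) //= big_mkord [X in _ + X]big1_seq ?addr0 //.
move=> l; rewrite /= mem_index_iota => /andP[ml _].
by rewrite zordP ?mul0r //; lia.
Qed.

Lemma zevP a m : in_zpoly m ->
  m - lconst (zev a m) = (monom 1 (- 1) - lconst a) * zdivdiff a m.
Proof.
move=> mz; apply/laurentP => i.
rewrite mulrBl lcoefB lcoefB !lcoef_monomM mul1r subr0 opprK lcoef_monom.
have key (k : nat) : m (- k%:Z) = \sum_(l < zord m) m (- (k + l)%:Z) * a ^+ l -
    a * \sum_(l < zord m) m (- (k.+1 + l)%:Z) * a ^+ l.
  rewrite -(@zord_sum a m k (zord m).+1) // big_ord_recl expr0 mulr1 addn0.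
  rewrite mulr_sumr -addrA -sumrB big1 ?addr0 // => l _.
  by rewrite mulrCA -exprS addnS addSn subrr.
have [i0|i0|->] := ltgtP i 0.
- rewrite mulr0n subr0 !lcoef_zdivdiff !ifF; [|lia|lia].
  have -> : m i = m (- (`|i|%N)%:Z) by congr (m _); lia.
  rewrite [LHS]key; congr (_ - _ * _); apply: eq_bigr => l _;
  by congr (m _ * _); lia.
- by rewrite mz // !lcoef_zdivdiff !ifT ?mulr0 ?subrr //; lia.
- rewrite !lcoef_zdivdiff /= sub0r mulr1n (key 0%N).
  rewrite /zev addrAC subrr sub0r; congr (- (_ * _)).
  by apply: eq_bigr => l _; congr (m _ * _); lia.
Qed.

(** The remainder modulo z - a is unique: if d = (z - a) r with d constant, then r_(i+1) = a r_i for
    i < 0. Starting below the support, this gives r_0 = 0, and degree 0 then gives d = 0. *)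
Lemma zev_uniq a c m q : in_zpoly m -> in_zpoly q ->
  m - lconst c = (monom 1 (- 1) - lconst a) * q -> zev a m = c.
Proof.
move=> m0 q0 e; have := zevP a m0; have := zdivdiff_zpoly a m.
move: (zdivdiff a m) (zev a m) => q' c' q'0 e'; apply/eqP; rewrite -subr_eq0.
have {e e'} : lconst (c' - c) = (monom 1 (- 1) - lconst a) * (q - q').
  by rewrite mulrBr -e -e' rmorphB; ring.
have : in_zpoly (q - q') by exact: in_zpolyB.
move: (c' - c) (q - q') => d r r0 e.
have er i : (lconst d) i = r (i + 1) - a * r i.
  by rewrite e mulrBl lcoefB !lcoef_monomM mul1r subr0 opprK.
have [M rM] := laurent_boundN r.
have rz (k : nat) : r (k%:Z - M%:Z - 1) = 0.
  elim: k => [|k IHk]; first by apply: rM; lia.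
  have [kM|kM] := ltP (k%:Z - M%:Z - 1) 0; last by apply: r0; lia.
  have := er (k%:Z - M%:Z - 1); rewrite IHk mulr0 subr0 lcoef_monom lt_eqF //.
  by rewrite mulr0n => ->; congr (r _); lia.
have := er 0; rewrite lcoef_monom eqxx mulr1n r0 // sub0r => ->.
have -> : r 0 = r ((M.+1)%:Z - M%:Z - 1) by congr (r _); lia.
by rewrite rz mulr0 oppr0.
Qed.

Lemma zev_const a c : zev a (lconst c) = c.
Proof.
apply: (@zev_uniq _ _ _ 0) => //; first exact: in_zpoly_monom.
by rewrite subrr mulr0.
Qed.

Lemma zevD a f g : in_zpoly f -> in_zpoly g -> zev a (f + g) = zev a f + zev a g.
Proof.
move=> f0 g0; apply: (@zev_uniq _ _ _ (zdivdiff a f + zdivdiff a g)) => //.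
- exact: in_zpolyD.
- by apply: in_zpolyD; exact: zdivdiff_zpoly.
- by rewrite mulrDr -!zevP // rmorphD; ring.
Qed.

Lemma zevM a f g : in_zpoly f -> in_zpoly g -> zev a (f * g) = zev a f * zev a g.
Proof.
move=> f0 g0.
apply: (@zev_uniq _ _ _ (zdivdiff a f * g + lconst (zev a f) * zdivdiff a g)) => //.
- exact: in_zpolyM.
- apply: in_zpolyD; apply: in_zpolyM => //; try exact: zdivdiff_zpoly.
  exact: in_zpoly_monom.
- rewrite mulrDr mulrA -zevP // [lconst _ * zdivdiff a g]mulrC mulrA -zevP // rmorphM.
  by ring.
Qed.

Lemma zevN a f : in_zpoly f -> zev a (- f) = - zev a f.
Proof.
move=> f0; apply: (@zev_uniq _ _ _ (- zdivdiff a f)) => //.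
- exact: in_zpolyN.
- by apply: in_zpolyN; exact: zdivdiff_zpoly.
- by rewrite mulrN -zevP // rmorphN; ring.
Qed.

Lemma zev1 a : zev a 1 = 1.
Proof. by rewrite -[1 in LHS](rmorph1 (@lconst A)) zev_const. Qed.

Lemma zev_z a : zev a (monom 1 (- 1)) = a.
Proof.
apply: (@zev_uniq _ _ _ 1) => //; last by rewrite mulr1.
  exact: in_zpoly_monom.
exact: in_zpoly1.
Qed.

Lemma zev_monom a c (i : nat) : zev a (monom c (- i%:Z)) = c * a ^+ i.
Proof.
have zi k : in_zpoly (monom 1 (- k%:Z) : laurent A) by apply: in_zpoly_monom; lia.
rewrite -[c in LHS]mulr1 -[- i%:Z]add0r -monomM zevM //; last exact: in_zpoly_monom.
rewrite -/(lconst c) zev_const //; congr (_ * _).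
elim: i => [|i IHi]; first by rewrite expr0 oppr0 -/(lconst 1) zev_const.
rewrite exprS -IHi -[X in _ = X * _](zev_z a) -zevM //; last exact: in_zpoly_monom.
by rewrite monomM mul1r; congr (zev a (monom _ _)); lia.
Qed.

Lemma zev_1Bmonom a c (i : nat) : zev a (1 - monom c (- i%:Z)) = 1 - c * a ^+ i.
Proof.
have zi : in_zpoly (monom c (- i%:Z)) by apply: in_zpoly_monom; lia.
rewrite zevD //; [|exact: in_zpoly1|exact: in_zpolyN].
by rewrite zevN ?zev1 ?zev_monom.
Qed.

Lemma zev_prod a (I : Type) (r : seq I) (F : I -> laurent A) :
    (forall i, in_zpoly (F i)) ->
  zev a (\prod_(i <- r) F i) = \prod_(i <- r) zev a (F i).
Proof.
move=> F0; elim: r => [|i r IHr]; first by rewrite !big_nil zev1.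
by rewrite !big_cons zevM // ?IHr //; exact: in_zpoly_prod.
Qed.

Lemma zdivdiff_sym a c m : zev c (zdivdiff a m) = zev a (zdivdiff c m).
Proof.
(* Both evaluations are summed up to the common bound [zord m], which makes the double sum visibly
   symmetric. *)
have E a' c' : zev c' (zdivdiff a' m) =
    \sum_(k < zord m) zdivdiff a' m (- k%:Z) * c' ^+ k.
  rewrite /zev; have [le|lt] := leqP (zord (zdivdiff a' m)) (zord m).
    by have := @zord_sum c' (zdivdiff a' m) 0 _ le; under eq_bigr do rewrite add0n;
       under [in RHS]eq_bigr do rewrite add0n.
  rewrite -(big_mkord xpredT (fun k => zdivdiff a' m (- k%:Z) * c' ^+ k)).
  rewrite (@big_cat_nat _ _ _ (zord m)) //=; last exact: ltnW.
  rewrite big_mkord [X in _ + X]big1_seq ?addr0 // => k.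
  rewrite /= mem_index_iota => /andP[mk _].
  rewrite ifF; last lia.
  rewrite big1 ?mul0r // => l _.
  have -> : - k%:Z - l%:Z - 1 = - (k + l + 1)%N%:Z by lia.
  by rewrite zordP ?mul0r //; lia.
have zi (k : nat) : 0 < - k%:Z = false by lia.
rewrite !E; under eq_bigr do rewrite lcoef_zdivdiff zi mulr_suml.
rewrite exchange_big /=; apply: eq_bigr => l _.
rewrite zi mulr_suml; apply: eq_bigr => k _.
by rewrite mulrAC; congr (m _ * _ * _); lia.
Qed.

End Evaluation.

Section EvaluationMap.
Variables (A B : comPzRingType) (i : {rmorphism A -> B}).

Lemma lmap_zpoly (m : laurent A) : in_zpoly m -> in_zpoly (lmap i m).
Proof. by move=> mz k k0; rewrite lcoef_map mz ?rmorph0. Qed.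

Lemma lmap_const (c : A) : lmap i (lconst c) = lconst (i c).
Proof. exact: lmap_monom. Qed.

Lemma zev_map (a : A) (m : laurent A) : in_zpoly m ->
  i (zev a m) = zev (i a) (lmap i m).
Proof.
move=> m0; apply/esym/(@zev_uniq _ _ _ _ (lmap i (zdivdiff a m))).
- exact: lmap_zpoly.
- by apply: lmap_zpoly; exact: zdivdiff_zpoly.
rewrite -lmap_const -rmorphB zevP // rmorphM rmorphB /= lmap_monom rmorph1.
by rewrite lmap_const.
Qed.

Lemma is_pos_map h : is_pos h -> is_pos (lmap i h).
Proof. by move=> [h0 h1]; split; [exact: lmap_tpow | rewrite lcoef_map h1 rmorph1]. Qed.

Lemma is_neg_map m : is_neg m -> is_neg (lmap i m).
Proof.
move=> [mz m1 mn]; split; first exact: lmap_zpoly.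
  by rewrite lcoef_map m1 rmorph1.
by move=> k k0; rewrite lcoef_map; apply/nilpotent_map/mn.
Qed.

End EvaluationMap.

(** * Splitting polynomials over faithful extensions *)

Section PolynomialSplitting.
Import Pdiv.CommonRing Pdiv.RingMonic.

Lemma qpoly_horner (A : comNzRingType) (h q : {poly A}) :
  (map_poly (qpolyC h) q).['qX] = in_qpoly h q.
Proof.
elim/poly_ind: q => [|q c IHq]; first by rewrite !rmorph0 horner0.
rewrite rmorphD rmorphM /= map_polyX map_polyC /= hornerD hornerMX hornerC IHq.
rewrite rmorphD rmorphM /=; congr (_ + _); apply/val_inj => /=.
by rewrite rmodp_small // size_polyC; apply: leq_ltn_trans (size_mk_monic_gt1 h); case: eqP.
Qed.

(** The class of X is a root of p in A[X]/(p), and [A] embeds there because p is monic; the cofactor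
    is again monic, of smaller degree. *)
Lemma poly_split (A : comNzRingType) (p : {poly A}) : p \is monic ->
  exists (B : comNzRingType) (i : {rmorphism A -> B}) (rs : seq B),
    injective i /\ map_poly i p = \prod_(r <- rs) ('X - r%:P).
Proof.
move: {2}(size p) (leqnn (size p)) => n; elim: n A p => [|n IHn] A p pn pm.
  by move: (monic_neq0 pm); rewrite -size_poly_eq0 -leqn0 pn.
have [p1|p1] := leqP (size p) 1.
  exists A, (idfun : {rmorphism A -> A}), [::]; split=> //; rewrite big_nil map_poly_id //.
  have /size1_polyC pE := p1; move: pm; rewrite pE monicE lead_coefC => /eqP ->.
  by [].
have pE : mk_monic p = p by rewrite /mk_monic p1 pm.
pose B := {poly %/ p}; pose i : {rmorphism A -> B} := qpolyC p.
have ii : injective i by move=> a b /(congr1 val) /polyC_inj.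
have /factor_theorem[q qE] : root (map_poly i p) ('qX : B).
  apply/eqP; rewrite qpoly_horner; apply: val_inj => /=.
  by rewrite pE rmodpp.
have qm : q \is monic.
  have : map_poly i p \is monic by exact: monic_map.
  by rewrite qE monicMr ?monicXsubC.
have qs : (size q <= n)%N.
  have := size_map_inj_poly ii (rmorph0 i) p; rewrite qE.
  rewrite size_Mmonic ?polyXsubC_eq0 ?monicXsubC //; last first.
    by apply: monic_neq0.
  by rewrite size_XsubC addn2 /= => e; rewrite -ltnS e.
have [C [j [rs [jj qj]]]] := IHn B q qs qm.
exists C, (j \o i : {rmorphism A -> C}), (j 'qX :: rs); split; first exact: inj_comp.
rewrite map_poly_comp /= [map_poly _ p]qE rmorphM /= qj big_cons mulrC.
by rewrite rmorphB /= map_polyX map_polyC.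
Qed.

End PolynomialSplitting.

Lemma laurent_nonzero (B : comNzRingType) : (1 : laurent B) != 0.
Proof.
apply/eqP => /(congr1 (fun f : laurent B => f 0)); rewrite lcoef1 => /eqP.
by rewrite oner_eq0.
Qed.

HB.instance Definition _ (B : comNzRingType) :=
  GRing.PzSemiRing_isNonZero.Build (laurent B) (laurent_nonzero B).

(** The list holds the roots of X^n - b with multiplicity. Both factorizations are recorded because
    the one in t is evaluated at nilpotent elements by [ev], the one in t^-1 at arbitrary elements
    by [zev]. *)
Record binomial_roots (A : comPzRingType) (n : nat) (b : A) (rs : seq A) : Prop :=
  BinomialRoots {
    roots_size : size rs = n;
    roots_exp : forall r, r \in rs -> r ^+ n = b;
    roots_pos : 1 - monom b n%:Z = \prod_(r <- rs) (1 - monom r 1);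
    roots_neg : 1 - monom b (- n%:Z) = \prod_(r <- rs) (1 - monom r (- 1)) }.

Lemma binomial_roots_map (A B : comPzRingType) (i : {rmorphism A -> B}) n b rs :
  binomial_roots n b rs -> binomial_roots n (i b) (map i rs).
Proof.
move=> [sz ex po ne]; split; first by rewrite size_map.
- by move=> _ /mapP[r rrs ->]; rewrite -rmorphXn ex.
- have -> : 1 - monom (i b) n%:Z = lmap i (1 - monom b n%:Z).
    by rewrite rmorphB rmorph1 /= lmap_monom.
  rewrite po rmorph_prod big_map.
  by apply: eq_bigr => r _; rewrite rmorphB rmorph1 /= lmap_monom.
- have -> : 1 - monom (i b) (- n%:Z) = lmap i (1 - monom b (- n%:Z)).
    by rewrite rmorphB rmorph1 /= lmap_monom.
  rewrite ne rmorph_prod big_map.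
  by apply: eq_bigr => r _; rewrite rmorphB rmorph1 /= lmap_monom.
Qed.

Lemma binomial_split (A : comPzRingType) (n : nat) (b : A) : (0 < n)%N ->
  exists (B : comPzRingType) (i : {rmorphism A -> B}) (rs : seq B),
    injective i /\ binomial_roots n (i b) rs.
Proof.
move=> n0; have [A0|A0] := eqVneq (1 : A) 0.
  have eA (x y : A) : x = y by rewrite -[x]mul1r -[y]mul1r A0 !mul0r.
  have eL (f g : laurent A) : f = g by apply/laurentP => k; exact: eA.
  exists A, (idfun : {rmorphism A -> A}), (nseq n 0); split=> //.
  split; [exact: size_nseq | by move=> r _; exact: eA | exact: eL | exact: eL].
pose A' : comNzRingType := HB.pack A (GRing.PzSemiRing_isNonZero.Build A A0).
have pm : ('X^n - (b : A')%:P : {poly A'}) \is monic by exact: monicXnsubC.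
have [B [i [rs [ii e]]]] := poly_split pm.
exists B, (i : {rmorphism A -> B}), rs; split=> //.
have {}e : 'X^n - (i b)%:P = \prod_(r <- rs) ('X - r%:P).
  by rewrite -e rmorphB /= map_polyXn map_polyC.
have sz : size rs = n.
  have := congr1 (fun p : {poly B} => size p) e.
  by rewrite size_XnsubC // size_prod_XsubC => -[].
have ex (x : laurent B) : x ^+ n - lconst (i b) = \prod_(r <- rs) (x - lconst r).
  have := congr1 (fun p => (map_poly (@lconst B) p).[x]) e.
  rewrite rmorphB /= map_polyXn map_polyC /= hornerD hornerXn hornerN hornerC.
  move=> ->; rewrite rmorph_prod horner_prod; apply: eq_bigr => r _.
  by rewrite rmorphB /= map_polyX map_polyC /= hornerXsubC.
(* This is x^n - b at x = t^(-k), multiplied by t^(kn); it is used for k = 1 and k = -1. *)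
have main (k : int) : 1 - monom (i b) (k *+ n) = \prod_(r <- rs) (1 - monom r k).
  have -> : 1 - monom (i b) (k *+ n) =
      monom 1 k ^+ n * (monom 1 (- k) ^+ n - lconst (i b)).
    rewrite mulrBr -exprMn monomM mulr1 subrr expr1n /lconst; congr (_ - _).
    by rewrite monomX expr1n monomM mul1r addr0.
  have -> : monom 1 k ^+ n * (monom 1 (- k) ^+ n - lconst (i b)) =
      \prod_(r <- rs) (monom 1 k * (monom 1 (- k) - lconst r)).
    by rewrite ex -sz; elim: (rs) => [|r s IHs]; rewrite ?big_nil ?mulr1 //= !big_cons
       exprS mulrACA IHs.
  apply: eq_bigr => r _.
  by rewrite mulrBr monomM mulr1 subrr /lconst monomM mul1r addr0.
split=> //.
- move=> r rrs; have := congr1 (fun p : {poly B} => p.[r]) e.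
  rewrite hornerD hornerXn hornerN hornerC horner_prod => /eqP.
  rewrite (big_rem r) //= hornerXsubC subrr mul0r subr_eq0 => /eqP.
  by [].
- by rewrite -main natz.
- by rewrite -main mulNrn natz.
Qed.

(** * The factors of the symbol and the roots of binomials *)

(** The factor with indices i, j of the double product in the symbol. The values (1 - a)^j at i = 0
    and (1 - b)^i at j = 0 are where Euclid's algorithm ends. *)
Definition local_factor (A : comPzRingType) (i j : nat) (a b : A) : A :=
  (1 - a ^+ (j %/ gcdn i j) * b ^+ (i %/ gcdn i j)) ^+ gcdn i j.

(** One Euclidean step, the counterpart of a r^i = (a b) r^(i-j) when r^j = b: the exponents of [b]
    add up to i divided by the gcd. *)
Lemma local_factor_subl (A : comPzRingType) (i j : nat) (a b : A) : (j <= i)%N ->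
  (0 < j)%N -> local_factor (i - j) j (a * b) b = local_factor i j a b.
Proof.
move=> ji j0; have gE : gcdn (i - j) j = gcdn i j.
  by rewrite gcdnC [RHS]gcdnC -[in RHS](subnK ji) gcdnDr.
rewrite /local_factor gE; congr ((1 - _) ^+ _).
rewrite exprMn -mulrA -exprD divnBr ?dvdn_gcdr //; congr (_ * _ ^+ _).
by rewrite subnKC // leq_div2r.
Qed.

Lemma local_factorC (A : comPzRingType) (i j : nat) (a b : A) :
  local_factor i j a b = local_factor j i b a.
Proof. by rewrite /local_factor gcdnC mulrC. Qed.

Lemma local_factor_map (A B : comPzRingType) (h : {rmorphism A -> B}) i j a b :
  h (local_factor i j a b) = local_factor i j (h a) (h b).
Proof. by rewrite rmorphXn rmorphB rmorph1 rmorphM !rmorphXn. Qed.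

(* Both sides are the product of the (1 - r r') over all pairs of roots. *)
Lemma roots_swap (A : comPzRingType) (i j : nat) (a b : A) (rs rs' : seq A) :
    nilpotent b -> (0 < j)%N -> binomial_roots i a rs -> binomial_roots j b rs' ->
  \prod_(r' <- rs') (1 - a * r' ^+ i) = \prod_(r <- rs) (1 - b * r ^+ j).
Proof.
move=> nb j0 [_ _ rpos _] [_ r'b _ rneg].
have nr' r' : r' \in rs' -> nilpotent r'.
  by move=> /r'b e; apply: (@nilpotent_of_exp _ _ j); rewrite e.
transitivity (\prod_(r' <- rs') \prod_(r <- rs) (1 - r * r')).
  rewrite !big_seq; apply: eq_bigr => r' r'rs.
  have nr := nr' _ r'rs; rewrite -ev_1Bmonom // rpos ev_prod // => [|r].
    by apply: eq_bigr => r _; rewrite (@ev_1Bmonom _ _ _ 1) // expr1.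
  by apply: in_tpowB; [exact: in_tpow1 | exact: in_tpow_monom].
rewrite exchange_big; apply: eq_bigr => r _.
rewrite -zev_1Bmonom rneg zev_prod => [|r'].
  by apply: eq_bigr => r' _; rewrite (@zev_1Bmonom _ _ _ 1) expr1 mulrC.
by apply: in_zpolyB; [exact: in_zpoly1 | exact: in_zpoly_monom].
Qed.

Lemma prod_const_seq (A : comPzRingType) (T : Type) (s : seq T) (x : A) :
  \prod_(r <- s) x = x ^+ size s.
Proof. by elim: s => [|y s IHs]; rewrite ?big_nil // big_cons IHs exprS. Qed.

(* Euclid's algorithm: r^j = b reduces i modulo j, and [roots_swap] exchanges
   the two exponents, after splitting the other binomial. *)
Lemma prod_roots (n : nat) (A : comPzRingType) (i j : nat) (a b : A) (rs : seq A) :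
    (i + j <= n)%N -> nilpotent b ->
  ((0 < j)%N -> binomial_roots j b rs ->
     \prod_(r <- rs) (1 - a * r ^+ i) = local_factor i j a b) /\
  ((0 < i)%N -> binomial_roots i a rs ->
     \prod_(r <- rs) (1 - b * r ^+ j) = local_factor i j a b).
Proof.
elim: n A i j a b rs => [|n IHn] A i j a b rs ijn nb.
  by split; [have -> : j = 0%N by lia | have -> : i = 0%N by lia].
(* The ring is a variable, since the remaining case of each claim is settled in an extension where
   the other binomial splits. *)
have step1 (B : comPzRingType) (a' b' : B) rs' : nilpotent b' -> (0 < j <= i)%N ->
    binomial_roots j b' rs' ->
    \prod_(r <- rs') (1 - a' * r ^+ i) = local_factor i j a' b'.
  move=> nb' /andP[j0 ji] rb; have [|IH _] := IHn B (i - j)%N j (a' * b') b' rs' _ nb'.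
    by lia.
  rewrite -local_factor_subl // -IH // !big_seq; apply: eq_bigr => r rrs.
  by rewrite -{1}(subnKC ji) exprD (roots_exp rb rrs) mulrA.
have step2 (B : comPzRingType) (a' b' : B) rs' : nilpotent b' -> (0 < i <= j)%N ->
    binomial_roots i a' rs' ->
    \prod_(r <- rs') (1 - b' * r ^+ j) = local_factor i j a' b'.
  move=> nb' /andP[i0 ij] ra.
  have [||_ IH] := IHn B i (j - i)%N a' (b' * a') rs'; [by lia|exact: nilpotentMr|].
  rewrite local_factorC -local_factor_subl // local_factorC -IH // !big_seq.
  apply: eq_bigr => r rrs.
  by rewrite -{1}(subnKC ij) exprD (roots_exp ra rrs) mulrA.
split=> [j0 rb|i0 ra].
  have [->|i0] := posnP i.
    under eq_bigr do rewrite expr0 mulr1.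
    rewrite prod_const_seq (roots_size rb) /local_factor gcd0n divnn j0 div0n.
    by rewrite expr1 expr0 mulr1.
  have [ji|ij] := leqP j i; first by apply: step1 => //; rewrite j0.
  have [B [h [ss [hi ra]]]] := binomial_split a i0.
  have rb' := binomial_roots_map h rb.
  apply: hi; rewrite local_factor_map -(step2 _ _ _ ss); last first.
  - by [].
  - by rewrite i0 ltnW.
  - exact: nilpotent_map.
  rewrite -(roots_swap _ _ ra rb') //; last exact: nilpotent_map.
  rewrite rmorph_prod big_map; apply: eq_bigr => r _.
  by rewrite rmorphB rmorph1 rmorphM rmorphXn.
have [->|j0] := posnP j.
  under eq_bigr do rewrite expr0 mulr1.
  rewrite prod_const_seq (roots_size ra) /local_factor gcdn0 divnn i0 div0n.
  by rewrite expr1 expr0 mul1r.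
have [ij|ji] := leqP i j; first by apply: step2 => //; rewrite i0.
have [B [h [ss [hi rb]]]] := binomial_split b j0.
have ra' := binomial_roots_map h ra.
apply: hi; rewrite local_factor_map -(step1 _ _ _ ss); last first.
- by [].
- by rewrite j0 ltnW.
- exact: nilpotent_map.
rewrite (roots_swap _ _ ra' rb) //; last exact: nilpotent_map.
rewrite rmorph_prod big_map; apply: eq_bigr => r _.
by rewrite rmorphB rmorph1 rmorphM rmorphXn.
Qed.

Section MapComp.
Variables (A B C : comPzRingType).

Lemma lmap_id (f : laurent A) : lmap (idfun : {rmorphism A -> A}) f = f.
Proof. exact/laurentP. Qed.

Lemma lmap_comp (h : {rmorphism B -> C}) (i : {rmorphism A -> B}) (f : laurent A) :
  lmap h (lmap i f) = lmap (h \o i : {rmorphism A -> C}) f.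
Proof. exact/laurentP. Qed.

End MapComp.

Definition neg_roots (A : comPzRingType) (m : laurent A) (rs : seq A) : Prop :=
  (forall r, r \in rs -> nilpotent r) /\ m = \prod_(r <- rs) (1 - monom r (- 1)).

Section NegRoots.

Lemma neg_roots_map (A B : comPzRingType) (i : {rmorphism A -> B}) m rs :
  neg_roots m rs -> neg_roots (lmap i m) (map i rs).
Proof.
move=> [nrs ->]; split; first by move=> _ /mapP[r /nrs nr ->]; exact: nilpotent_map.
rewrite rmorph_prod big_map; apply: eq_bigr => r _.
by rewrite rmorphB rmorph1 /= lmap_monom.
Qed.

Lemma neg_rootsM (A : comPzRingType) (m m' : laurent A) rs rs' :
  neg_roots m rs -> neg_roots m' rs' -> neg_roots (m * m') (rs ++ rs').
Proof.
move=> [nrs ->] [nrs' ->]; split; last by rewrite big_cat.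
by move=> r; rewrite mem_cat => /orP[/nrs|/nrs'].
Qed.

(** The binomials of the Witt coordinates are split one after the other, each over an extension of
    the previous ring. A root is nilpotent because a power of it is. *)
Lemma neg_split (A : comPzRingType) (m : laurent A) : is_neg m ->
  exists (B : comPzRingType) (i : {rmorphism A -> B}) (rs : seq B),
    injective i /\ neg_roots (lmap i m) rs.
Proof.
move=> /witt_neg[b [L [nb _ ->]]]; elim: L => [|L [B [i [rs [ii mrs]]]]].
  exists A, (idfun : {rmorphism A -> A}), [::]; split=> //; split=> //.
  by rewrite big_geq // rmorph1 big_nil.
have [L0|L1] := leqP L 0.
  exists A, (idfun : {rmorphism A -> A}), [::]; split=> //; split=> //.
  by rewrite big_geq ?rmorph1 ?big_nil //; lia.
have [C [h [ss [hi hss]]]] := binomial_split (i (b L)) L1.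
exists C, (h \o i : {rmorphism A -> C}), (map h rs ++ ss).
split; first exact: inj_comp.
rewrite -lmap_comp big_nat_recr //= !rmorphM /=; apply: neg_rootsM.
  exact: neg_roots_map.
split=> [r /(roots_exp hss) e|].
  by apply: (@nilpotent_of_exp _ _ L); rewrite e; do 2 apply: nilpotent_map.
by rewrite -(roots_neg hss) !rmorphB !rmorph1 /= !lmap_monom.
Qed.

Lemma local_factor_eq1 (A : comPzRingType) (i j K : nat) (a b : A) :
  (0 < j)%N -> b ^+ K = 0 -> (K * j <= i)%N -> local_factor i j a b = 1.
Proof.
move=> j0 bK Kji; have g0 : (0 < gcdn i j)%N by rewrite gcdn_gt0 j0 orbT.
have [K0|K0] := posnP K.
  have A0 : (1 : A) = 0 by rewrite -bK K0 expr0.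
  by rewrite -[LHS]mul1r A0 mul0r.
rewrite /local_factor (@expr_nilpotent _ b K) ?mulr0 ?subr0 ?expr1n //.
rewrite leq_divRL //; apply: leq_trans Kji; rewrite leq_mul2l.
by rewrite dvdn_leq ?orbT // dvdn_gcdr.
Qed.

(** For each i, the products 1 - x r are arranged in two ways, with r a root of [m] and x a root of
    1 - a_i t^i. Grouped by r they give the i-th factor of h(r), the tail of [h] being killed by r^N
    = 0; grouped by x they give [m] at t^-1 = x, which [prod_roots] evaluates binomial by
    binomial. *)
Lemma ev_roots_formula (A : comPzRingType) (a b : nat -> A) (h m : laurent A)
    (L : nat) (rs : seq A) :
    is_pos h -> witt_coords a h -> (forall j, nilpotent (b j)) ->
    m = \prod_(1 <= j < L) (1 - monom (b j) (- j%:Z)) -> neg_roots m rs ->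
  exists N0 : nat, forall N : nat, (N0 <= N)%N ->
    \prod_(r <- rs) ev r h =
    \prod_(1 <= i < N) \prod_(1 <= j < L) local_factor i j (a i) (b j).
Proof.
move=> [h0 _] ah nb mb [nrs mrs].
have [N0 N0P] := nilpotent_seq nrs.
exists N0 => N N0N.
have evh r : r \in rs -> ev r h = \prod_(1 <= i < N) (1 - a i * r ^+ i).
  move=> rrs; have nr := nrs _ rrs.
  have P0 i : in_tpow 0 (1 - monom (a i) i%:Z : laurent A).
    by apply: in_tpowB; [exact: in_tpow1 | exact: in_tpow_monom].
  have PP0 : in_tpow 0 (\prod_(1 <= i < N) (1 - monom (a i) i%:Z) : laurent A).
    by apply: in_tpow_prod => i _.
  have rN : r ^+ N = 0 by rewrite (expr_nilpotent (N0P r rrs)).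
  have := ev_tpow rN (ah N); rewrite evD ?evN //; last exact: in_tpowN.
  move=> /eqP; rewrite subr_eq0 => /eqP <-; rewrite ev_prod //.
  by apply: eq_bigr => i _; rewrite ev_1Bmonom.
rewrite big_seq (eq_bigr _ evh) -big_seq exchange_big /=.
rewrite [LHS]big_nat [RHS]big_nat; apply: eq_bigr => i /andP[i0 _].
have [C [k [ss [ki kss]]]] := binomial_split (a i) i0; apply: ki.
have nk r : r \in rs -> nilpotent (k r) by move=> /nrs; exact: nilpotent_map.
transitivity (\prod_(x <- ss) zev x (lmap k m)).
  rewrite rmorph_prod mrs rmorph_prod.
  transitivity (\prod_(r <- rs) \prod_(x <- ss) (1 - x * k r)).
    rewrite [LHS]big_seq [RHS]big_seq; apply: eq_bigr => r rrs.
    rewrite rmorphB rmorph1 rmorphM rmorphXn -ev_1Bmonom; last exact: nk.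
    rewrite (roots_pos kss) ev_prod; last 2 first.
    - exact: nk.
    - by move=> x; apply: in_tpowB; [exact: in_tpow1 | exact: in_tpow_monom].
    by apply: eq_bigr => x _; rewrite (@ev_1Bmonom _ _ _ 1) ?expr1 //; exact: nk.
  rewrite exchange_big; apply: eq_bigr => x _; rewrite zev_prod => [|r].
    apply: eq_bigr => r _; rewrite rmorphB rmorph1 /= lmap_monom.
    by rewrite (@zev_1Bmonom _ _ _ 1) expr1 mulrC.
  apply/lmap_zpoly/in_zpolyB; first exact: in_zpoly1.
  exact: in_zpoly_monom.
rewrite mb rmorph_prod; under eq_bigr => x _.
  rewrite zev_prod => [|j]; last first.
    apply/lmap_zpoly/in_zpolyB; first exact: in_zpoly1.
    by apply: in_zpoly_monom; lia.
  under eq_bigr do rewrite rmorphB rmorph1 /= lmap_monom zev_1Bmonom.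
  over.
rewrite exchange_big rmorph_prod /=; apply: eq_bigr => j _.
have [_ ->] := @prod_roots (i + j) C i j (k (a i)) (k (b j)) ss (leqnn _)
  (nilpotent_map k (nb j)) => //.
by rewrite local_factor_map.
Qed.

End NegRoots.

(* The symbol of h and m: the product of the values of h at the roots of m in
   any ring where m splits. *)
Definition pairing_spec (A : comPzRingType) (h m : laurent A) (x : A) : Prop :=
  forall (B : comPzRingType) (i : {rmorphism A -> B}) (rs : seq B),
    neg_roots (lmap i m) rs -> i x = \prod_(r <- rs) ev r (lmap i h).

Definition pairing (A : comPzRingType) (h m : laurent A) : A :=
  xget 0 [set x | pairing_spec h m x].

(** * The pairing of plus and minus parts *)

Section Pairing.
Variable A : comPzRingType.
Implicit Types (h m : laurent A).

Lemma local_factor_big (b : nat -> A) (L : nat) : (forall j, nilpotent (b j)) ->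
  exists N1 : nat, forall i, (N1 <= i)%N ->
    forall (a : A) j, (1 <= j < L)%N -> local_factor i j a (b j) = 1.
Proof.
move=> nb; elim: L => [|L [N1 IH]]; first by exists 0%N => i _ a j; lia.
have [K bK] := nb L; exists (N1 + K * L)%N => i iN a j jL.
have [->|jL'] := eqVneq j L; last by apply: IH; lia.
by apply: (local_factor_eq1 _ _ bK); [lia | apply: leq_trans iN; exact: leq_addl].
Qed.

Lemma witt_coords_map (B : comPzRingType) (i : {rmorphism A -> B}) a h :
  witt_coords a h -> witt_coords (i \o a) (lmap i h).
Proof.
move=> ah n; have := lmap_tpow i (ah n); rewrite rmorphB rmorph_prod.
by under eq_bigr do rewrite rmorphB rmorph1 /= lmap_monom.
Qed.

(** The bound in [ev_roots_formula] depends on the extension and the roots, whereas [N1] depends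
    only on the coordinates of [m]. Past [N1] all factors are 1, so one element of [A] meets the
    specification in every extension. *)
Lemma pairing_spec_witt (a b : nat -> A) h m (L : nat) :
    is_pos h -> witt_coords a h -> (forall j, nilpotent (b j)) ->
    m = \prod_(1 <= j < L) (1 - monom (b j) (- j%:Z)) ->
  exists N1 : nat, (forall i, (N1 <= i)%N ->
      forall (a : A) j, (1 <= j < L)%N -> local_factor i j a (b j) = 1) /\
    forall N : nat, (N1 <= N)%N -> pairing_spec h m
     (\prod_(1 <= i < N) \prod_(1 <= j < L) local_factor i j (a i) (b j)).
Proof.
move=> hp ah nb mb; have [N1 N1P] := local_factor_big L nb.
exists N1; split=> // N N1N B i rs mrs.
have mb' : lmap i m = \prod_(1 <= j < L) (1 - monom ((i \o b) j) (- j%:Z)).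
  by rewrite mb rmorph_prod; under eq_bigr do rewrite rmorphB rmorph1 /= lmap_monom.
have [|N0 N0P] := ev_roots_formula (is_pos_map i hp) (witt_coords_map i ah) _ mb' mrs.
  by move=> j; exact: nilpotent_map.
rewrite (N0P (N + N0)%N) ?leq_addl // rmorph_prod.
have [N00|Nge] := leqP N 0.
  rewrite big_geq; last lia.
  rewrite big_nat big1 // => k kN; rewrite big_nat big1 // => j jL.
  by rewrite -local_factor_map N1P ?rmorph1 //; lia.
rewrite [RHS](@big_cat_nat _ _ _ N) ?leq_addr //= [X in _ * X]big1_seq ?mulr1.
  apply: eq_bigr => k _; rewrite rmorph_prod; apply: eq_bigr => j _.
  by rewrite local_factor_map.
move=> k; rewrite /= mem_index_iota => /andP[Nk _].
rewrite big_nat big1 // => j jL.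
by rewrite -local_factor_map N1P ?rmorph1 //; lia.
Qed.

Lemma pairingP h m : is_pos h -> is_neg m -> pairing_spec h m (pairing h m).
Proof.
move=> hp mn; have [a ah] := witt_pos hp; have [b [L [nb _ mb]]] := witt_neg mn.
have [N1 [_ /(_ _ (leqnn _)) N1P]] := pairing_spec_witt hp ah nb mb.
by rewrite /pairing; case: xgetP => // /(_ _ N1P).
Qed.

(** [m] splits in some faithful extension, and there the specification fixes the image of [x]. *)
Lemma pairing_uniq h m x : is_pos h -> is_neg m -> pairing_spec h m x ->
  pairing h m = x.
Proof.
move=> hp mn hx; have [B [i [rs [ii mrs]]]] := neg_split mn.
by apply: ii; rewrite (pairingP hp mn mrs) (hx _ _ _ mrs).
Qed.

End Pairing.

Section PairingTheory.
Variable A : comPzRingType.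
Implicit Types (h m : laurent A).

Lemma pairingMl h h' m : is_pos h -> is_pos h' -> is_neg m ->
  pairing (h * h') m = pairing h m * pairing h' m.
Proof.
move=> hp hp' mn; apply: pairing_uniq => //; first exact: is_posM.
move=> B i rs mrs; rewrite rmorphM !(pairingP _ mn mrs) // -big_split /=.
have [nrs _] := mrs; rewrite big_seq [RHS]big_seq; apply: eq_bigr => r rrs.
by rewrite rmorphM evM //; [exact: nrs|case: (is_pos_map i hp)|case: (is_pos_map i hp')].
Qed.

Lemma pairing1l m : is_neg m -> pairing 1 m = 1.
Proof.
move=> mn; apply: pairing_uniq => //; first exact: is_pos1.
move=> B i rs [nrs _]; rewrite !rmorph1 big_seq big1 // => r rrs.
by rewrite ev1 //; exact: nrs.
Qed.

(** A ring over [B] is a ring over [A] by composition, so the specification over [A] contains the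
    one over [B]. *)
Lemma pairing_map (B : comPzRingType) (i : {rmorphism A -> B}) h m :
  is_pos h -> is_neg m -> pairing (lmap i h) (lmap i m) = i (pairing h m).
Proof.
move=> hp mn; apply: pairing_uniq; [exact: is_pos_map|exact: is_neg_map|].
move=> C k rs; rewrite !lmap_comp => mrs.
by rewrite -(pairingP hp mn mrs).
Qed.

Lemma pairing_root h r : is_pos h -> nilpotent r ->
  pairing h (1 - monom r (- 1)) = ev r h.
Proof.
move=> hp nr; have mn := is_neg_monom (ltn0Sn 0) nr.
have /(pairingP hp mn (i := (idfun : {rmorphism A -> A}))) :
    neg_roots (lmap (idfun : {rmorphism A -> A}) (1 - monom r (- 1))) [:: r].
  rewrite lmap_id; split; last by rewrite big_seq1.
  by move=> x; rewrite inE => /eqP->.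
by rewrite big_seq1 lmap_id.
Qed.

(** The product of the 1 - a r over the roots r of [m] is [m] at t^-1 = a. Here only the minus part
    gets evaluated, and [a] need not be nilpotent. *)
Lemma pairing_lin a m : is_neg m -> pairing (1 - monom a 1) m = zev a m.
Proof.
move=> mn; apply: pairing_uniq => //; first exact: (@is_pos_monom _ _ 1).
have [mz _ _] := mn; move=> B i rs [nrs e]; rewrite zev_map // e zev_prod; last first.
  by move=> r; apply: in_zpolyB; [exact: in_zpoly1 | exact: in_zpoly_monom].
rewrite [LHS]big_seq [RHS]big_seq; apply: eq_bigr => r rrs.
rewrite (@zev_1Bmonom _ _ _ 1) expr1 rmorphB rmorph1 /= lmap_monom.
by rewrite (@ev_1Bmonom _ _ _ 1) ?expr1 1?mulrC //; exact: nrs.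
Qed.

(** If all roots of [m] satisfy r^N = 0, then h(r) depends on [h] modulo t^N only. This permits
    truncating plus parts when [m] is fixed. *)
Lemma pairing_tail m : is_neg m -> exists N : nat, forall h, is_pos h ->
  in_tpow N%:Z (h - 1) -> pairing h m = 1.
Proof.
move=> mn; have [B [i [rs [ii mrs]]]] := neg_split mn; have [nrs _] := mrs.
have [N NP] := nilpotent_seq nrs.
exists N => h hp hN; apply: ii; rewrite (pairingP hp mn mrs) rmorph1.
rewrite big_seq big1 // => r rrs; have nr := nrs _ rrs.
have [h0 _] := is_pos_map i hp.
have := ev_tpow (NP r rrs) (lmap_tpow i hN).
rewrite rmorphB rmorph1 evD ?evN ?ev1 //; [|exact: in_tpow1|].
  by move=> /eqP; rewrite subr_eq0 => /eqP.
by apply/in_tpowN/in_tpow1.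
Qed.

(** [m'] is split over the extension that already splits [m]; the roots of the product are the two
    lists together. *)
Lemma pairingMr h m m' : is_pos h -> is_neg m -> is_neg m' ->
  pairing h (m * m') = pairing h m * pairing h m'.
Proof.
move=> hp mn mn'; have [B [i [rs [ii mrs]]]] := neg_split mn.
have [C [k [rs' [ki mrs']]]] := neg_split (is_neg_map i mn').
apply/ii/ki; have mrsC := neg_roots_map k mrs; move: mrs' mrsC.
have kiE x : k (i x) = (k \o i : {rmorphism A -> C}) x by [].
rewrite !kiE !lmap_comp => mrs' mrsC; have mm := neg_rootsM mrsC mrs'.
rewrite -rmorphM in mm.
rewrite (pairingP hp (is_negM mn mn') mm) big_cat rmorphM.
by rewrite (pairingP hp mn mrsC) (pairingP hp mn' mrs').
Qed.

Lemma pairing1r h : is_pos h -> pairing h 1 = 1.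
Proof.
move=> hp; have m0 : neg_roots (lmap (idfun : {rmorphism A -> A}) 1) [::].
  by split=> //; rewrite rmorph1 big_nil.
by have := pairingP hp (is_neg1 A) m0; rewrite big_nil.
Qed.

Lemma pairing_invertible h m : is_pos h -> is_neg m -> invertible (pairing h m).
Proof.
move=> hp mn; have [h' hp' hh'] := is_posV hp.
by exists (pairing h' m); rewrite -pairingMl // hh' pairing1l.
Qed.

End PairingTheory.

(** * Integral powers, units and spectra under base change *)

Section Zpow.
Variable G : groupType.
Implicit Types (x : G) (n : int).

Lemma zpow_shift x n (M : nat) : 0 <= n + M%:Z ->
  (zpow x n * x ^+ M)%g = (x ^+ absz (n + M%:Z))%g.
Proof.
case: n => k nM /=; first by rewrite -expgnDr; congr (x ^+ _)%g.
have kM : (k.+1 <= M)%N by lia.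
have -> : absz (Negz k + M%:Z) = (M - k.+1)%N by lia.
by rewrite -{1}(subnKC kM) expgnDr mulgA mulVg mul1g.
Qed.

Lemma zpowD x m n : zpow x (m + n) = (zpow x m * zpow x n)%g.
Proof.
pose M := (`|m| + `|n|)%N; apply: (mulIg (x ^+ (M + M))%g).
rewrite zpow_shift; last lia.
rewrite {1}expgnDr mulgA -[(zpow x m * zpow x n * _)%g]mulgA.
rewrite zpow_shift; last lia.
have cxz k l : ((x ^+ k) * x ^+ l = x ^+ l * x ^+ k)%g.
  by rewrite -!expgnDr addnC.
rewrite -mulgA cxz mulgA zpow_shift; last lia.
by rewrite -expgnDr; congr (x ^+ _)%g; lia.
Qed.

Lemma zpow0 x : zpow x 0 = 1%g. Proof. by []. Qed.
Lemma zpow1 x : zpow x 1 = x. Proof. by []. Qed.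
Lemma zpowN x n : zpow x (- n) = (zpow x n)^-1%g.
Proof. by apply: (mulIg (zpow x n)); rewrite -zpowD addNr mulVg. Qed.

End Zpow.

Section GmTheory.
Variable A : comPzRingType.
Implicit Types (x y : Gm A).

Lemma gm_val1 : gm_val (1%g : Gm A) = 1. Proof. by []. Qed.
Lemma gm_valM x y : gm_val (x * y)%g = gm_val x * gm_val y. Proof. by []. Qed.
Lemma gm_valX x n : gm_val (x ^+ n)%g = gm_val x ^+ n.
Proof. by elim: n => [//|n IHn]; rewrite expgS gm_valM IHn exprS. Qed.
Lemma gm_valV x : gm_val x * gm_val x^-1%g = 1.
Proof. by rewrite -gm_valM mulgV. Qed.
Lemma gm_inj : injective (@gm_val A). Proof. exact: val_inj. Qed.
Lemma gm_valV_uniq x (y : A) : gm_val x * y = 1 -> gm_val x^-1%g = y.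
Proof. exact: inv_uniq (gm_valV x). Qed.
Lemma toGmK (x : A) (hx : invertible x) : gm_val (toGm hx) = x. Proof. by []. Qed.
Lemma gmC x y : (x * y)%g = (y * x)%g. Proof. exact: gm_mulC. Qed.
Lemma gmACA x y z t : (x * y * (z * t))%g = (x * z * (y * t))%g.
Proof. by apply: gm_inj; rewrite !gm_valM mulrACA. Qed.
Lemma gm_invM x y : (x * y)^-1%g = (x^-1 * y^-1)%g.
Proof. by rewrite invgM gmC. Qed.

Lemma zpowMl x y n : zpow (x * y)%g n = (zpow x n * zpow y n)%g.
Proof.
have cx k : ((x * y) ^+ k = x ^+ k * y ^+ k)%g.
  by apply: gm_inj; rewrite gm_valM !gm_valX gm_valM exprMn.
by case: n => k /=; rewrite cx // gm_invM.
Qed.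

End GmTheory.

Section GmMapTheory.
Variables (A B : comPzRingType) (h : {rmorphism A -> B}).

Lemma gm_map_val x : gm_val (Gm_map h x) = h (gm_val x). Proof. by []. Qed.
Lemma Gm_map1 : Gm_map h 1%g = 1%g.
Proof. by apply: gm_inj; rewrite gm_map_val rmorph1. Qed.
Lemma Gm_mapM x y : Gm_map h (x * y)%g = (Gm_map h x * Gm_map h y)%g.
Proof. by apply: gm_inj; rewrite gm_valM !gm_map_val rmorphM. Qed.
Lemma Gm_mapV x : Gm_map h x^-1%g = (Gm_map h x)^-1%g.
Proof. by apply: (mulgI (Gm_map h x)); rewrite -Gm_mapM !mulgV Gm_map1. Qed.
Lemma Gm_mapX x n : Gm_map h (x ^+ n)%g = (Gm_map h x ^+ n)%g.
Proof. by apply: gm_inj; rewrite gm_valX !gm_map_val gm_valX rmorphXn. Qed.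
Lemma Gm_map_zpow x n : Gm_map h (zpow x n) = zpow (Gm_map h x) n.
Proof. by case: n => k /=; rewrite ?Gm_mapV Gm_mapX. Qed.

Fact Spec_map_subproof (p : Spec B) : [/\ p (h 0),
    forall x y, p (h x) -> p (h y) -> p (h (x + y)),
    forall a x, p (h x) -> p (h (a * x)),
    ~ p (h 1) & forall x y, p (h (x * y)) -> p (h x) \/ p (h y)].
Proof.
split; [| |by move=> a x; rewrite rmorphM; exact: prime_memMl| |].
- by rewrite rmorph0; exact: prime_mem0.
- by move=> x y; rewrite rmorphD; exact: prime_memD.
- by rewrite rmorph1; exact: prime_mem1.
- by move=> x y; rewrite rmorphM; exact: prime_memM.
Qed.

Definition Spec_map (p : Spec B) : Spec A :=
  let: And5 p0 pD pM p1 pP := Spec_map_subproof p in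
  @PrimeIdeal A (fun x => p (h x)) p0 pD pM p1 pP.

Lemma Spec_mapE p x : Spec_map p x = p (h x).
Proof. by rewrite /Spec_map; case: Spec_map_subproof. Qed.

Lemma locally_constant_map (nu : Spec A -> int) :
  locally_constant nu -> locally_constant (nu \o Spec_map).
Proof.
move=> nulc p; have [s [ps sq]] := nulc (Spec_map p); exists (h s).
rewrite Spec_mapE in ps; split=> // q qs; apply: sq; by rewrite Spec_mapE.
Qed.

End GmMapTheory.

(** * Locally constant functions and idempotents *)

Section Idempotents.
Variable A : comPzRingType.

(** [orth_idempotents] over an arbitrary finite index type, so that a common refinement can be
    indexed by pairs. *)
Definition orth_family (I : finType) (e : I -> A) : Prop :=
  [/\ \sum_i e i = 1, forall i, e i * e i = e i
    & forall i j, i != j -> e i * e j = 0].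

Lemma orth_family_mul (R : comPzRingType) (f : {rmorphism A -> R}) (I : finType)
    (e : I -> A) (x y : I -> R) : orth_family e ->
  (\sum_i f (e i) * x i) * (\sum_i f (e i) * y i) = \sum_i f (e i) * (x i * y i).
Proof.
move=> [e1 ee eo]; rewrite mulr_suml; apply: eq_bigr => i _.
rewrite mulr_sumr (bigD1 i) //= big1 ?addr0 => [|j ji].
  by rewrite mulrACA -rmorphM ee.
by rewrite mulrACA -rmorphM eo ?rmorph0 ?mul0r // eq_sym.
Qed.

Lemma orth_family_sum (R : comPzRingType) (f : {rmorphism A -> R}) (I : finType)
    (e : I -> A) : orth_family e -> \sum_i f (e i) = 1.
Proof. by move=> [e1 _ _]; rewrite -rmorph_sum e1 rmorph1. Qed.

Lemma orth_family_prime (I : finType) (e : I -> A) (p : Spec A) : orth_family e ->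
  exists i, ~ p (e i) /\ forall j, j != i -> p (e j).
Proof.
move=> [e1 ee eo]; have [i pi] : exists i, ~ p (e i).
  apply: contrapT => np; apply: (@prime_mem1 _ p); rewrite -e1.
  apply: prime_sum => i _; apply: contrapT => pi; apply: np; by exists i.
exists i; split=> // j ji; have := prime_mem0 p; rewrite -(eo _ _ ji).
by move=> /prime_memM[].
Qed.

(** An idempotent lying in every prime is nilpotent, hence zero. *)
Lemma idempotent_prime (x : A) : x * x = x -> x <> 0 -> exists p : Spec A, ~ p x.
Proof.
move=> xx x0; apply: contrapT => np; have : nilpotent x.
  by apply/nilpotentP => p; apply: contrapT => px; apply: np; exists p.
move=> [n]; elim: n => [|n IHn] xn.
  by apply: x0; rewrite -[x]mul1r -(expr0 x) xn mul0r.
apply: IHn; case: n xn => [|n]; last by rewrite !exprS mulrA xx.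
by rewrite expr1.
Qed.

(** The powers x_i^(K+1) are exactly orthogonal, and each differs from x_i by a nilpotent, so their
    sum is a unit. Dividing by it gives orthogonal elements of sum 1, which are therefore
    idempotent. *)
Lemma idempotent_lift (I : finType) (x : I -> A) : \sum_i x i = 1 ->
    (forall i j, i != j -> nilpotent (x i * x j)) ->
  exists e : I -> A, orth_family e /\ exists c : I -> A, forall i, e i = c i * x i.
Proof.
move=> x1 xn; have [K KP] : exists K, forall i j, i != j -> (x i * x j) ^+ K = 0.
  have /choice[K KP] : forall ij : I * I, exists K, ij.1 != ij.2 ->
      (x ij.1 * x ij.2) ^+ K = 0.
    move=> [i j] /=; have [ij|ij] := boolP (i == j); first by exists 0%N.
    by have [K ijK] := xn _ _ ij; exists K.
  exists (\sum_ij K ij)%N => i j ij; apply: (expr_nilpotent (KP (i, j) ij)).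
  by rewrite (bigD1 (i, j)) //= leq_addr.
have x2 i : nilpotent (x i ^+ 2 - x i).
  have -> : x i ^+ 2 - x i = - \sum_(j | j != i) x i * x j.
    rewrite -mulr_sumr -[x i in X in _ - X]mulr1 -x1 [\sum_i _](bigD1 i) //=.
    by ring.
  by apply/nilpotentN/nilpotent_sum => j ji; apply: xn; rewrite eq_sym.
have xK i n : nilpotent (x i ^+ n.+1 - x i).
  elim: n => [|n IHn]; first by rewrite expr1 subrr; exact: nilpotent0.
  have -> : x i ^+ n.+2 - x i = x i * (x i ^+ n.+1 - x i) + (x i ^+ 2 - x i).
    by rewrite [x i ^+ n.+2]exprS; ring.
  by apply: nilpotentD => //; exact: nilpotentMl.
pose y i := x i ^+ K.+1.
have [w yw] : invertible (\sum_i y i).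
  have -> : \sum_i y i = 1 + \sum_i (y i - x i) by rewrite sumrB x1 addrCA subrr addr0.
  by apply/invertible1D/nilpotent_sum => i _; exact: xK.
have yy i j : i != j -> y i * y j = 0.
  by move=> ij; rewrite /y -exprMn exprSr KP ?mul0r.
have e1 : \sum_i w * y i = 1 by rewrite -mulr_sumr mulrC.
have eo i j : i != j -> w * y i * (w * y j) = 0.
  by move=> ij; rewrite mulrACA yy ?mulr0.
exists (fun i => w * y i); split; last first.
  by exists (fun i => w * x i ^+ K) => i; rewrite /y exprSr mulrA.
split=> // i; rewrite -[RHS]mulr1 -e1 mulr_sumr (bigD1 i) //= big1 ?addr0 // => j ji.
by rewrite eo // eq_sym.
Qed.

(** Quasi-compactness of the spectrum: the ideal generated by the s with [nu] constant on D(s) lies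
    in no prime, so 1 is a finite sum of such s. Terms with the same value of [nu] are collected;
    the product of two different groups lies in every prime, and the sums lift to idempotents. *)
Lemma locally_constant_decomp (nu : Spec A -> int) : locally_constant nu ->
  exists (I : finType) (e : I -> A) (m : I -> int), orth_family e /\
    forall i (p : Spec A), ~ p (e i) -> nu p = m i.
Proof.
move=> nulc; pose good (y : A * int) := forall q : Spec A, ~ q y.1 -> nu q = y.2.
pose I : set A := [set x | exists l : seq (A * int),
  (forall y, y \in l -> good y) /\ x = \sum_(y <- l) y.1].
have Iid : is_ideal I.
  split.
  - by exists [::]; split=> //; rewrite big_nil.
  - move=> _ _ [l [lg ->]] [l' [lg' ->]]; exists (l ++ l'); rewrite big_cat; split=> //.
    by move=> y; rewrite mem_cat => /orP[/lg|/lg'].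
  - move=> a _ [l [lg ->]]; exists [seq (a * y.1, y.2) | y <- l]; split.
      move=> _ /mapP[y /lg yg ->] q /= nq; apply: yg => qy; apply: nq.
      exact: prime_memMl.
    by rewrite big_map mulr_sumr.
have [l [lg l1]] : I 1.
  apply: contrapT => I1; have [n|p [Ip _]] := @exists_prime A I 1 Iid.
    by rewrite expr1n.
  have [s [ps sq]] := nulc p; apply/ps/Ip; exists [:: (s, nu p)].
  split; last by rewrite big_seq1.
  by move=> y; rewrite inE => /eqP->.
pose ms := undup (map snd l).
pose x (i : 'I_(size ms)) := \sum_(y <- l | y.2 == nth 0 ms i) y.1.
have xg i (q : Spec A) : ~ q (x i) -> nu q = nth 0 ms i.
  move=> nq; apply: contrapT => nuq; apply: nq; rewrite /x big_seq_cond.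
  apply: prime_sum => y /andP[yl /eqP yi]; apply: contrapT => qy.
  by apply: nuq; rewrite (lg y).
have [||e [eo [c ec]]] := @idempotent_lift _ x.
- rewrite [RHS]l1 /x; under eq_bigr do rewrite big_mkcond.
  rewrite exchange_big /= [LHS]big_seq [RHS]big_seq; apply: eq_bigr => y yl.
  have ym : y.2 \in ms by rewrite mem_undup map_f.
  have iy : (index y.2 ms < size ms)%N by rewrite index_mem.
  rewrite (bigD1 (Ordinal iy)) //= nth_index // eqxx big1 ?addr0 // => j ji.
  case: eqP => // e; move: ji; rewrite -val_eqE /= e index_uniq ?undup_uniq //.
  by rewrite eqxx.
- move=> i j ij; apply/nilpotentP => q; apply: contrapT => qij.
  have qi : ~ q (x i) by move=> qi; apply: qij; rewrite mulrC; exact: prime_memMl.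
  have qj : ~ q (x j) by move=> qj; apply: qij; exact: prime_memMl.
  have := xg _ _ qi; rewrite (xg _ _ qj) => /eqP; rewrite nth_uniq ?undup_uniq //.
  by rewrite eq_sym val_eqE (negbTE ij).
exists _, e, (fun i : 'I_(size ms) => nth 0 ms i); split=> // i p pe; apply: xg => px.
by apply: pe; rewrite ec; exact: prime_memMl.
Qed.

Lemma locally_constant_decomp2 (nu mu : Spec A -> int) :
    locally_constant nu -> locally_constant mu ->
  exists (I : finType) (e : I -> A) (m n : I -> int), orth_family e /\
    forall i (p : Spec A), ~ p (e i) -> nu p = m i /\ mu p = n i.
Proof.
move=> /locally_constant_decomp[I [e [m [[e1 ee eo] em]]]].
move=> /locally_constant_decomp[J [f [n [[f1 ff fo] fn]]]].
exists (I * J)%type, (fun ij => e ij.1 * f ij.2), (fun ij => m ij.1), (fun ij => n ij.2).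
split; first split.
- rewrite -(pair_bigA _ (fun i j => e i * f j)) /= -e1.
  by apply: eq_bigr => i _; rewrite -mulr_sumr f1 mulr1.
- by move=> [i j] /=; rewrite mulrACA ee ff.
- move=> [i j] [i' j'] /= ne; rewrite mulrACA.
  have [ii|ii] := eqVneq i i'; last by rewrite eo ?mul0r.
  rewrite fo ?mulr0 //; apply: contraNneq ne => ->; by rewrite ii.
move=> [i j] p /= pef; split.
  by apply: em => pe; apply: pef; rewrite mulrC; exact: prime_memMl.
by apply: fn => pf; apply: pef; exact: prime_memMl.
Qed.

Lemma locally_constant_cst (n : int) : @locally_constant A (fun=> n).
Proof. by move=> p; exists 1; split=> //; exact: prime_mem1. Qed.

Lemma locally_constant_op (op : int -> int -> int) (nu mu : Spec A -> int) :
  locally_constant nu -> locally_constant mu ->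
  locally_constant (fun p => op (nu p) (mu p)).
Proof.
move=> nulc mulc p; have [s [ps sq]] := nulc p; have [u [pu uq]] := mulc p.
exists (s * u); split; first by move=> /prime_memM[].
move=> q qsu; rewrite sq ?uq // => qx; apply: qsu; first exact: prime_memMl.
by rewrite mulrC; exact: prime_memMl.
Qed.

End Idempotents.

Section LcPow.
Variables (A R : comPzRingType) (iota : {rmorphism A -> R}).
Implicit Types (nu mu : Spec A -> int) (x y : Gm R).

(** Independence of the decomposition chosen in [lcpow]: whenever the idempotent e_i f_j is nonzero,
    some prime misses it, and the value of [nu] there is the exponent of both decompositions. *)
Lemma lcpowE (I : finType) (e : I -> A) (m : I -> int) nu x : orth_family e ->
    (forall i (p : Spec A), ~ p (e i) -> nu p = m i) ->
  gm_val (lcpow iota nu x) = \sum_i iota (e i) * gm_val (zpow x (m i)).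
Proof.
move=> eo em; have [e1 ee eoo] := eo.
pose s (n : I -> int) := \sum_i iota (e i) * gm_val (zpow x (n i)).
have sV : invertible (s m).
  exists (s (fun i => - m i)); rewrite /s (orth_family_mul _ _ _ eo).
  under eq_bigr do rewrite -gm_valM -zpowD subrr mulr1.
  exact: orth_family_sum.
have enumE (S : comPzRingType) (F : I -> S) :
    \sum_(k < #|I|) F (enum_val k) = \sum_i F i.
  by rewrite (reindex _ (onW_bij _ (enum_val_bij I))).
have ex : is_lcpow iota nu x (toGm sV).
  exists #|I|, (fun i => e (enum_val i)), (fun i => m (enum_val i)); split.
  - split=> [|i|i j ij]; [by rewrite enumE | exact: ee |].
    by apply: eoo; apply: contraNneq ij => /enum_val_inj->.
  - by move=> i p; exact: em.
  - by rewrite toGmK /s -enumE.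
rewrite /lcpow; case: xgetP => [y _ [k [f [n [[f1 ff fo] fn ->]]]]|/(_ _ ex)//].
rewrite -[RHS]mul1r -(rmorph1 iota) -f1 rmorph_sum mulr_suml.
apply: eq_bigr => j _; rewrite -[LHS]mul1r -(orth_family_sum iota eo) mulr_suml mulr_sumr.
apply: eq_bigr => i _; rewrite mulrA [RHS]mulrCA [RHS]mulrA -!rmorphM.
have [->|ef0] := eqVneq (e i * f j) 0; first by rewrite rmorph0 !mul0r.
have [||p pef] := @idempotent_prime _ (e i * f j); last 1 first.
- rewrite -(fn j p); last by move=> pf; apply: pef; exact: prime_memMl.
  by rewrite (em i p) // => pe; apply: pef; rewrite mulrC; exact: prime_memMl.
- by rewrite mulrACA ee ff.
- exact/eqP.
Qed.

Lemma lcpowM nu x y : locally_constant nu ->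
  lcpow iota nu (x * y)%g = (lcpow iota nu x * lcpow iota nu y)%g.
Proof.
move=> /locally_constant_decomp[I [e [m [eo em]]]]; apply: gm_inj.
rewrite gm_valM !(lcpowE _ eo em) orth_family_mul //.
by apply: eq_bigr => i _; rewrite zpowMl gm_valM.
Qed.

Lemma lcpowD nu mu x : locally_constant nu -> locally_constant mu ->
  lcpow iota (fun p => nu p + mu p) x = (lcpow iota nu x * lcpow iota mu x)%g.
Proof.
move=> nulc /(locally_constant_decomp2 nulc)[I [e [m [n [eo emn]]]]]; apply: gm_inj.
have em i (p : Spec A) : ~ p (e i) -> nu p = m i by move=> /emn[].
have en i (p : Spec A) : ~ p (e i) -> mu p = n i by move=> /emn[].
have emn' i (p : Spec A) : ~ p (e i) -> nu p + mu p = m i + n i by move=> /emn[-> ->].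
rewrite gm_valM (lcpowE _ eo em) (lcpowE _ eo en) (lcpowE _ eo emn') orth_family_mul //.
by apply: eq_bigr => i _; rewrite zpowD gm_valM.
Qed.

Lemma lcpow_cst n x : lcpow iota (fun=> n) x = zpow x n.
Proof.
have eo : @orth_family A unit (fun=> 1).
  split=> [|i|[] []] //; rewrite ?mulr1 //.
  by rewrite big_const /= card_unit /= addr0.
apply: gm_inj; rewrite (@lcpowE _ _ (fun=> n) _ _ eo) //.
by rewrite big_const /= card_unit /= addr0 rmorph1 mul1r.
Qed.

Lemma lcpow0 x : lcpow iota (fun=> 0) x = 1%g.
Proof. by rewrite lcpow_cst. Qed.

Lemma lcpow1l nu : locally_constant nu -> lcpow iota nu 1%g = 1%g.
Proof.
move=> nulc; apply: (mulIg (lcpow iota nu 1%g)).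
by rewrite -lcpowM // !mul1g.
Qed.

Lemma lcpowV nu x : locally_constant nu ->
  lcpow iota nu x^-1%g = (lcpow iota nu x)^-1%g.
Proof.
move=> nulc; apply: (mulIg (lcpow iota nu x)).
by rewrite -lcpowM // !mulVg lcpow1l.
Qed.

Lemma lcpowN nu x : locally_constant nu ->
  lcpow iota (fun p => - nu p) x = (lcpow iota nu x)^-1%g.
Proof.
move=> nulc; have nulcN : locally_constant (fun p => - nu p).
  exact: (locally_constant_op (fun a _ => - a) nulc nulc).
apply: (mulIg (lcpow iota nu x)); rewrite -lcpowD // mulVg.
by rewrite (_ : (fun p => _) = fun=> 0) ?lcpow0 //; apply/funext => p; rewrite addNr.
Qed.

End LcPow.

Lemma lcpow_map (A B R S : comPzRingType) (h : {rmorphism A -> B})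
    (g : {rmorphism R -> S}) (iA : {rmorphism A -> R}) (iB : {rmorphism B -> S})
    (nu : Spec A -> int) (x : Gm R) : locally_constant nu ->
    (forall a, g (iA a) = iB (h a)) ->
  Gm_map g (lcpow iA nu x) = lcpow iB (nu \o Spec_map h) (Gm_map g x).
Proof.
move=> /locally_constant_decomp[I [e [m [eo em]]]] gi; have [e1 ee eoo] := eo.
have heo : orth_family (h \o e).
  split=> [|i|i j ij] /=; first by rewrite -rmorph_sum e1 rmorph1.
    by rewrite -rmorphM ee.
  by rewrite -rmorphM eoo ?rmorph0.
have hem i (p : Spec B) : ~ p ((h \o e) i) -> (nu \o Spec_map h) p = m i.
  by move=> pe; apply: em; rewrite Spec_mapE.
apply: gm_inj; rewrite gm_map_val (lcpowE _ _ eo em) (lcpowE _ _ heo hem).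
rewrite rmorph_sum; apply: eq_bigr => i _.
by rewrite rmorphM gi -Gm_map_zpow.
Qed.

(** * Birkhoff factorization and the symbol *)

Section WeakFactorization.
Variable A : comPzRingType.
Implicit Types (f g h m : laurent A) (nu mu : Spec A -> int) (c : Gm A).

Definition tpow nu : Gm (laurent A) := lcpow (@lconst A) nu (tvar A).

Lemma zpow_tvar n : gm_val (zpow (tvar A) n) = monom 1 n.
Proof.
have tX k : gm_val (tvar A ^+ k)%g = monom 1 k%:Z.
  by rewrite gm_valX /= monomX expr1n natz.
case: n => k /=; first exact: tX.
apply: gm_valV_uniq; rewrite tX monomM mulr1.
by rewrite (_ : _ + _ = 0) //; lia.
Qed.

Lemma tpowE (I : finType) (e : I -> A) (n : I -> int) nu : orth_family e ->
    (forall i (p : Spec A), ~ p (e i) -> nu p = n i) ->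
  gm_val (tpow nu) = \sum_i monom (e i) (n i).
Proof.
move=> eo en; rewrite /tpow (lcpowE _ _ eo en); apply: eq_bigr => i _.
by rewrite zpow_tvar monomM mulr1 add0r.
Qed.

Lemma tpow_cst (n : int) : gm_val (tpow (fun=> n)) = monom 1 n.
Proof. by rewrite /tpow lcpow_cst zpow_tvar. Qed.

Lemma tpowD nu mu : locally_constant nu -> locally_constant mu ->
  tpow (fun p => nu p + mu p) = (tpow nu * tpow mu)%g.
Proof. exact: lcpowD. Qed.

(** The decomposition with its two products kept as series [m] and [h]: in this form it is
    multiplicative and stable under base change, while coordinates are not multiplicative. *)
Definition weak_factorization f nu c m h : Prop :=
  [/\ locally_constant nu, is_neg m, is_pos h
    & f = m * (gm_val c *: gm_val (tpow nu)) * h].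

Lemma neg_pos_unit m (c : A) h : is_neg m -> invertible c -> is_pos h ->
  nil_tpow 0 (m * (c *: h)) /\ invertible ((m * (c *: h)) 0).
Proof.
move=> [mz m1 mn] cu [h0 h1]; split.
  by rewrite -[0]addr0; apply: nil_tpowM => //; apply/in_nil_tpow/in_tpowZ.
have -> : m * (c *: h) = c *: h + (m - 1) * (c *: h) by ring.
rewrite lcoefD lcoefZ h1 mulr1; apply: invertible_nilpD => //.
apply: (@nil_tpowM _ 1 0) => //; last by apply/in_nil_tpow/in_tpowZ.
move=> i i1; rewrite lcoefB lcoef1; have [->|i0] := eqVneq i 0.
  by rewrite m1 subrr; exact: nilpotent0.
by rewrite subr0; apply: mn; lia.
Qed.

(** Modulo a prime [p] the series has order exactly [nu p], so the series determines [nu]. *)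
Lemma order_uniq nu g : locally_constant nu -> nil_tpow 0 g -> invertible (g 0) ->
  forall p : Spec A, ~ p ((gm_val (tpow nu) * g) (nu p)) /\
    forall i, i < nu p -> p ((gm_val (tpow nu) * g) i).
Proof.
move=> /locally_constant_decomp[I [e [n [eo en]]]] gnil gu p.
rewrite (tpowE eo en) mulr_suml.
have [k [pk pj]] := orth_family_prime p eo; rewrite (en _ _ pk); split.
  rewrite lcoef_sum; under eq_bigr do rewrite lcoef_monomM.
  rewrite (bigD1 k) //= subrr => pkj.
  have : p (e k * g 0).
    rewrite -[e k * _](addrK (\sum_(i | i != k) e i * g (n k - n i))).
    apply: primeB => //; apply: prime_sum => j jk.
    by rewrite mulrC; apply/prime_memMl/pj.
  by move=> /prime_memM[//|]; exact: prime_invertible.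
move=> i ik; rewrite lcoef_sum; apply: prime_sum => j _; rewrite lcoef_monomM.
have [->|jk] := eqVneq j k; last by rewrite mulrC; apply/prime_memMl/pj.
by apply/prime_memMl/nilpotent_prime/gnil; lia.
Qed.

Lemma weak_factorization_uniq f nu nu' c c' m m' h h' :
    weak_factorization f nu c m h -> weak_factorization f nu' c' m' h' ->
  [/\ nu = nu', c = c', m = m' & h = h'].
Proof.
have wfE mu d n k : n * (gm_val d *: gm_val (tpow mu)) * k =
    gm_val (tpow mu) * (n * (gm_val d *: k)).
  by rewrite !scale_monomM; ring.
move=> [nulc mneg hpos ->] [nulc' mneg' hpos'].
have [mn mu] := neg_pos_unit mneg (gm_invertible c) hpos.
have [mn' mu'] := neg_pos_unit mneg' (gm_invertible c') hpos'.
rewrite !wfE => e.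
have nuE : nu = nu'.
  apply/funext => p; have [p1 p2] := order_uniq nulc mn mu p.
  have [p1' p2'] := order_uniq nulc' mn' mu' p; rewrite e in p1 p2.
  case: (ltgtP (nu p) (nu' p)) => // [/p2'|/p2] //.
move: e; rewrite nuE => /(invertible_mulI (gm_invertible _)) e.
by have [-> /gm_inj -> ->] := birkhoff_uniq mneg mneg' (gm_invertible c) hpos hpos' e.
Qed.

(** Induction on i + j. By the coefficient of degree i + j in f g = 1, the square of f_i g_j is
    minus a sum of products f_i g_j f_l g_(i+j-l) with l different from i. Each contains a product
    of smaller total degree: f_l g_j if l < i, and f_i g_(i+j-l) if l > i. *)
Lemma lead_products_nilpotent f g : f * g = 1 ->
  forall i j, i + j < 0 -> nilpotent (f i * g j).
Proof.
move=> fg; have [Mf fM] := laurent_boundN f; have [Mg gM] := laurent_boundN g.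
suff H n : forall i j : int, i + j + Mf%:Z + Mg%:Z < n%:Z -> i + j < 0 ->
    nilpotent (f i * g j).
  by move=> i j ij; apply: (H (absz (i + j + Mf%:Z + Mg%:Z)).+1) => //; lia.
elim: n => [|n IHn] i j ijn ij.
  have [iM|iM] := ltP i (- Mf%:Z); first by rewrite fM // mul0r; exact: nilpotent0.
  by rewrite gM ?mulr0; [exact: nilpotent0 | lia].
have [iM|iM] := ltP i (- Mf%:Z); first by rewrite fM // mul0r; exact: nilpotent0.
have [jM|jM] := ltP j (- Mg%:Z); first by rewrite gM // mulr0; exact: nilpotent0.
have := congr1 (fun f : laurent A => f (i + j)) fg; rewrite lcoef1 lt_eqF //.
rewrite (@lcoefM_window _ f g Mf Mg n.+2) //; last lia.
pose i' := absz (i + Mf%:Z); have ik : (i' < n.+2)%N by lia.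
rewrite (bigD1 (Ordinal ik)) //=.
have -> : i'%:Z - Mf%:Z = i by lia.
have -> : i + j - i = j by lia.
move=> /(congr1 (fun x => f i * g j * x)); rewrite mulr0 mulrDr.
move=> /eqP; rewrite addr_eq0 => /eqP e.
apply: (@nilpotent_of_exp _ _ 2); rewrite expr2 e; apply: nilpotentN.
rewrite mulr_sumr; apply: nilpotent_sum => k ki.
set l := k%:Z - Mf%:Z; have li : l != i.
  by apply: contraNneq ki => e'; rewrite -val_eqE /=; apply/eqP; lia.
have [lti|gei] := ltP l i.
  have -> : f i * g j * (f l * g (i + j - l)) = f l * g j * (f i * g (i + j - l)).
    by ring.
  by apply/nilpotentMr/IHn; lia.
have -> : f i * g j * (f l * g (i + j - l)) = f i * g (i + j - l) * (f l * g j).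
  by ring.
by apply/nilpotentMr/IHn; lia.
Qed.

(** The elements x_k = f_k g_(-k) sum to 1, the constant term of f g, and have nilpotent pairwise
    products. The idempotents that lift them mark where [f] has order k; after division by t^nu,
    Birkhoff factorization applies. *)
Lemma weak_factorization_exists f : invertible f ->
  exists nu c m h, weak_factorization f nu c m h.
Proof.
move=> [g fg]; have fgn := lead_products_nilpotent fg.
have [Mf fM] := laurent_boundN f; have [Mg gM] := laurent_boundN g.
pose K := (Mf + Mg).+1; pose n (k : 'I_K) := k%:Z - Mf%:Z.
pose x k := f (n k) * g (- n k).
have x1 : \sum_k x k = 1.
  have e : (f * g) 0 = 1 by rewrite fg.
  rewrite -e (@lcoefM_window _ f g Mf Mg K) //; last lia.
  by apply: eq_bigr => k _; rewrite /x /n sub0r.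
have xn k l : k != l -> nilpotent (x k * x l).
  move=> kl; have nkl : n k != n l.
    by apply: contraNneq kl; rewrite /n => e; rewrite -val_eqE /=; apply/eqP; lia.
  have [lt|ge] := ltP (n k) (n l).
    have -> : x k * x l = f (n k) * g (- n l) * (f (n l) * g (- n k)).
      by rewrite /x; ring.
    by apply/nilpotentMr/fgn; lia.
  have -> : x k * x l = f (n l) * g (- n k) * (f (n k) * g (- n l)).
    by rewrite /x; ring.
  by apply/nilpotentMr/fgn; lia.
have [e [eo [d ed]]] := idempotent_lift x1 xn; have [e1 ee eoo] := eo.
have pick (p : Spec A) := orth_family_prime p eo.
have uniq_k (p : Spec A) k l : ~ p (e k) -> ~ p (e l) -> k = l.
  move=> pk pl; apply: contrapT => /eqP kl; have := prime_mem0 p.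
  by rewrite -(eoo k l kl) => /prime_memM[].
have /choice[kp kpP] : forall p : Spec A, exists k, ~ p (e k).
  by move=> p; have [k [pk _]] := pick p; exists k.
pose nu p := n (kp p).
have nuE k (p : Spec A) : ~ p (e k) -> nu p = n k.
  by move=> pk; congr n; apply: (uniq_k p) => //; exact: kpP.
have nulc : locally_constant nu.
  move=> p; exists (e (kp p)); split; first exact: kpP.
  by move=> q qk; rewrite (nuE _ _ qk).
pose f' := gm_val (tpow nu)^-1%g * f.
have ff' : f = gm_val (tpow nu) * f' by rewrite mulrA gm_valV mul1r.
have f'E i : f' i = \sum_k e k * f (i + n k).
  have -> : f' = gm_val (tpow (fun p => - nu p)) * f by rewrite /tpow lcpowN.
  rewrite (@tpowE _ e (fun k => - n k)) //.
    rewrite mulr_suml lcoef_sum; apply: eq_bigr => k _.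
    by rewrite lcoef_monomM opprK.
  by move=> k p /nuE->.
have [||m [c [h [mneg cu hpos f'm]]]] := @birkhoff _ f'.
- move=> i i0; rewrite f'E; apply: nilpotent_sum => k _; rewrite ed /x.
  have -> : d k * (f (n k) * g (- n k)) * f (i + n k) =
    d k * f (n k) * (f (i + n k) * g (- n k)) by ring.
  by apply/nilpotentMl/fgn; lia.
(* The cofactor is the constant term of t^nu g. The product is the sum of the e_k x_k, which differs
   from 1 by nilpotent terms e_i x_j with j different from i. *)
- apply: (@invertible_mull _ _ (\sum_k e k * g (- n k))).
  rewrite f'E (orth_family_mul (idfun : {rmorphism A -> A})) //.
  have -> : \sum_i e i * (f (0 + n i) * g (- n i)) =
      1 - \sum_i \sum_(j | j != i) e i * x j.
    rewrite -{1}e1 -sumrB; apply: eq_bigr => i _; rewrite add0r -/(x i).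
    by rewrite -[e i in X in _ = X - _]mulr1 -x1 [\sum_i x i](bigD1 i) //= mulrDr
       -mulr_sumr addrK.
  apply: invertible_1Bnil; apply: nilpotent_sum => i _; apply: nilpotent_sum => j ji.
  by rewrite ed -mulrA; apply/nilpotentMl/xn; rewrite eq_sym.
exists nu, (toGm cu), m, h; split=> //; rewrite ff' f'm toGmK !scale_monomM.
by ring.
Qed.

Lemma neg_fsprod (a : int -> A) (L : nat) : (forall i, i <= - L%:Z -> a i = 0) ->
  \big[*%R/1]_(i \in [set i : int | i < 0]) (1 - monom (a i) i) =
  \prod_(1 <= j < L) (1 - monom (a (- j%:Z)) (- j%:Z)).
Proof.
move=> aL; rewrite (fsbigE [seq - j%:Z | j <- index_iota 1 L]) /=.
- rewrite big_map big_seq_cond [RHS]big_seq; apply: eq_bigl => j.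
  rewrite mem_index_iota andbC; case: (boolP (1 <= j < L)%N) => [jL|]; last by rewrite andbF.
  by rewrite andbT; apply/mem_set => /=; lia.
- by rewrite map_inj_uniq ?iota_uniq // => i j; lia.
- by move=> i /= /mapP[j]; rewrite mem_index_iota => jL ->; rewrite /=; lia.
- move=> i /= i0 /mapP nj; have [iL|iL] := lerP i (- L%:Z).
    by rewrite aL // monom0 subr0.
  by case: nj; exists (absz i); [rewrite mem_index_iota|]; lia.
Qed.

Lemma witt_coords_exists (a : nat -> A) : exists2 h, is_pos h & witt_coords a h.
Proof.
pose P n : laurent A := \prod_(1 <= i < n) (1 - monom (a i) i%:Z).
have P0 n : is_pos (P n).
  rewrite /P big_nat; apply: big_ind; [exact: is_pos1|exact: is_posM|].
  by move=> i /andP[i1 _]; exact: is_pos_monom.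
have PS n : in_tpow n%:Z (P n.+1 - P n).
  case: n => [|n].
    by apply: in_tpowB; [case: (P0 1%N) | case: (P0 0%N)].
  rewrite /P big_nat_recr //= -/(P n.+1) mulrBr mulr1.
  rewrite addrAC subrr sub0r; apply/in_tpowN/in_tpowMl; first by case: (P0 n.+1).
  exact: in_tpow_monom.
have Pk n k : (n <= k)%N -> in_tpow n%:Z (P k - P n).
  move=> /subnKC <-; elim: (k - n)%N => [|d IHd]; first by rewrite addn0 subrr.
  rewrite addnS; apply: in_tpow_trans IHd; apply: in_tpowW (PS _); lia.
have [|h hP] := @laurent_complete _ P.
  by move=> n; exists (absz n) => k nk; apply: in_tpowW (PS k); lia.
have ha : witt_coords a h.
  move=> n; have [K KP] := hP n%:Z; rewrite -/(P n).
  apply: (@in_tpow_trans _ _ (P (n + K)%N)).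
    by apply/in_tpow_sym/Pk; rewrite leq_addr.
  by apply: KP; rewrite leq_addl.
exists h => //; split.
  have := ha 1%N; rewrite big_geq // => /(in_tpowW (m := 0)).
  move=> /(_ isT) h1; rewrite -[h](subKr 1); apply: in_tpowB => //; exact: in_tpow1.
have := ha 1%N; rewrite big_geq // => /(_ 0 isT) /eqP.
by rewrite lcoefB lcoef1 subr_eq0 => /eqP <-.
Qed.

Lemma witt_coords_lim (a : int -> A) h : witt_coords (a \o Posz) h ->
  lim ((fun N : nat => \prod_(1 <= i < N) (1 - monom (a i%:Z) i%:Z)) @ \oo) = h.
Proof.
move=> ah; apply: tadic_limE => n; exists (absz n) => k nk.
by apply: in_tpowW (ah k); lia.
Qed.

Lemma factorization_weak f (a : factorization f) : exists m h (L : nat),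
  [/\ weak_factorization f (cf_nu a) (cf_lead a) m h,
      witt_coords (cf_coef a \o Posz) h,
      forall j, (L <= j)%N -> cf_coef a (- j%:Z) = 0
    & m = \prod_(1 <= j < L) (1 - monom (cf_coef a (- j%:Z)) (- j%:Z))].
Proof.
have [h hpos ha] := witt_coords_exists (cf_coef a \o Posz).
have [L aL] : exists L : nat, forall i, i <= - L%:Z -> cf_coef a i = 0.
  have /finite_seqP[s sE] := cf_fin a.
  exists (\sum_(i <- s) absz i).+1 => i iL; apply: contrapT => ai.
  have : i \in s by have : [set` s] i by rewrite -sE /=; split=> //; lia.
  move=> si; have le : (absz i <= \sum_(i <- s) absz i)%N.
    by rewrite (big_rem i) //= leq_addr.
  by move: (\sum_(i <- s) absz i) le iL => N; lia.
exists (\prod_(1 <= j < L) (1 - monom (cf_coef a (- j%:Z)) (- j%:Z))), h, L; split=> //.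
- split=> //; first exact: cf_nu_lc.
    apply: is_neg_prod => j; rewrite mem_index_iota => jL; apply: is_neg_monom; first lia.
    by apply: cf_nil; lia.
  by rewrite [LHS](cf_eq a) (neg_fsprod aL) (witt_coords_lim ha).
- by move=> j Lj; apply: aL; lia.
Qed.

(** Only the existence of coordinates is claimed; any choice of them yields the same symbol, which
    depends on [m] and [h] alone. *)
Lemma weak_factorization_coords f nu c m h : weak_factorization f nu c m h ->
  exists a : factorization f, True.
Proof.
move=> [nulc mneg hpos fE].
have [p hp] := witt_pos hpos; have [b [L [nb bL mb]]] := witt_neg mneg.
pose a i := match i with Posz k => p k | Negz k => b k.+1 end.
have aN (j : nat) : (0 < j)%N -> a (- j%:Z) = b j by case: j => // j _.
have aL i : i <= - L.+1%:Z -> a i = 0.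
  by case: i => [k|k] iL; rewrite /= ?bL //; lia.
have anil i : i < 0 -> nilpotent (a i) by case: i => // k _; exact: nb.
have afin : finite_set [set i : int | i < 0 /\ a i <> 0].
  apply: (@sub_finite_set _ _ [set` [seq - j%:Z | j <- iota 0 L.+1]]).
    move=> i [i0 ai]; apply/mapP; exists (absz i); last lia.
    rewrite mem_iota; apply: contrapT => iL; apply: ai; apply: aL; lia.
  exact: finite_seq.
have ha : witt_coords (a \o Posz) h by [].
apply: ex_intro I; apply: (@Factorization _ _ nu c a) => //.
have mE : m = \prod_(1 <= j < L.+1) (1 - monom (a (- j%:Z)) (- j%:Z)).
  have [L0|L0] := leqP L 0; first by rewrite mb !big_geq //; lia.
  rewrite [RHS]big_nat_recr //= aN // bL // monom0 subr0 mulr1 mb.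
  by rewrite [LHS]big_nat [RHS]big_nat; apply: eq_bigr => j /andP[j0 _]; rewrite aN.
by rewrite (neg_fsprod aL) (witt_coords_lim ha) -mE.
Qed.

End WeakFactorization.

Lemma gm_fsprod (A : comPzRingType) (F : nat * nat -> Gm A) (N L : nat) :
    (forall ij, ~~ ((ij.1 < N) && (ij.2 < L))%N -> F ij = 1%g) ->
  gm_val (\big[*%g/1%g]_(ij \in [set: nat * nat]) F ij) =
  \prod_(0 <= i < N) \prod_(0 <= j < L) gm_val (F (i, j)).
Proof.
move=> F1; rewrite (big_morph (@gm_val A) (@gm_valM A) (gm_val1 A)).
have -> : finite_support 1%g [set: nat * nat] F =
    finite_support 1 [set: nat * nat] (fun ij => gm_val (F ij)).
  rewrite /finite_support !unlock.
  suff -> : [set: nat * nat] `&` F @^-1` [set~ 1%g] =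
    [set: nat * nat] `&` (fun ij => gm_val (F ij)) @^-1` [set~ 1] by [].
  apply/seteqP; split=> ij [_ Fij].
    by split=> // e; apply: Fij; exact: gm_inj.
  by split=> // e; apply: Fij => /=; rewrite e.
rewrite (fsbigE [seq (i, j) | i <- iota 0 N, j <- iota 0 L]) //=; last 2 first.
- by apply: allpairs_uniq; rewrite ?iota_uniq // => -[? ?] [? ?].
- move=> [i j] _ nij; rewrite F1 //=; apply: contra nij => /andP[iN jL].
  by apply/allpairsP; exists (i, j); rewrite !mem_iota.
rewrite (eq_bigl xpredT) => [|ij]; last by rewrite in_setT.
by rewrite big_allpairs /index_iota !subn0.
Qed.

(** * The symbol: well-definedness, bimultiplicativity, base change *)

Section Symbol.
Variable A : comPzRingType.
Implicit Types (f g h m : laurent A) (nu mu : Spec A -> int) (c : Gm A).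

Lemma cc_half_pairing f g (a : factorization f) (b : factorization g) h m (L : nat) :
    is_pos h -> is_neg m -> witt_coords (cf_coef a \o Posz) h ->
    (forall j, (L <= j)%N -> cf_coef b (- j%:Z) = 0) ->
    m = \prod_(1 <= j < L) (1 - monom (cf_coef b (- j%:Z)) (- j%:Z)) ->
  gm_val (cc_half a b) = pairing h m.
Proof.
move=> hpos mneg ha bL mb.
(* The value at index 0 is reset so that every [b' j] is nilpotent, as [pairing_spec_witt]
   requires. *)
pose b' j := if j is 0 then 0 else cf_coef b (- j%:Z).
have nb' j : nilpotent (b' j).
  by case: j => [|j]; [exact: nilpotent0 | apply: cf_nil; lia].
have mb' : m = \prod_(1 <= j < L) (1 - monom (b' j) (- j%:Z)).
  by rewrite mb [LHS]big_nat [RHS]big_nat; apply: eq_bigr => -[].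
have [N [N1 /(_ N.+1 (leqnSn _)) hm]] := pairing_spec_witt hpos ha nb' mb'.
have factorE i j : gm_val (toGm (invertible_1Bnil (cc_factor_subproof a b i j))
     ^+ gcdn i.+1 j.+1)%g = local_factor i.+1 j.+1 (cf_coef a i.+1) (b' j.+1).
  by rewrite gm_valX toGmK.
have factor1 i j : (L <= j.+1)%N ->
    local_factor i.+1 j.+1 (cf_coef a i.+1) (b' j.+1) = 1.
  move=> Lj; rewrite /local_factor /b' bL // expr0n.
  have -> : (i.+1 %/ gcdn i.+1 j.+1 == 0)%N = false.
    by apply/negbTE; rewrite -lt0n divn_gt0 ?gcdn_gt0 // dvdn_leq ?dvdn_gcdl.
  by rewrite mulr0 subr0 expr1n.
rewrite (pairing_uniq hpos mneg hm) /cc_half (@gm_fsprod _ _ N L).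
  rewrite [RHS](@big_add1 _ _ _ 0 N.+1) /=; apply: eq_bigr => i _.
  have [L0|L0] := posnP L; first by rewrite L0 !big_geq.
  rewrite [RHS](@big_add1 _ _ _ 0 L) -[L in LHS](prednK L0) big_nat_recr //=.
  rewrite factorE factor1 ?prednK // mulr1.
  by apply: eq_bigr => j _; rewrite factorE.
move=> [i j] /=; rewrite negb_and -!leqNgt => ijNL; apply: gm_inj; rewrite factorE.
have [Lj|jL] := leqP L j.+1; first exact: factor1.
by apply: N1; [case/orP: ijNL; lia | rewrite jL].
Qed.

Definition gpairing h m : Gm A := xget 1%g [set x : Gm A | gm_val x = pairing h m].

Lemma gpairingE h m : is_pos h -> is_neg m -> gm_val (gpairing h m) = pairing h m.
Proof.
move=> hpos mneg; rewrite /gpairing; case: xgetP => [//|no].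
by case: (no (toGm (pairing_invertible hpos mneg))).
Qed.

Definition symbol nu c m h nu' c' m' h' : Gm A :=
  (lcpow (idfun : {rmorphism A -> A}) (fun p => (nu p * nu' p)%R) (gm_opp1 A)
   * ((lcpow (idfun : {rmorphism A -> A}) nu' c * gpairing h m')
      / (lcpow (idfun : {rmorphism A -> A}) nu c' * gpairing h' m)))%g.

Lemma CC_formula_symbol f g (a : factorization f) (b : factorization g)
    nu c m h nu' c' m' h' :
    weak_factorization f nu c m h -> weak_factorization g nu' c' m' h' ->
  CC_formula a b = symbol nu c m h nu' c' m' h'.
Proof.
move=> wf wg.
have [ma [ha [La [wa haa aL maE]]]] := factorization_weak a.
have [mb [hb [Lb [wb hbb bL mbE]]]] := factorization_weak b.
have [<- <- <- <-] := weak_factorization_uniq wa wf.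
have [<- <- <- <-] := weak_factorization_uniq wb wg.
have [_ man hap _] := wa; have [_ mbn hbp _] := wb.
rewrite /symbol; have -> : gpairing ha mb = cc_half a b.
  by apply: gm_inj; rewrite gpairingE // (cc_half_pairing hap mbn haa bL mbE).
have -> : gpairing hb ma = cc_half b a.
  by apply: gm_inj; rewrite gpairingE // (cc_half_pairing hbp man hbb aL maE).
by [].
Qed.

Lemma is_CC_symbol f g nu c m h nu' c' m' h' x :
    weak_factorization f nu c m h -> weak_factorization g nu' c' m' h' ->
  is_CC f g x <-> x = symbol nu c m h nu' c' m' h'.
Proof.
move=> wf wg; split=> [[a [b ->]]|->]; first exact: CC_formula_symbol.
have [a _] := weak_factorization_coords wf; have [b _] := weak_factorization_coords wg.
by exists a, b; rewrite (CC_formula_symbol a b wf wg).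
Qed.

Lemma CCE f g nu c m h nu' c' m' h' :
    weak_factorization f nu c m h -> weak_factorization g nu' c' m' h' ->
  CC f g = symbol nu c m h nu' c' m' h'.
Proof.
move=> wf wg; have e := is_CC_symbol _ wf wg; rewrite /CC.
case: xgetP => [x _ /e//|/(_ _ (proj2 (e _) erefl))//].
Qed.

Lemma CC_uniq f g : invertible f -> invertible g -> exists! c, is_CC f g c.
Proof.
move=> /weak_factorization_exists[nu [c [m [h wf]]]].
move=> /weak_factorization_exists[nu' [c' [m' [h' wg]]]].
exists (symbol nu c m h nu' c' m' h'); split; first exact/(is_CC_symbol _ wf wg).
by move=> x /(is_CC_symbol _ wf wg)->.
Qed.

Lemma weak_factorizationM f g nu c m h nu' c' m' h' :
    weak_factorization f nu c m h -> weak_factorization g nu' c' m' h' ->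
  weak_factorization (f * g) (fun p => nu p + nu' p) (c * c')%g (m * m') (h * h').
Proof.
move=> [nulc mn hp ->] [nulc' mn' hp' ->]; split.
- exact: (locally_constant_op +%R).
- exact: is_negM.
- exact: is_posM.
- rewrite tpowD // !gm_valM !scale_monomM -!/(lconst _) rmorphM.
  set T := gm_val _; set T' := gm_val _; by ring.
Qed.

Lemma gpairingMl h h' m : is_pos h -> is_pos h' -> is_neg m ->
  gpairing (h * h') m = (gpairing h m * gpairing h' m)%g.
Proof.
move=> hp hp' mn; apply: gm_inj; rewrite gm_valM !gpairingE ?pairingMl //.
exact: is_posM.
Qed.

Lemma gpairingMr h m m' : is_pos h -> is_neg m -> is_neg m' ->
  gpairing h (m * m') = (gpairing h m * gpairing h m')%g.
Proof.
move=> hp mn mn'; apply: gm_inj; rewrite gm_valM !gpairingE ?pairingMr //.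
exact: is_negM.
Qed.

Lemma gpairing1l m : is_neg m -> gpairing 1 m = 1%g.
Proof.
move=> mn; apply: gm_inj; rewrite gpairingE ?pairing1l //; exact: is_pos1.
Qed.

Lemma gpairing1r h : is_pos h -> gpairing h 1 = 1%g.
Proof.
move=> hp; apply: gm_inj; rewrite gpairingE ?pairing1r //; exact: is_neg1.
Qed.

Lemma CCMl f1 f2 g : invertible f1 -> invertible f2 -> invertible g ->
  CC (f1 * f2) g = (CC f1 g * CC f2 g)%g.
Proof.
move=> /weak_factorization_exists[n1 [c1 [m1 [h1 w1]]]].
move=> /weak_factorization_exists[n2 [c2 [m2 [h2 w2]]]].
move=> /weak_factorization_exists[n [c [m [h w]]]].
rewrite (CCE w1 w) (CCE w2 w) (CCE (weak_factorizationM w1 w2) w) /symbol.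
have [nlc1 mn1 hp1 _] := w1; have [nlc2 mn2 hp2 _] := w2; have [nlc mn hp _] := w.
have lcM k l : locally_constant k -> locally_constant l ->
    locally_constant (fun p : Spec A => k p * l p).
  exact: (locally_constant_op *%R).
have -> : (fun p => (n1 p + n2 p) * n p) = (fun p => n1 p * n p + n2 p * n p).
  by apply/funext => p; rewrite mulrDl.
rewrite (lcpowD _ _ (lcM _ _ nlc1 nlc) (lcM _ _ nlc2 nlc)) lcpowM // lcpowD //.
rewrite gpairingMl // gpairingMr //.
by rewrite [RHS]gmACA; congr (_ * _)%g; rewrite [RHS]gmACA -gm_invM;
  congr (_ / _)%g; exact: gmACA.
Qed.

Lemma CC_anti f g : invertible f -> invertible g -> CC g f = (CC f g)^-1%g.
Proof.
move=> /weak_factorization_exists[n1 [c1 [m1 [h1 w1]]]].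
move=> /weak_factorization_exists[n2 [c2 [m2 [h2 w2]]]].
rewrite (CCE w1 w2) (CCE w2 w1) /symbol.
have [nlc1 _ _ _] := w1; have [nlc2 _ _ _] := w2.
have nlc12 : locally_constant (fun p : Spec A => n1 p * n2 p).
  exact: (locally_constant_op *%R).
have -> : (fun p => n2 p * n1 p) = (fun p => n1 p * n2 p).
  by apply/funext => p; rewrite mulrC.
rewrite [RHS]gm_invM; congr (_ * _)%g; last by rewrite invgF.
by rewrite -lcpowV //; congr (lcpow _ _ _); apply: gm_inj; apply/esym/gm_valV_uniq;
  rewrite /= mulrNN mulr1.
Qed.

Lemma CCMr f g1 g2 : invertible f -> invertible g1 -> invertible g2 ->
  CC f (g1 * g2) = (CC f g1 * CC f g2)%g.
Proof.
move=> fu gu1 gu2; rewrite (CC_anti (invertibleM gu1 gu2) fu) CCMl // gm_invM.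
by rewrite -!CC_anti.
Qed.

End Symbol.

Section SymbolMap.
Variables (A B : comPzRingType) (i : {rmorphism A -> B}).

Lemma gpairing_map h m : is_pos h -> is_neg m ->
  Gm_map i (gpairing h m) = gpairing (lmap i h) (lmap i m).
Proof.
move=> hp mn; apply: gm_inj; rewrite gm_map_val !gpairingE //.
- by rewrite pairing_map.
- exact: is_pos_map.
- exact: is_neg_map.
Qed.

Lemma tpow_map (nu : Spec A -> int) : locally_constant nu ->
  lmap i (gm_val (tpow nu)) = gm_val (tpow (nu \o Spec_map i)).
Proof.
move=> nulc; pose g : {rmorphism laurent A -> laurent B} := lmap i.
have gi a : g (lconst a) = lconst (i a) by exact: lmap_const.
have /(congr1 (@gm_val _)) e := lcpow_map (iB := @lconst B) (tvar A) nulc gi.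
have tB : Gm_map g (tvar A) = tvar B.
  by apply: gm_inj; rewrite /= lmap_monom rmorph1.
by rewrite tB in e; exact: e.
Qed.

Lemma weak_factorization_map f nu c m h : weak_factorization f nu c m h ->
  weak_factorization (lmap i f) (nu \o Spec_map i) (Gm_map i c) (lmap i m) (lmap i h).
Proof.
move=> [nulc mn hp ->]; split.
- exact: locally_constant_map.
- exact: is_neg_map.
- exact: is_pos_map.
- by rewrite !rmorphM /= lmapZ tpow_map.
Qed.

Lemma CC_map f g : invertible f -> invertible g ->
  CC (lmap i f) (lmap i g) = Gm_map i (CC f g).
Proof.
move=> /weak_factorization_exists[n1 [c1 [m1 [h1 w1]]]].
move=> /weak_factorization_exists[n2 [c2 [m2 [h2 w2]]]].
rewrite (CCE w1 w2) (CCE (weak_factorization_map w1) (weak_factorization_map w2)).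
have [nlc1 mn1 hp1 _] := w1; have [nlc2 mn2 hp2 _] := w2.
have nlc12 : locally_constant (fun p : Spec A => n1 p * n2 p).
  exact: (locally_constant_op *%R).
have lm nu x : locally_constant nu ->
    Gm_map i (lcpow (idfun : {rmorphism A -> A}) nu x) =
    lcpow (idfun : {rmorphism B -> B}) (nu \o Spec_map i) (Gm_map i x).
  by move=> nulc; apply: lcpow_map.
rewrite /symbol !Gm_mapM !Gm_mapV !Gm_mapM !gpairing_map // !lm //.
congr (lcpow _ _ _ * _)%g; apply: gm_inj; rewrite gm_map_val /= rmorphN.
by rewrite rmorph1.
Qed.

End SymbolMap.

(** * Continuous endomorphisms *)

Section Density.
Variable A : comPzRingType.
Implicit Types (f g : laurent A) (u : Gm (laurent A)).

Lemma lcomp_partialS f u (N : nat) : (0 < N)%N -> lcomp_partial f u N.+1 =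
  lcomp_partial f u N + (f N%:Z *: gm_val (zpow u N%:Z)
    + f (- N%:Z) *: gm_val (zpow u (- N%:Z))).
Proof.
by move=> N0; rewrite /lcomp_partial big_nat_recr // [in LHS]big_nat_recr //= addrACA.
Qed.

Lemma lcoef_partial f (N : nat) i : lcomp_partial f (tvar A) N i =
  if (absz i < N)%N then f i else 0.
Proof.
elim: N => [|[|N] IHN].
- by rewrite /lcomp_partial !big_geq // addr0.
- rewrite /lcomp_partial big_nat1 big_geq // addr0 lcoefZ zpow_tvar lcoef_monom.
  by case: eqVneq => [->|i0]; rewrite ?mulr1 // ifF ?mulr0 //; lia.
rewrite lcomp_partialS // lcoefD IHN lcoefD !lcoefZ !zpow_tvar !lcoef_monom.
case: ltnP => iN.
  have i1 : (i == N.+1%:Z) = false by lia.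
  have i2 : (i == - N.+1%:Z) = false by lia.
  by rewrite i1 i2 !mulr0n !mulr0 !addr0 ifT //; lia.
case: ltnP => iN2; last first.
  have i1 : (i == N.+1%:Z) = false by lia.
  have i2 : (i == - N.+1%:Z) = false by lia.
  by rewrite i1 i2 !mulr0n !mulr0 !addr0.
have N1 : (N.+1%:Z == - N.+1%:Z) = false by lia.
have N2 : (- N.+1%:Z == N.+1%:Z) = false by lia.
rewrite add0r; have [->|->] : i = N.+1%:Z \/ i = - N.+1%:Z by lia.
- by rewrite eqxx N1 mulr0n mulr0 addr0 mulr1n mulr1.
- by rewrite eqxx N2 mulr0n mulr0 add0r mulr1n mulr1.
Qed.

Lemma partial_lim f : tadic_lim (lcomp_partial f (tvar A)) f.
Proof.
move=> n; have [M fM] := laurent_boundN f; exists (absz n + M).+1 => k nk i ni.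
rewrite lcoefB lcoef_partial; case: ifP => ik; first by rewrite subrr.
by rewrite fM ?subrr //; lia.
Qed.

Lemma partial_ind (P : laurent A -> Prop) f (N : nat) : P 0 ->
    (forall g h, P g -> P h -> P (g + h)) -> (forall a k, P (monom a k)) ->
  P (lcomp_partial f (tvar A) N).
Proof.
move=> P0 PD Pm; have Pz a k : P (a *: gm_val (zpow (tvar A) k)).
  by rewrite zpow_tvar -monomE.
by apply: (PD); apply: big_ind => [||i _]; by [exact: P0 | exact: PD | exact: Pz].
Qed.

(** Finite sums of monomials are dense. This gives the chain rule, and its bilinear form [density2]
    gives the Leibniz rule and the multiplicativity of substitution. *)
Lemma density (D : laurent A -> laurent A) f :
    (forall g h, D (g + h) = D g + D h) -> (forall a k, D (monom a k) = 0) ->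
    (forall s L, tadic_lim s L -> tadic_lim (fun N => D (s N)) (D L)) ->
  D f = 0.
Proof.
move=> DD Dm Dc; apply: (@tadic_lim_uniq _ _ _ _ (Dc _ _ (partial_lim f))).
apply: (@tadic_lim_ext _ (fun=> 0)); last exact: tadic_lim_cst.
exists 0%N => k _; apply/esym; apply: (@partial_ind (fun g => D g = 0)) => //.
  by have := Dm 0 0; rewrite monom0.
by move=> g h Dg Dh; rewrite DD Dg Dh addr0.
Qed.

Lemma density2 (D : laurent A -> laurent A -> laurent A) f g :
    (forall g f1 f2, D (f1 + f2) g = D f1 g + D f2 g) ->
    (forall f g1 g2, D f (g1 + g2) = D f g1 + D f g2) ->
    (forall a j b k, D (monom a j) (monom b k) = 0) ->
    (forall s s' L L', tadic_lim s L -> tadic_lim s' L' ->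
       tadic_lim (fun N => D (s N) (s' N)) (D L L')) ->
  D f g = 0.
Proof.
move=> Dl Dr Dm Dc.
apply: (@tadic_lim_uniq _ _ _ _ (Dc _ _ _ _ (partial_lim f) (partial_lim g))).
apply: (@tadic_lim_ext _ (fun=> 0)); last exact: tadic_lim_cst.
exists 0%N => k _; apply/esym.
apply: (@partial_ind (fun f => D f (lcomp_partial g (tvar A) k) = 0)).
- have := Dl (lcomp_partial g (tvar A) k) 0 0; rewrite addr0 => /eqP.
  by rewrite -subr_eq0 opprD addrA subrr sub0r oppr_eq0 => /eqP.
- by move=> f1 f2 D1 D2; rewrite Dl D1 D2 addr0.
move=> a j; apply: (@partial_ind (fun g => D (monom a j) g = 0)) => //.
- by have := Dm a j 0 0; rewrite monom0.
- by move=> g1 g2 D1 D2; rewrite Dr D1 D2 addr0.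
Qed.

Lemma tadic_limN s (L : laurent A) : tadic_lim s L -> tadic_lim (fun N => - s N) (- L).
Proof.
move=> sL n; have [K KP] := sL n; exists K => k Kk.
by rewrite -opprD; apply/in_tpowN/KP.
Qed.

Lemma tadic_limB s s' (L L' : laurent A) : tadic_lim s L -> tadic_lim s' L' ->
  tadic_lim (fun N => s N - s' N) (L - L').
Proof. by move=> sL sL'; apply/tadic_limD/tadic_limN. Qed.

Lemma lderivD f g : lderiv (f + g) = lderiv f + lderiv g.
Proof. by apply/laurentP => i; rewrite /= mulrzDl. Qed.

Lemma lderiv_lim s (L : laurent A) : tadic_lim s L -> tadic_lim (fun N => lderiv (s N)) (lderiv L).
Proof.
move=> sL n; have [K KP] := sL (n + 1); exists K => k Kk i ni.
rewrite lcoefB !lcoef_deriv -mulrzBl -lcoefB KP ?mul0rz //; lia.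
Qed.

Lemma lderiv_monom (a : A) (k : int) : lderiv (monom a k) = monom (a *~ k) (k - 1).
Proof.
apply/laurentP => i; rewrite lcoef_deriv !lcoef_monom.
have -> : (i == k - 1) = (i + 1 == k) by lia.
by case: eqP => [->|_]; rewrite ?mulr1n // !mulr0n mul0rz.
Qed.

Lemma lderivM f g : lderiv (f * g) = lderiv f * g + f * lderiv g.
Proof.
apply/eqP; rewrite -subr_eq0; apply/eqP.
apply: (@density2 (fun f g => lderiv (f * g) - (lderiv f * g + f * lderiv g))).
- by move=> h f1 f2; rewrite !mulrDl !lderivD; ring.
- by move=> h f1 f2; rewrite !mulrDr !lderivD; ring.
- move=> a j b k; rewrite monomM !lderiv_monom !monomM.
  have -> : j + (k - 1) = j + k - 1 by lia.
  have -> : j - 1 + k = j + k - 1 by lia.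
  by rewrite -monomD mulrzAl mulrzAr -mulrzDr subrr.
- move=> s s' L L' sL sL'; apply: tadic_limB; first exact/lderiv_lim/tadic_limM.
  by apply: tadic_limD; apply: tadic_limM => //; exact: lderiv_lim.
Qed.

End Density.

Section Endomorphisms.
Variable A : comPzRingType.
Implicit Types (f g : laurent A) (phi : laurent A -> laurent A).

(** Continuity at zero, which for additive maps is continuity everywhere. *)
Definition tadic_continuous phi : Prop :=
  forall n, exists N, forall f, in_tpow N f -> in_tpow n (phi f).

Record is_cendo phi : Prop := IsCendo {
  cendoD : forall f g, phi (f + g) = phi f + phi g;
  cendoZ : forall a f, phi (a *: f) = a *: phi f;
  cendo1 : phi 1 = 1;
  cendoM : forall f g, phi (f * g) = phi f * phi g;
  cendo_cont : tadic_continuous phi }.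

Section Cendo.
Variables (phi : laurent A -> laurent A) (phiP : is_cendo phi).

Lemma cendo0 : phi 0 = 0.
Proof. by have := cendoZ phiP 0 0; rewrite !scale0r. Qed.

Lemma cendoN f : phi (- f) = - phi f.
Proof. by rewrite -scaleN1r (cendoZ phiP) scaleN1r. Qed.

Lemma cendoB f g : phi (f - g) = phi f - phi g.
Proof. by rewrite (cendoD phiP) cendoN. Qed.

Lemma cendo_const a : phi (lconst a) = lconst a.
Proof.
have cE : lconst a = a *: (1 : laurent A) by rewrite scale_monomM mulr1.
by rewrite cE (cendoZ phiP) (cendo1 phiP).
Qed.

Lemma cendo_invertible f : invertible f -> invertible (phi f).
Proof. by move=> [g fg]; exists (phi g); rewrite -(cendoM phiP) fg (cendo1 phiP). Qed.

Lemma cendoX f k : phi (f ^+ k) = phi f ^+ k.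
Proof.
elim: k => [|k IHk]; first by rewrite !expr0 (cendo1 phiP).
by rewrite !exprS (cendoM phiP) IHk.
Qed.

Lemma cendo_sum (I : Type) (r : seq I) (F : I -> laurent A) :
  phi (\sum_(i <- r) F i) = \sum_(i <- r) phi (F i).
Proof. exact: (big_morph phi (cendoD phiP) cendo0). Qed.

Lemma cendo_lim s L : tadic_lim s L -> tadic_lim (fun N => phi (s N)) (phi L).
Proof.
move=> sL n; have [N NP] := cendo_cont phiP n; have [K KP] := sL N.
by exists K => k Kk; rewrite -cendoB; apply/NP/KP.
Qed.

Lemma cendo_zpow (u v : Gm (laurent A)) k : phi (gm_val v) = gm_val u ->
  phi (gm_val (zpow v k)) = gm_val (zpow u k).
Proof.
move=> vu; have vX l : phi (gm_val (v ^+ l)%g) = gm_val (u ^+ l)%g.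
  by rewrite !gm_valX cendoX vu.
case: k => l; first exact: vX.
apply/esym/gm_valV_uniq; rewrite -vX -(cendoM phiP) -gm_valM mulgV.
exact: cendo1 phiP.
Qed.

Lemma cendo_partial (u : Gm (laurent A)) f N : phi (gm_val (tvar A)) = gm_val u ->
  phi (lcomp_partial f (tvar A) N) = lcomp_partial f u N.
Proof.
move=> tu; rewrite /lcomp_partial (cendoD phiP) !cendo_sum.
by congr (_ + _); apply: eq_bigr => k _; rewrite (cendoZ phiP) (cendo_zpow _ tu).
Qed.

Lemma cendo_lcomp_lim (u : Gm (laurent A)) f : phi (gm_val (tvar A)) = gm_val u ->
  tadic_lim (lcomp_partial f u) (phi f).
Proof.
move=> tu; apply: tadic_lim_ext (cendo_lim (partial_lim f)).
by exists 0%N => k _; exact: cendo_partial.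
Qed.

Lemma cendo_lcomp (u : Gm (laurent A)) f : phi (gm_val (tvar A)) = gm_val u ->
  lcomp f u = phi f.
Proof. by move=> tu; apply: tadic_limE; exact: cendo_lcomp_lim. Qed.

(** The defect [E] of the chain rule is a derivation along [phi]. It vanishes on constants and on t,
    hence on t^-1 and on all monomials, and density concludes. *)
Lemma cendo_chain f : lderiv (phi f) = phi (lderiv f) * lderiv (phi (monom 1 1)).
Proof.
pose E f := lderiv (phi f) - phi (lderiv f) * lderiv (phi (monom 1 1)).
have ED g h : E (g + h) = E g + E h.
  by rewrite /E (cendoD phiP) !lderivD (cendoD phiP); ring.
have EM g h : E (g * h) = E g * phi h + phi g * E h.
  by rewrite /E (cendoM phiP) !lderivM (cendoD phiP) !(cendoM phiP); ring.
have lderiv_const a : lderiv (lconst a) = 0.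
  by rewrite /lconst lderiv_monom mulr0z monom0.
have Ec a : E (lconst a) = 0.
  by rewrite /E cendo_const lderiv_const cendo0 mul0r subrr.
have E1 : E 1 = 0 by exact: Ec.
have Et : E (monom 1 1) = 0.
  by rewrite /E lderiv_monom subrr (cendo1 phiP) mul1r subrr.
have tz : monom 1 1 * monom 1 (- 1) = 1 :> laurent A.
  by rewrite monomM mulr1 subrr.
have Ez : E (monom 1 (- 1)) = 0.
  have := EM (monom 1 1) (monom 1 (- 1)); rewrite tz E1 Et mul0r add0r.
  move=> /(congr1 (fun x => phi (monom 1 (- 1)) * x)).
  by rewrite mulr0 mulrA -(cendoM phiP) mulrC mulrC [monom 1 (-1) * _]mulrC tz
    (cendo1 phiP) mul1r.
have EX g k : E g = 0 -> E (g ^+ k) = 0.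
  move=> Eg; elim: k => [|k IHk]; first by rewrite expr0.
  by rewrite exprS EM Eg IHk mul0r mulr0 addr0.
have Em a k : E (monom a k) = 0.
  rewrite -[a]mulr1 -[k]add0r -monomM EM Ec mul0r add0r.
  suff -> : E (monom 1 k) = 0 by rewrite mulr0.
  case: k => k.
    by have := EX _ k Et; rewrite monomX expr1n natz.
  have := EX _ k.+1 Ez; rewrite monomX expr1n mulNrn natz.
  by [].
apply/eqP; rewrite -subr_eq0; apply/eqP; apply: (@density _ E) => // s L sL.
apply: tadic_limB; first exact/lderiv_lim/cendo_lim.
by apply: tadic_limM; [exact/cendo_lim/lderiv_lim | exact: tadic_lim_cst].
Qed.

End Cendo.

Lemma cendo_comp phi psi : is_cendo phi -> is_cendo psi -> is_cendo (phi \o psi).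
Proof.
move=> [pD pZ p1 pM pc] [qD qZ q1 qM qc]; split.
- by move=> f g /=; rewrite qD pD.
- by move=> a f /=; rewrite qZ pZ.
- by rewrite /= q1 p1.
- by move=> f g /=; rewrite qM pM.
- by move=> n; have [N NP] := pc n; have [K KP] := qc N; exists K => f /KP/NP.
Qed.

(** The condition characterizing the image of t under a continuous automorphism; its necessity is
    [contAut_admissible]. *)
Definition admissible (u : laurent A) : Prop := nil_tpow 1 u /\ invertible (u 1).

Lemma admissible_split u : admissible u -> exists p n : laurent A,
  [/\ u = p + n, in_tpow 1 p, invertible p & nilpotent n].
Proof.
move=> [unil u1]; pose p := lcut 1 u; pose p' := monom 1 (- 1) * p.
have p'0 : in_tpow 0 p' by rewrite -[0](subrr 1); exact/in_tpow_shift/lcut_tpow.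
have p'u : invertible (p' 0) by rewrite lcoef_monomM mul1r sub0r opprK.
have [q [pq _ _]] := unit_pseries p'0 p'u.
exists p, (u - p); split; [by rewrite addrC subrK|exact: lcut_tpow| |].
  exists (monom 1 (- 1) * q); rewrite [p](monom_shift 1) -/p' mulrACA.
  by rewrite monomM mulr1 subrr pq mul1r.
have [k uk] := in_tpow_bound u.
apply: (@nil_laurent _ (Num.min k 1)).
- by apply: in_tpowB; [apply: in_tpowW uk | apply: in_tpowW (@lcut_tpow _ _ _)]; lia.
- move=> i; rewrite lcoef_cutN; case: ifP => [|_]; first exact: unil.
  exact: nilpotent0.
- by exists 1 => i i1; rewrite lcoef_cutN ifF //; lia.
Qed.

Lemma admissible_invertible u : admissible u -> invertible u.
Proof. by move=> /admissible_split[p [n [-> _ pu nn]]]; exact: invertible_nilpD. Qed.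

Lemma admissible_pow u : admissible u ->
  forall n, exists K, forall k, (K <= k)%N -> in_tpow n (u ^+ k).
Proof.
move=> /admissible_split[p [q [-> p1 _ [N qN]]]] n.
have [M qM] := laurent_boundN q.
(* At most N - 1 factors are taken from the nilpotent part, each with a pole of order at most [M]; N
   * M outweighs these poles. *)
exists (absz n + N + N * M)%N => k nk; rewrite exprDn; apply: in_tpow_sum => i _.
have [Ni|iN] := leqP N i; first by rewrite (expr_nilpotent qN Ni) mulr0 mul0rn.
have pk : in_tpow ((k - i)%N%:Z) (p ^+ (k - i)) by rewrite -natz; exact: in_tpowX.
have qi : in_tpow (- (i * M)%N%:Z) (q ^+ i).
  have -> : - (i * M)%N%:Z = (- M%:Z) *+ i by rewrite mulNrn -mulr_natr natz PoszM mulrC.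
  exact: in_tpowX.
rewrite -scaler_nat; apply: in_tpowZ; apply: in_tpowW (in_tpowM pk qi).
have : (i * M <= N * M)%N by rewrite leq_mul2r ltnW ?orbT.
have := ltn_ord i; lia.
Qed.

End Endomorphisms.

(** * Substitution of an admissible series *)

Section Composition.
Variable A : comPzRingType.
Implicit Types (f g : laurent A) (u : Gm (laurent A)).

Lemma lcomp_partial_monom a k u (N : nat) : (absz k < N)%N ->
  lcomp_partial (monom a k) u N = a *: gm_val (zpow u k).
Proof.
case: k => k kN; rewrite /lcomp_partial.
  rewrite (bigD1_seq k) ?iota_uniq //; last by rewrite mem_index_iota.
  rewrite lcoef_monom eqxx mulr1n [X in _ + X + _]big1 => [|i ik]; last first.
    by rewrite lcoef_monom (_ : (_ == _) = false) ?mulr0n ?scale0r //; lia.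
  rewrite [X in _ + X]big_nat [X in _ + X]big1 ?addr0 // => i /andP[i1 _].
  by rewrite lcoef_monom (_ : (_ == _) = false) ?mulr0n ?scale0r //; lia.
rewrite [X in X + _]big1 ?add0r => [|i _]; last first.
  by rewrite lcoef_monom (_ : (_ == _) = false) ?mulr0n ?scale0r //; lia.
rewrite (bigD1_seq k.+1) ?iota_uniq //; last by rewrite mem_index_iota.
rewrite lcoef_monom (_ : (_ == _) = true) ?mulr1n; last lia.
rewrite big1 => [|i ik]; last first.
  by rewrite lcoef_monom (_ : (_ == _) = false) ?mulr0n ?scale0r //; lia.
by rewrite /= addr0.
Qed.

Lemma lcomp_partialD f g u N :
  lcomp_partial (f + g) u N = lcomp_partial f u N + lcomp_partial g u N.
Proof.
rewrite /lcomp_partial addrACA -!big_split /=.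
by congr (_ + _); apply: eq_bigr => i _; rewrite scalerDl.
Qed.

Lemma lcomp_partialZ a f u N : lcomp_partial (a *: f) u N = a *: lcomp_partial f u N.
Proof.
rewrite /lcomp_partial scalerDr !scaler_sumr.
by congr (_ + _); apply: eq_bigr => i _; rewrite scalerA.
Qed.

Section Admissible.
Variables (u : Gm (laurent A)) (uP : admissible (gm_val u)).

Lemma lcomp_lim f : tadic_lim (lcomp_partial f u) (lcomp f u).
Proof.
suff [L fL] : exists L, tadic_lim (lcomp_partial f u) L.
  by rewrite /lcomp (tadic_limE fL).
apply: laurent_complete => n; have [K KP] := admissible_pow uP n.
have [M fM] := laurent_boundN f; exists (K + M).+1 => k kK.
rewrite lcomp_partialS; last lia; rewrite addrAC subrr add0r.
rewrite (fM (- k%:Z)); last lia; rewrite scale0r addr0; apply: in_tpowZ.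
by rewrite gm_valX; apply: KP; lia.
Qed.

Lemma lcomp_tadic_continuous : tadic_continuous (fun f => lcomp f u).
Proof.
move=> n; have [K KP] := admissible_pow uP n; exists K.+1%:Z => f fK.
apply: (tadic_lim_in_tpow (lcomp_lim f)); exists 0%N => N _.
apply: in_tpowD; apply: in_tpow_sum => k _.
  have [kK|Kk] := ltnP k K; first by rewrite fK ?scale0r //; lia.
  by apply: in_tpowZ; rewrite gm_valX; exact: KP.
by rewrite fK ?scale0r //; lia.
Qed.

Lemma lcompD f g : lcomp (f + g) u = lcomp f u + lcomp g u.
Proof.
apply: (tadic_lim_uniq (lcomp_lim (f + g))).
apply: tadic_lim_ext (tadic_limD (lcomp_lim f) (lcomp_lim g)).
by exists 0%N => k _; rewrite lcomp_partialD.
Qed.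

Lemma lcompZ a f : lcomp (a *: f) u = a *: lcomp f u.
Proof.
apply: (tadic_lim_uniq (lcomp_lim (a *: f))).
apply: tadic_lim_ext (tadic_limZ a (lcomp_lim f)).
by exists 0%N => k _; rewrite lcomp_partialZ.
Qed.

Lemma lcomp_monom a k : lcomp (monom a k) u = a *: gm_val (zpow u k).
Proof.
apply: (tadic_lim_uniq (lcomp_lim _)).
apply: (@tadic_lim_ext _ (fun=> a *: gm_val (zpow u k))); last exact: tadic_lim_cst.
by exists (absz k).+1 => N kN; rewrite lcomp_partial_monom.
Qed.

Lemma lcompN f : lcomp (- f) u = - lcomp f u.
Proof. by rewrite -scaleN1r lcompZ scaleN1r. Qed.

Lemma lcomp_cvg s L : tadic_lim s L ->
  tadic_lim (fun N => lcomp (s N) u) (lcomp L u).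
Proof.
move=> sL n; have [N NP] := lcomp_tadic_continuous n; have [K KP] := sL N.
by exists K => k Kk; rewrite -lcompN -lcompD; apply/NP/KP.
Qed.

Lemma lcompM f g : lcomp (f * g) u = lcomp f u * lcomp g u.
Proof.
apply/eqP; rewrite -subr_eq0; apply/eqP.
apply: (@density2 _ (fun f g => lcomp (f * g) u - lcomp f u * lcomp g u)).
- by move=> h f1 f2; rewrite mulrDl !lcompD; ring.
- by move=> h f1 f2; rewrite mulrDr !lcompD; ring.
- move=> a j b k; rewrite monomM !lcomp_monom zpowD gm_valM !scale_monomM.
  by rewrite -!/(lconst _) rmorphM; set x := gm_val _; set y := gm_val _; ring.
- move=> s s' L L' sL sL'; apply: tadic_limB; first exact/lcomp_cvg/tadic_limM.
  by apply: tadic_limM; exact: lcomp_cvg.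
Qed.

Lemma lcomp1 : lcomp 1 u = 1.
Proof. by rewrite -(monom1 A) lcomp_monom zpow0 gm_val1 scale1r. Qed.

Lemma lcomp_cendo : is_cendo (fun f => lcomp f u).
Proof.
split; [exact: lcompD | exact: lcompZ | exact: lcomp1 | exact: lcompM |].
exact: lcomp_tadic_continuous.
Qed.

Lemma lcomp_t : lcomp (monom 1 1) u = gm_val u.
Proof. by rewrite lcomp_monom scale1r. Qed.

End Admissible.
End Composition.

Section CompositionMap.
Variables (A B : comPzRingType) (i : {rmorphism A -> B}).

Lemma admissible_map (u : laurent A) : admissible u -> admissible (lmap i u).
Proof.
move=> [un u1]; split; last by rewrite lcoef_map; exact: invertible_map.
by move=> k k1; rewrite lcoef_map; apply/nilpotent_map/un.
Qed.

Lemma lcomp_map (f : laurent A) (u : Gm (laurent A)) (v : Gm (laurent B)) :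
  admissible (gm_val u) -> gm_val v = lmap i (gm_val u) ->
  lmap i (lcomp f u) = lcomp (lmap i f) v.
Proof.
move=> uP vu; have vP : admissible (gm_val v) by rewrite vu; exact: admissible_map.
apply/esym/(tadic_lim_uniq (lcomp_lim vP _)).
apply: tadic_lim_ext (lmap_lim i (lcomp_lim uP f)); exists 0%N => N _.
have vE : v = Gm_map (lmap i : {rmorphism _ -> _}) u by exact: gm_inj.
have zE k : lmap i (gm_val (zpow u k)) = gm_val (zpow v k).
  by rewrite vE -Gm_map_zpow.
rewrite /lcomp_partial rmorphD !rmorph_sum.
by congr (_ + _); apply: eq_bigr => k _; rewrite [LHS]lmapZ zE.
Qed.

End CompositionMap.

(** * The image of t under a continuous automorphism *)

Section ContAutTheory.
Variable A : comPzRingType.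
Implicit Types (phi psi : contAut A).

Lemma contAut_cendo phi : is_cendo phi.
Proof.
have [lin [p1 pM] [psi [_ _ pc _]]] := contAut_prop phi.
have pD f g : phi (f + g) = phi f + phi g.
  by have := lin 1 f g; rewrite !scale1r.
have p0 : phi 0 = 0.
  by have /eqP := pD 0 0; rewrite addr0 -subr_eq0 opprD addrA subrr sub0r oppr_eq0 => /eqP.
split=> //.
- by move=> a f; have := lin a f 0; rewrite !addr0 p0 addr0.
- move=> n; have : nbhs (phi 0) [set g | in_tpow n (g - phi 0)] by exists n.
  move=> /(pc 0)[N _ NP]; exists N => f fN.
  by have := NP f; rewrite /= subr0 p0 subr0; apply.
Qed.

(** The lowest term of u^N has degree m N <= 0 and coefficient u_m^N, which must vanish. *)
Lemma nilpotent_lead u (m : int) (N : nat) : m <= 0 -> in_tpow m u ->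
  in_tpow 1 (u ^+ N) -> nilpotent (u m : A).
Proof.
move=> m0 um u1; exists N.
have [H1 H2] : in_tpow (m *+ N) (u ^+ N) /\ (u ^+ N) (m *+ N) = u m ^+ N.
  elim: N {u1} => [|N [IH1 IH2]].
    by rewrite mulr0n !expr0 lcoef1; split=> //; exact: in_tpow1.
  by rewrite mulrS !exprS; split; [exact: in_tpowM | rewrite lcoef_lead // IH2].
rewrite -H2 u1 //; have -> : m *+ N = m * N%:Z by rewrite -mulr_natr natz.
nia.
Qed.

(** Degree by degree from below: once the coefficients below m are nilpotent, removing them changes
    [u] by a nilpotent series [w]. High powers of the rest still lie in t A[[t]], and its lowest
    coefficient is u_m. *)
Lemma topologically_nilpotent (u : laurent A) :
    (forall n, exists K, forall k, (K <= k)%N -> in_tpow n (u ^+ k)) ->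
  nil_tpow 1 u.
Proof.
move=> uk; have [M uM] := laurent_boundN u.
suff H d : (d <= M.+1)%N -> forall i, i < d%:Z - M%:Z -> nilpotent (u i).
  by move=> i i1; apply: (H M.+1) => //; lia.
elim: d => [_|d IHd dM] i id; first by rewrite uM; [exact: nilpotent0 | lia].
have [lt|ge] := ltP i (d%:Z - M%:Z); first by apply: IHd; lia.
have {id ge} -> : i = d%:Z - M%:Z by lia.
set m := d%:Z - M%:Z; pose v := lcut m u; pose w := u - v.
have wn : nilpotent w.
  apply: (@nil_laurent _ (- M%:Z)).
  - by move=> j jM; rewrite lcoef_cutN uM ?if_same.
  - by move=> j; rewrite lcoef_cutN; case: ifP => [jm|_];
      [apply: IHd => //; lia | exact: nilpotent0].
  - by exists m => j mj; rewrite lcoef_cutN ifF //; lia.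
have [N wN] := wn.
have -> : u m = v m by rewrite lcoef_cut ltxx.
(* The margin compensates the poles of w^j for j < N, of order at most N M. *)
have [K KP] := uk (1 + (N * M)%N%:Z + N%:Z).
apply: (@nilpotent_lead _ _ (K + N)); [lia | exact: lcut_tpow |].
have -> : v = u - w by rewrite /w opprB addrCA subrr addr0.
rewrite exprDn; apply: in_tpow_sum => j _; rewrite -scaler_nat; apply: in_tpowZ.
have wN' : (- w) ^+ N = 0 by rewrite exprNn wN mulr0.
have [Nj|jN] := leqP N j; first by rewrite (expr_nilpotent wN' Nj) mulr0.
have wj : in_tpow (- (j * M)%N%:Z) ((- w) ^+ j).
  have -> : - (j * M)%N%:Z = (- M%:Z) *+ j by rewrite mulNrn -mulr_natr natz PoszM mulrC.
  apply/in_tpowX/in_tpowN => k kM; rewrite lcoef_cutN uM ?if_same //.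
have uj : in_tpow (1 + (N * M)%N%:Z + N%:Z) (u ^+ (K + N - j)) by apply: KP; lia.
apply: in_tpowW (in_tpowM uj wj).
have : (j * M <= N * M)%N by rewrite leq_mul2r ltnW ?orbT.
lia.
Qed.

Lemma cendo_topologically_nilpotent (phi : laurent A -> laurent A) : is_cendo phi ->
  nil_tpow 1 (phi (monom 1 1)).
Proof.
move=> phiP; apply: topologically_nilpotent => n.
have [N NP] := cendo_cont phiP n; exists (absz N) => k Nk.
rewrite -(cendoX phiP); apply: NP; rewrite monomX expr1n natz.
by apply: in_tpow_monom; lia.
Qed.

Lemma laurent_finite (f : laurent A) (M K : nat) :
    (forall i, i < - M%:Z -> f i = 0) -> (forall i, K%:Z - M%:Z <= i -> f i = 0) ->
  f = \sum_(k < K) monom (f (k%:Z - M%:Z)) (k%:Z - M%:Z).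
Proof.
move=> fM fK; apply/laurentP => i; rewrite lcoef_sum.
under eq_bigr do rewrite lcoef_monom.
have [iM|iM] := ltP i (- M%:Z).
  rewrite fM // big1 // => k _.
  by rewrite (_ : (_ == _) = false) ?mulr0n //; lia.
have [iK|iK] := lerP (K%:Z - M%:Z) i.
  rewrite fK // big1 // => k _.
  by rewrite (_ : (_ == _) = false) ?mulr0n //; have := ltn_ord k; lia.
pose j := absz (i + M%:Z); have jK : (j < K)%N by lia.
rewrite (bigD1 (Ordinal jK)) //= big1 ?addr0 => [|k kj].
  by rewrite (_ : (_ == _) = true) ?mulr1n; [congr (f _)|]; lia.
rewrite (_ : (_ == _) = false) ?mulr0n //; apply/negbTE.
by apply: contraNneq kj => e; rewrite -val_eqE /=; apply/eqP; lia.
Qed.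

(** A polynomial in t goes to a polynomial in phi(t), whose polar coefficients are nilpotent; the
    tail goes into A[[t]] by continuity. *)
Lemma cendo_nil_tpow (phi : laurent A -> laurent A) f : is_cendo phi ->
  in_tpow 0 f -> nil_tpow 0 (phi f).
Proof.
move=> phiP f0; have [N NP] := cendo_cont phiP 0; pose K := absz N.
have u1 := cendo_topologically_nilpotent phiP.
have -> : f = \sum_(k < K) monom (f (k%:Z - 0%:Z)) (k%:Z - 0%:Z) + lcut K%:Z f.
  have e (k : 'I_K) : (f - lcut K%:Z f) (k%:Z - 0%:Z) = f (k%:Z - 0%:Z).
    by rewrite lcoef_cutN ifT //; have := ltn_ord k; lia.
  rewrite -[LHS](subrK (lcut K%:Z f)) {1}(@laurent_finite (f - lcut K%:Z f) 0 K).
  - by under eq_bigr do rewrite e.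
  - by move=> i i0; rewrite lcoef_cutN f0 ?if_same //; lia.
  - by move=> i iK; rewrite lcoef_cutN ifF //; lia.
rewrite (cendoD phiP) (cendo_sum phiP); apply: nil_tpowD.
  apply: nil_tpow_sum => k _; rewrite monomE (cendoZ phiP).
  have -> : monom 1 (k%:Z - 0%:Z) = monom 1 1 ^+ k :> laurent A.
    by rewrite monomX expr1n natz subr0.
  rewrite (cendoX phiP) => i i0; rewrite lcoefZ; apply: nilpotentMl.
  suff H l : nil_tpow 0 (phi (monom 1 1) ^+ l) by exact: H.
  elim: l => [|l IHl].
    by move=> j j0; rewrite expr0 lcoef1 lt_eqF //; exact: nilpotent0.
  by rewrite exprS; apply: (@nil_tpowM _ 0 0) => //; exact: nil_tpowW u1.
apply: in_nil_tpow; apply: NP; apply: in_tpowW (@lcut_tpow _ _ _); lia.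
Qed.

(** For the coefficient of u = phi(t) at t, let v = psi(t), so phi(v) = t. The part of v below
    degree 1 has nilpotent coefficients, and the part from degree 2 on maps to a multiple of u^2,
    whose coefficient at t is nilpotent. Comparing coefficients of t, v_1 u_1 is 1 up to a
    nilpotent. *)
Lemma cendo_iso_admissible (phi psi : laurent A -> laurent A) :
  is_cendo phi -> is_cendo psi -> cancel psi phi -> admissible (phi (monom 1 1)).
Proof.
move=> phiP psiP psiK; split; first exact: cendo_topologically_nilpotent.
set u := phi _; have un : nil_tpow 1 u by exact: cendo_topologically_nilpotent.
pose v := psi (monom 1 1); have vn : nil_tpow 1 v.
  exact: cendo_topologically_nilpotent.
have vE : monom 1 1 = phi v by rewrite psiK.
pose v2 := lcut 2 v; pose v1 := monom (v 1) 1; pose v0 := v - lcut 1 v.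
have v_split : v = v0 + (v1 + v2).
  apply/laurentP => i; have e0 : v0 i = if i < 1 then v i else 0 by exact: lcoef_cutN.
  rewrite lcoefD e0 lcoefD lcoef_monom lcoef_cut.
  case: (ltgtP i 1) => i1.
  - by rewrite ifT ?addr0 //; lia.
  - by rewrite ifF ?add0r //; lia.
  - by rewrite i1 addr0 add0r mulr1n.
have v0n i : nilpotent (phi v0 i).
  have [M vM] := laurent_boundN v.
  rewrite (@laurent_finite v0 M M.+1).
  - rewrite (cendo_sum phiP) lcoef_sum; apply: nilpotent_sum => k _.
    rewrite monomE (cendoZ phiP) lcoefZ; apply: nilpotentMr.
    by rewrite /v0 lcoef_cutN; case: ifP => [|_]; [exact: vn | exact: nilpotent0].
  - by move=> j jM; rewrite /v0 lcoef_cutN vM ?if_same.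
  - by move=> j jM; rewrite /v0 lcoef_cutN ifF //; lia.
have v2n : nilpotent (phi v2 1).
  rewrite [v2](monom_shift 2) (cendoM phiP).
  have -> : monom 1 2 = monom 1 1 ^+ 2 :> laurent A by rewrite monomX expr1n natz.
  rewrite (cendoX phiP); apply: (@nil_tpowM _ 2 0) => //.
    by rewrite expr2; apply: (@nil_tpowM _ 1 1).
  apply: cendo_nil_tpow => //; rewrite -[0](subrr 2).
  exact/in_tpow_shift/lcut_tpow.
have := congr1 (fun f : laurent A => f 1) vE.
rewrite v_split (cendoD phiP v0) (cendoD phiP v1) 2!lcoefD lcoef_monom eqxx mulr1n.
rewrite /v1 monomE (cendoZ phiP) lcoefZ -/u => e.
apply: (@invertible_mull _ _ (v 1)); rewrite mulrC.
have -> : v 1 * u 1 = 1 - (phi v0 1 + phi v2 1) by rewrite e; ring.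
by apply/invertible_1Bnil/nilpotentD.
Qed.

Lemma contAut_admissible phi : admissible (gm_val (tilde phi)).
Proof.
have := mulVg phi; have := contAut_cendo phi; have := contAut_cendo (phi^-1)%g.
move=> psiP phiP _; apply: (cendo_iso_admissible phiP psiP) => f.
have /(congr1 (fun k : contAut A => k f)) := mulgV phi; exact.
Qed.

Lemma contAut_lcomp phi f : phi f = lcomp f (tilde phi).
Proof. by rewrite (cendo_lcomp (contAut_cendo phi)). Qed.

Lemma contAut_lcomp_lim phi f : tadic_lim (lcomp_partial f (tilde phi)) (phi f).
Proof. exact: (cendo_lcomp_lim (contAut_cendo phi)). Qed.

Lemma tauM phi psi : tau (phi * psi)%g = tau phi * phi (tau psi).
Proof.
rewrite mulrC; have := cendo_chain (contAut_cendo phi) (psi (monom 1 1)).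
exact.
Qed.

Lemma tau_invertible phi : invertible (tau phi).
Proof.
have : tau (phi * phi^-1)%g = 1.
  by rewrite mulgV /tau /= lderiv_monom subrr.
by rewrite tauM => e; exists (phi (tau (phi^-1)%g)).
Qed.

End ContAutTheory.

(** * Invariance of the symbol under substitution *)

Section ConstantOrder.
Variable A : comPzRingType.
Implicit Types (f g h m u : laurent A) (c : Gm A).

Lemma weak_factorization_cst f (n : int) c m h : is_neg m -> is_pos h ->
  f = m * (gm_val c *: monom 1 n) * h -> weak_factorization f (fun=> n) c m h.
Proof.
by move=> mn hp fE; split=> //; [exact: locally_constant_cst | rewrite tpow_cst].
Qed.

Lemma weak_factorization_cst_inv f (n : int) c m h :
  weak_factorization f (fun=> n) c m h -> f = m * (gm_val c *: monom 1 n) * h.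
Proof. by move=> [_ _ _]; rewrite tpow_cst. Qed.

Lemma weak_factorization_invertible f nu c m h :
  weak_factorization f nu c m h -> invertible f.
Proof.
move=> [_ mn hp ->]; apply: invertibleM; last exact: is_pos_invertible.
apply: invertibleM; first exact: is_neg_invertible.
rewrite scale_monomM; apply: invertibleM; last exact: gm_invertible.
by apply: invertible_monom; exact: gm_invertible.
Qed.

Lemma CC_cst f g (n n' : int) c c' m m' h h' :
    weak_factorization f (fun=> n) c m h -> weak_factorization g (fun=> n') c' m' h' ->
  CC f g = (zpow (gm_opp1 A) (n * n') *
    ((zpow c n' * gpairing h m') / (zpow c' n * gpairing h' m)))%g.
Proof. by move=> wf wg; rewrite (CCE wf wg) /symbol !lcpow_cst. Qed.

Lemma pos_weak h : is_pos h -> weak_factorization h (fun=> 0) 1%g 1 h.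
Proof.
move=> hp; apply: weak_factorization_cst => //; first exact: is_neg1.
by rewrite scale1r !mul1r.
Qed.

Lemma const_weak c : weak_factorization (lconst (gm_val c)) (fun=> 0) c 1 1.
Proof.
apply: weak_factorization_cst; [exact: is_neg1 | exact: is_pos1 |].
by rewrite scale_monom mul1r !mulr1.
Qed.

Lemma pseries_weak f : in_tpow 0 f -> invertible (f 0) ->
  exists c h, weak_factorization f (fun=> 0) c 1 h /\ f = gm_val c *: h.
Proof.
move=> f0 fu; have [d fd] := fu.
have fE : f = f 0 *: (d *: f) by rewrite scalerA fd scale1r.
exists (toGm fu), (d *: f); split=> //; apply: weak_factorization_cst.
- exact: is_neg1.
- by split; [exact: in_tpowZ | rewrite lcoefZ mulrC].
- by rewrite mul1r -lscalerAl mul1r.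
Qed.

Lemma root_weak c b h : nilpotent b -> is_pos h ->
  weak_factorization ((monom 1 1 - lconst b) * (gm_val c *: h)) (fun=> 1) c
    (1 - monom b (- 1)) h.
Proof.
move=> nb hp; apply: weak_factorization_cst => //.
  exact: (is_neg_monom (ltn0Sn 0)).
rewrite !scale_monomM mulrA; congr (_ * h).
have -> : monom 1 1 - lconst b = monom 1 1 * (1 - monom b (- 1)) :> laurent A.
  by rewrite mulrBr mulr1 monomM mul1r subrr.
by ring.
Qed.

(** [r] has order 0, constant 1 and trivial minus part, so only its pairing with the minus part of
    [g] is left, and [pairing_tail] gives [N] in terms of that part. *)
Lemma tail_CC g : invertible g -> exists N : nat, forall r, is_pos r ->
  in_tpow N%:Z (r - 1) -> CC r g = 1%g.
Proof.
move=> /weak_factorization_exists[nu [c [m [h wg]]]]; have [nulc mn hp _] := wg.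
have [N NP] := pairing_tail mn; exists N => r rp rN.
rewrite (CCE (pos_weak rp) wg) /symbol.
rewrite (_ : (fun p => _) = fun=> 0); last by apply/funext => p; rewrite mul0r.
rewrite !lcpow0 lcpow1l // gpairing1r // !mul1g invg1 mulg1.
by apply: gm_inj; rewrite gpairingE // NP.
Qed.

Lemma unit_root b : nilpotent b -> invertible (monom 1 1 - lconst b : laurent A).
Proof.
move=> nb; have := root_weak 1%g nb (is_pos1 A).
by rewrite scale1r mulr1 => /weak_factorization_invertible.
Qed.

(* The values of the symbol on the elements 1 - a u and u - b, those it has for
   u = t. *)
Record generic_symbols u : Prop := GenericSymbols {
  generic_lin : forall a, exists c m h, weak_factorization (1 - a *: u) (fun=> 0) c m h;
  generic_root : forall b, nilpotent b ->
    exists c m h, weak_factorization (u - lconst b) (fun=> 1) c m h;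
  generic_lin_lin : forall a a', CC (1 - a *: u) (1 - a' *: u) = 1%g;
  generic_lin_root : forall a b, nilpotent b ->
    gm_val (CC (1 - a *: u) (u - lconst b)) = 1 - a * b;
  generic_root_root : forall b b', nilpotent b -> nilpotent b' ->
    CC (u - lconst b) (u - lconst b') = gm_opp1 A }.

Lemma gm_div_eq (x y : Gm A) (z : A) : gm_val x = z * gm_val y -> gm_val (x / y)%g = z.
Proof. by move=> e; rewrite gm_valM e -mulrA gm_valV mulr1. Qed.

(* Birkhoff factorization replaces Weierstrass preparation: the minus part of
   u - b has degree one. *)
Lemma pseries_root u : admissible u -> in_tpow 0 u ->
  exists b (c : Gm A) h, [/\ nilpotent b, is_pos h
    & u = (monom 1 1 - lconst b) * (gm_val c *: h)].
Proof.
move=> [un u1] u0; pose f := monom 1 (- 1) * u.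
have fE i : f i = u (i + 1) by rewrite lcoef_monomM mul1r opprK.
have [||m [c [h [mn cu hp e]]]] := @birkhoff _ f.
- by move=> i i0; rewrite fE; apply: un; lia.
- by rewrite fE.
have uE : u = monom 1 1 * m * (c *: h).
  by rewrite -mulrA -e mulrA monomM mulr1 subrr mul1r.
have [h0 h1] := hp; have [||g [hg g0 _]] := @unit_pseries _ (c *: h).
- exact: in_tpowZ.
- by rewrite lcoefZ h1 mulr1.
have tm : in_tpow 0 (monom 1 1 * m).
  have -> : monom 1 1 * m = u * g by rewrite uE -[RHS]mulrA hg mulr1.
  exact: in_tpowMl.
have [mz m1 mnil] := mn.
have mE : m = 1 - monom (- m (- 1)) (- 1).
  apply/laurentP => i; rewrite lcoefB lcoef1 lcoef_monom.
  case: (ltgtP i 0) => [i0|i0|->].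
  - rewrite sub0r mulNrn opprK; case: eqVneq => [->//|i1].
    have := tm (i + 1); rewrite lcoef_monomMK mul1r => -> //; lia.
  - by rewrite mz // (_ : (_ == _) = false) ?subr0 //; lia.
  - by rewrite m1 subr0.
exists (- m (- 1)), (toGm cu), h; split=> //; first by apply/nilpotentN/mnil.
rewrite {1}uE {1}mE; congr (_ * _).
by rewrite mulrBr mulr1 monomM mul1r subrr.
Qed.

(** 1 - a u is a power series, and u - b has a single root b', with u(b') = b; so the mixed symbol
    is the value of 1 - a u at b', that is 1 - a b. For two roots, the two pairings with their
    constants are divided differences of [u] at the same two points; they cancel and leave the
    sign. *)
Lemma pseries_generic u : admissible u -> in_tpow 0 u -> generic_symbols u.
Proof.
move=> uP u0; have [un u1] := uP.
have lin a : exists c h, weak_factorization (1 - a *: u) (fun=> 0) c 1 h /\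
    1 - a *: u = gm_val c *: h.
  apply: pseries_weak; first by apply: in_tpowB; [exact: in_tpow1 | exact: in_tpowZ].
  by rewrite lcoefB lcoef1 lcoefZ; apply/invertible_1Bnil/nilpotentMl/un.
have root b : nilpotent b -> exists b' (c : Gm A) h, [/\ nilpotent b', is_pos h,
    ev b' u = b, u - lconst b = (monom 1 1 - lconst b') * (gm_val c *: h)
    & gm_val c *: h = divdiff b' u].
  move=> nb; have bu : admissible (u - lconst b).
    split=> [i i1|]; last by rewrite lcoefB lcoef_const subr0.
    rewrite lcoefB lcoef_const; apply/nilpotentD/nilpotentN; first exact: un.
    by case: eqP => _; [exact: nb | exact: nilpotent0].
  have bu0 : in_tpow 0 (u - lconst b).
    by apply: in_tpowB => //; exact: in_tpow_monom.
  have [b' [c [h [nb' hp e]]]] := pseries_root bu bu0.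
  have ub : ev b' u = b.
    apply: (@ev_uniq _ _ _ _ (gm_val c *: h)) => //.
    by case: hp => h0 _; exact: in_tpowZ.
  exists b', c, h; split=> //.
  apply: (invertible_mulI (unit_root nb')).
  by rewrite -e -evP // ub.
split.
- by move=> a; have [c [h [w _]]] := lin a; exists c, 1, h.
- move=> b nb; have [b' [c [h [nb' hp _ -> _]]]] := root b nb.
  by exists c, (1 - monom b' (- 1)), h; exact: root_weak.
- move=> a a'; have [c [h [w _]]] := lin a; have [c' [h' [w' _]]] := lin a'.
  have [_ _ hp _] := w; have [_ _ hp' _] := w'.
  by rewrite (CC_cst w w') mul0r !zpow0 !gpairing1r // !mulg1 invg1 !mulg1.
- move=> a b nb; have [c [h [w e]]] := lin a.
  have [b' [c' [h' [nb' hp' ub e' _]]]] := root b nb.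
  have [_ _ hp _] := w.
  rewrite e' (CC_cst w (root_weak c' nb' hp')) mul0r !zpow0 zpow1 gpairing1r //.
  rewrite mul1g mulg1 invg1 mulg1 gm_valM gpairingE //; last first.
    exact: (is_neg_monom (ltn0Sn 0)).
  rewrite pairing_root //; have [h0 _] := hp.
  have -> : gm_val c * ev b' h = ev b' (gm_val c *: h).
    by rewrite scale_monomM evM ?ev_const //; exact: in_tpow_monom.
  rewrite -e scale_monomM evD ?evN ?evM ?ev1 ?ev_const ?ub //.
  + exact: in_tpow_monom.
  + by rewrite -scale_monomM; exact: in_tpowZ.
  + exact: in_tpow1.
  + by rewrite -scale_monomM; apply/in_tpowN/in_tpowZ.
- move=> b b' nb nb'; have [r [c [h [nr hp ub e ed]]]] := root b nb.
  have [r' [c' [h' [nr' hp' ub' e' ed']]]] := root b' nb'.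
  rewrite e e' (CC_cst (root_weak c nr hp) (root_weak c' nr' hp')) mulr1 !zpow1.
  rewrite -[RHS]mulg1; congr (_ * _)%g; apply: gm_inj; apply: gm_div_eq.
  rewrite mul1r !gm_valM !gpairingE ?pairing_root //; try exact: (is_neg_monom (ltn0Sn 0)).
  have cE (d : Gm A) x k : nilpotent x -> is_pos k ->
      gm_val d * ev x k = ev x (gm_val d *: k).
    move=> nx [k0 _]; rewrite scale_monomM evM ?ev_const //; exact: in_tpow_monom.
  by rewrite !cE // ed ed' divdiff_sym.
Qed.

(** With z = t^-1 and u = t U, 1 - a u equals t (z - a U). Its plus part is 1 - a' t with a' = a
    U(a'), so a' is a root of z - a U, and constant times minus part is the quotient by z - a'. The
    plus part of u - b is trivial. All pairings then become values at z = a'. *)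
Lemma zpoly_generic U : is_neg U -> generic_symbols (monom 1 1 * U).
Proof.
move=> Un; have [Uz U1 Unil] := Un; set u := monom 1 1 * U.
have uE i : u i = U (i - 1) by rewrite lcoef_monomM mul1r.
have lin a : exists a' (c : Gm A) m, [/\ is_neg m,
    weak_factorization (1 - a *: u) (fun=> 0) c m (1 - monom a' 1),
    gm_val c * zev a' U = 1, a' = a * zev a' U
    & gm_val c *: m = 1 - a *: zdivdiff a' U].
  have [||m [c [h [mn cu hp e]]]] := @birkhoff _ (1 - a *: u).
  - move=> i i0; rewrite lcoefB lcoef1 lt_eqF // sub0r lcoefZ uE.
    by apply/nilpotentN/nilpotentMl/Unil; lia.
  - rewrite lcoefB lcoef1 lcoefZ uE; apply/invertible_1Bnil/nilpotentMl/Unil.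
    by [].
  have [d cd] := cu; have [m' [m'z _ _] mm'] := is_negV mn.
  have zE : monom 1 (- 1) * (1 - a *: u) = monom 1 (- 1) - a *: U.
    rewrite /u !scale_monomM.
    have -> : monom 1 (- 1) * (1 - monom a 0 * (monom 1 1 * U)) =
      monom 1 (- 1) - monom a 0 * (monom 1 (- 1) * monom 1 1 * U) by ring.
    by rewrite monomM mul1r addNr monom1 mul1r.
  have Uaz : in_zpoly (monom 1 (- 1) - a *: U).
    by apply: in_zpolyB; [exact: in_zpoly_monom | exact: in_zpolyZ].
  (* z h is z - a U divided by c m, hence a polynomial in z; therefore [h] has degree at most one in
     t. *)
  have zh : in_zpoly (monom 1 (- 1) * h).
    have -> : monom 1 (- 1) * h = d *: (monom 1 (- 1) - a *: U) * m'.
      rewrite -zE e !scale_monomM.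
      have -> : monom d 0 * (monom 1 (-1) * (m * (monom c 0 * h))) * m' =
        (monom c 0 * monom d 0) * (m * m') * (monom 1 (-1) * h) by ring.
      by rewrite mm' monomM cd monom1 !mul1r.
    by apply: in_zpolyM => //; exact: in_zpolyZ.
  have [h0 h1] := hp; pose a' := - h 1.
  have hE : h = 1 - monom a' 1.
    apply/laurentP => i; rewrite lcoefB lcoef1 lcoef_monom.
    case: (ltgtP i 0) => [i0|i0|->].
    + by rewrite h0 // (_ : (_ == _) = false) ?subr0 //; lia.
    + rewrite sub0r mulNrn opprK; case: eqVneq => [->//|i1].
      by have := zh (i - 1); rewrite lcoef_monomMK mul1r => -> //; lia.
    + by rewrite h1 subr0.
  pose V := c *: m; have [mz m1 _] := mn.
  have Vz : in_zpoly V by exact: in_zpolyZ.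
  have zV : monom 1 (- 1) - a *: U = (monom 1 (- 1) - lconst a') * V.
    rewrite -zE e hE /V !scale_monomM.
    have -> : monom 1 (- 1) - lconst a' = monom 1 (-1) * (1 - monom a' 1) :> laurent A.
      by rewrite mulrBr mulr1 monomM mul1r addNr.
    by ring.
  have za x f : in_zpoly f -> zev x (a *: f) = a * zev x f.
    move=> fz; rewrite scale_monomM zevM ?zev_const //; exact: in_zpoly_monom.
  have zz : in_zpoly (monom 1 (- 1) : laurent A) by exact: in_zpoly_monom.
  have za' : in_zpoly (lconst a') by exact: in_zpoly_monom.
  have a'E : a' = a * zev a' U.
    have := congr1 (zev a') zV; rewrite zevM //; last exact: in_zpolyB.
    rewrite [zev a' (_ - lconst a')]zevD ?zevN ?zev_z ?zev_const //; last exact: in_zpolyN.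
    rewrite subrr mul0r zevD ?zevN ?zev_z ?za //; last by apply/in_zpolyN/in_zpolyZ.
      by move=> /eqP; rewrite subr_eq0 => /eqP.
    exact: in_zpolyZ.
  have VE : V = 1 - a *: zdivdiff a' U.
    apply: (@invertible_mulI _ (monom 1 (- 1) - lconst a')).
      have -> : monom 1 (- 1) - lconst a' = monom 1 (- 1) * h.
        by rewrite hE mulrBr mulr1 monomM mul1r addNr.
      apply: invertibleM; last exact: is_pos_invertible.
      by apply: invertible_monom; exact: invertible1.
    rewrite -zV; set z' := _ - lconst a'.
    have -> : z' * (1 - a *: zdivdiff a' U) = z' - lconst a * (z' * zdivdiff a' U).
      by rewrite scale_monomM -/(lconst a); ring.
    rewrite -zevP // /z' {1}a'E rmorphM /= scale_monomM -/(lconst a).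
    by set x := lconst (zev a' U); ring.
  exists a', (toGm cu), m; split=> //.
  - apply: weak_factorization_cst => //; first by rewrite -hE.
    by rewrite toGmK e hE !scale_monomM monomM mulr1 addr0 mulrA.
  (* Let D be the constant term of the quotient of U - U(a') by z - a'. Constant terms give c = 1 -
     a D and 1 - U(a') = - a' D; with a' = a U(a') this yields c U(a') = 1. *)
  - have c0 : c = 1 - a * zdivdiff a' U 0.
      transitivity (V 0); first by rewrite lcoefZ m1 mulr1.
      by rewrite VE lcoefB lcoef1 lcoefZ.
    have := congr1 (fun f : laurent A => f 0) (zevP a' Uz).
    rewrite lcoefB lcoef_const eqxx mulr1n U1 mulrBl lcoefB lcoef_monomM.
    rewrite (zdivdiff_zpoly _) // mulr0 sub0r lcoef_monomM subr0 => e0.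
    rewrite toGmK c0 mulrBl mul1r mulrAC -a'E.
    by move/eqP: e0; rewrite subr_eq => /eqP->; ring.
have root b : nilpotent b -> is_neg (U - monom b (- 1)) /\
    weak_factorization (u - lconst b) (fun=> 1) 1%g (U - monom b (- 1)) 1.
  move=> nb; have wn : is_neg (U - monom b (- 1)).
    split.
    - by apply: in_zpolyB => //; exact: in_zpoly_monom.
    - by rewrite lcoefB lcoef_monom U1 subr0.
    - move=> i i0; rewrite lcoefB lcoef_monom; apply: nilpotentD; first exact: Unil.
      by apply: nilpotentN; case: eqP => _; [exact: nb | exact: nilpotent0].
  split=> //; apply: weak_factorization_cst => //; first exact: is_pos1.
  by rewrite scale1r mulr1 mulrC mulrBr monomM mul1r subrr.
have np1 (k : laurent A) : is_neg k -> gpairing 1 k = 1%g by exact: gpairing1l.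
split.
- by move=> a; have [a' [c [m [_ w _ _ _]]]] := lin a; exists c, m, (1 - monom a' 1).
- by move=> b /root[_ w]; exists 1%g, (U - monom b (- 1)), 1.
- move=> a b; have [a' [c [m [mn w c1 a'E VE]]]] := lin a.
  have [b' [d [n [nn w' d1 b'E WE]]]] := lin b.
  rewrite (CC_cst w w') mul0r !zpow0 !mul1g; apply: gm_inj; apply: gm_div_eq.
  have p1 x : is_pos (1 - monom x 1 : laurent A) by exact: (@is_pos_monom _ _ 1).
  rewrite mul1r !gpairingE // !pairing_lin //.
  (* The minus part of 1 - a u takes at b' the value U(a') - a' S, and that of 1 - b u takes at a'
     the value U(b') - b' S, with the same divided difference S by symmetry. They agree because
     U(a') - U(b') = (a' - b') S. *)
  have zval x y z k (e : Gm A) : is_neg k -> gm_val e * zev y U = 1 ->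
      y = z * zev y U -> gm_val e *: k = 1 - z *: zdivdiff y U ->
      zev x k = zev y U - y * zev x (zdivdiff y U).
    move=> [kz _ _] e1 yE kE.
    have : zev x (gm_val e *: k) = gm_val e * zev x k.
      rewrite scale_monomM zevM ?zev_const //; exact: in_zpoly_monom.
    have dz := @zdivdiff_zpoly _ y U.
    have zdz : in_zpoly (z *: zdivdiff y U) by exact: in_zpolyZ.
    rewrite kE zevD; [|exact: in_zpoly1|exact: in_zpolyN].
    rewrite zevN // zev1.
    rewrite scale_monomM zevM ?zev_const //; last exact: in_zpoly_monom.
    move=> /(congr1 (fun t => zev y U * t)); rewrite [in RHS]mulrA [zev y U * gm_val e]mulrC e1 mul1r.
    move=> <-; set S := zev x _; have -> : y * S = z * zev y U * S by rewrite -yE.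
    by ring.
  rewrite (zval _ _ _ _ _ nn d1 b'E WE) (zval _ _ _ _ _ mn c1 a'E VE).
  rewrite (zdivdiff_sym b' a'); set S := zev b' _.
  have := congr1 (zev a') (zevP b' Uz).
  have zz : in_zpoly (monom 1 (- 1) : laurent A) by exact: in_zpoly_monom.
  have zc x : in_zpoly (lconst x : laurent A) by exact: in_zpoly_monom.
  rewrite zevM; [|exact: in_zpolyB|exact: zdivdiff_zpoly].
  rewrite zdivdiff_sym -/S !zevD ?zevN ?zev_z ?zev_const //; try exact: in_zpolyN.
  by move=> /eqP; rewrite subr_eq => /eqP->; ring.
- move=> a b nb; have [a' [c [m [mn w c1 a'E VE]]]] := lin a.
  have [bn w'] := root b nb.
  rewrite (CC_cst w w') mul0r !zpow0 zpow1 np1 // mul1g mulg1 invg1 mulg1.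
  have p1 x : is_pos (1 - monom x 1 : laurent A) by exact: (@is_pos_monom _ _ 1).
  rewrite gm_valM gpairingE // pairing_lin // zevD //; last first.
    by apply/in_zpolyN/in_zpoly_monom.
  rewrite zevN; last exact: in_zpoly_monom.
  rewrite (@zev_monom _ _ _ 1) expr1 mulrBr c1; congr (_ - _).
  have -> : gm_val c * (b * a') = b * (a * (gm_val c * zev a' U)).
    by rewrite {1}a'E; ring.
  by rewrite c1 mulr1 mulrC.
- move=> b b' nb nb'; have [bn w] := root b nb; have [bn' w'] := root b' nb'.
  by rewrite (CC_cst w w') mulr1 !zpow1 !np1 // !mulg1 invg1 !mulg1.
Qed.

End ConstantOrder.

(** * Products of constants and linear series *)

Section Words.
Variable A : comPzRingType.
Implicit Types (f g h m u : laurent A).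

Inductive word : laurent A -> Prop :=
  | word_const c : invertible c -> word (lconst c)
  | word_lin a : word (1 - a *: monom 1 1)
  | word_root b : nilpotent b -> word (monom 1 1 - lconst b)
  | word_mul f g : word f -> word g -> word (f * g)
  | word_inv f g : word f -> f * g = 1 -> word g.

Lemma admissible_t : admissible (monom 1 1 : laurent A).
Proof.
split; last by rewrite lcoef_monom eqxx; exact: invertible1.
by apply/in_nil_tpow; exact: in_tpow_monom.
Qed.

Lemma generic_t : generic_symbols (monom 1 1 : laurent A).
Proof. by apply: pseries_generic; [exact: admissible_t | exact: in_tpow_monom]. Qed.

Lemma generic_lin_invertible u a : generic_symbols u -> invertible (1 - a *: u).
Proof.
by move=> /generic_lin/(_ a)[c [m [h]]]; exact: weak_factorization_invertible.
Qed.

Lemma word_invertible f : word f -> invertible f.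
Proof.
elim=> {f}.
- by move=> c cu; exact: invertible_monom.
- by move=> a; exact: generic_lin_invertible generic_t.
- by move=> b; exact: unit_root.
- by move=> f g _ fu _ gu; exact: invertibleM.
- by move=> f g _ _ fg; exists f; rewrite mulrC.
Qed.

Lemma word1 : word 1.
Proof. by rewrite -(rmorph1 (@lconst A)); apply/word_const/invertible1. Qed.

Lemma word_prod (I : Type) (r : seq I) (F : I -> laurent A) :
  (forall i, word (F i)) -> word (\prod_(i <- r) F i).
Proof. by move=> wF; apply: big_ind => //; [exact: word1 | exact: word_mul]. Qed.

Lemma word_t : word (monom 1 1).
Proof.
by have := word_root (@nilpotent0 A); rewrite rmorph0 subr0.
Qed.

Lemma word_z : word (monom 1 (- 1)).
Proof. by apply: word_inv word_t _; rewrite monomM mulr1 subrr. Qed.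

Lemma word_monom (n : int) : word (monom 1 n).
Proof.
have wX f k : word f -> word (f ^+ k).
  move=> wf; elim: k => [|k IHk]; first exact: word1.
  by rewrite exprS; exact: word_mul.
case: n => k.
  by have := wX _ k word_t; rewrite monomX expr1n natz.
by have := wX _ k.+1 word_z; rewrite monomX expr1n mulNrn natz.
Qed.

Lemma neg_roots_word m rs : neg_roots m rs -> word m.
Proof.
move=> [nrs ->]; rewrite big_seq; apply: big_ind; [exact: word1|exact: word_mul|].
move=> r /nrs nr; have -> : 1 - monom r (- 1) = monom 1 (- 1) * (monom 1 1 - lconst r).
  by rewrite mulrBr !monomM mulr1 addNr mul1r addr0.
by apply: word_mul; [exact: word_z | exact: word_root].
Qed.

Lemma CC1l g : invertible g -> CC 1 g = 1%g.
Proof.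
move=> gu; apply: (mulIg (CC 1 g)); rewrite mul1g -CCMl ?mulr1 //; exact: invertible1.
Qed.

Lemma CC_constl (c : Gm A) g (n : int) c' m h :
  weak_factorization g (fun=> n) c' m h -> CC (lconst (gm_val c)) g = zpow c n.
Proof.
move=> w; have [_ mn hp _] := w.
by rewrite (CC_cst (const_weak c) w) mul0r zpow0 gpairing1l // gpairing1r //
  !mulg1 mul1g invg1 mulg1.
Qed.

Section Invariance.
Variables (phi : laurent A -> laurent A) (phiP : is_cendo phi).
Hypothesis phit : generic_symbols (phi (monom 1 1)).
Let t := monom 1 1 : laurent A.

Definition invariant f g := CC (phi f) (phi g) = CC f g.

Lemma invariant_sym f g : invertible f -> invertible g -> invariant f g -> invariant g f.
Proof.
move=> fu gu; rewrite /invariant => e.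
rewrite (CC_anti fu gu) -e; apply: CC_anti; exact: cendo_invertible phiP _ _.
Qed.

Lemma invariantM f f' g : invertible f -> invertible f' -> invertible g ->
  invariant f g -> invariant f' g -> invariant (f * f') g.
Proof.
move=> fu fu' gu; rewrite /invariant => e e'.
by rewrite (cendoM phiP) !CCMl ?e ?e' //; exact: cendo_invertible phiP _ _.
Qed.

Lemma invariantV f f' g : f * f' = 1 -> invertible g -> invariant f g -> invariant f' g.
Proof.
move=> ff' gu; rewrite /invariant => e.
have fu : invertible f by exists f'.
have fu' : invertible f' by exists f; rewrite mulrC.
have pu := cendo_invertible phiP.
apply: (mulgI (CC f g)); rewrite -{1}e -!CCMl //; try exact: pu.
by rewrite -(cendoM phiP) ff' (cendo1 phiP) !CC1l //; exact: pu.
Qed.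

Lemma phi_lin a : phi (1 - a *: t) = 1 - a *: phi t.
Proof. by rewrite (cendoB phiP) (cendo1 phiP) (cendoZ phiP). Qed.

Lemma phi_root b : phi (t - lconst b) = phi t - lconst b.
Proof. by rewrite (cendoB phiP) (cendo_const phiP). Qed.

Definition basic g := [\/ exists2 c, invertible c & g = lconst c,
  exists a, g = 1 - a *: t | exists2 b, nilpotent b & g = t - lconst b].

Lemma invariant_const (c : A) g : invertible c -> basic g -> invariant (lconst c) g.
Proof.
move=> cu; rewrite /invariant (cendo_const phiP) -(toGmK cu).
move=> [[d du ->]|[a ->]|[b nb ->]].
- by rewrite (cendo_const phiP).
- have [d [m [h w]]] := generic_lin phit a; have [d' [m' [h' w']]] := generic_lin generic_t a.
  by rewrite phi_lin (CC_constl _ w) (CC_constl _ w').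
- have [d [m [h w]]] := generic_root phit nb.
  have [d' [m' [h' w']]] := generic_root generic_t nb.
  by rewrite phi_root (CC_constl _ w) (CC_constl _ w').
Qed.

Lemma basic_word g : basic g -> word g.
Proof.
move=> [[c cu ->]|[a ->]|[b nb ->]];
  [exact: word_const | exact: word_lin | exact: word_root].
Qed.

Lemma invariant_basic f g : basic f -> basic g -> invariant f g.
Proof.
move=> bf bg; have fu := word_invertible (basic_word bf).
have gu := word_invertible (basic_word bg).
case: (bf) => [[c cu fE]|[a fE]|[b nb fE]]; first by rewrite fE; exact: invariant_const.
all: case: (bg) => [[c' cu' gE]|[a' gE]|[b' nb' gE]];
  first by apply: invariant_sym => //; rewrite gE; exact: invariant_const.
- rewrite fE gE /invariant !phi_lin (generic_lin_lin phit).
  by rewrite (generic_lin_lin generic_t).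
- rewrite fE gE /invariant phi_lin phi_root; apply: gm_inj.
  by rewrite (generic_lin_root phit) // (generic_lin_root generic_t).
- apply: invariant_sym => //; rewrite fE gE /invariant phi_lin phi_root; apply: gm_inj.
  by rewrite (generic_lin_root phit) // (generic_lin_root generic_t).
- rewrite fE gE /invariant !phi_root (generic_root_root phit) //.
  by rewrite (generic_root_root generic_t).
Qed.

(** Invariance spreads from generators to words by multiplicativity in one argument at a time; the
    other argument is treated in [invariant_word]. *)
Lemma invariant_word_basic f g : word f -> basic g -> invariant f g.
Proof.
move=> wf bg; have gu := word_invertible (basic_word bg); elim: wf => {f}.
- by move=> c cu; apply: invariant_const.
- by move=> a; apply: invariant_basic => //; constructor 2; exists a.
- by move=> b nb; apply: invariant_basic => //; constructor 3; exists b.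
- by move=> f f' wf IHf wf' IHf'; apply: invariantM => //; exact: word_invertible.
- by move=> f f' wf IHf ff'; apply: invariantV ff' gu IHf.
Qed.

Lemma invariant_word f g : word f -> word g -> invariant f g.
Proof.
move=> wf wg; have fu := word_invertible wf.
apply: invariant_sym => //; first exact: word_invertible.
elim: wg => {g}.
- move=> c cu; apply: invariant_sym => //; first exact: invertible_monom.
  by apply: invariant_word_basic => //; constructor 1; exists c.
- move=> a; apply: invariant_sym => //; first exact/word_invertible/word_lin.
  by apply: invariant_word_basic => //; constructor 2; exists a.
- move=> b nb; apply: invariant_sym => //; first exact: unit_root.
  by apply: invariant_word_basic => //; constructor 3; exists b.
- by move=> g g' wg IHg wg' IHg'; apply: invariantM => //; exact: word_invertible.
- by move=> g g' wg IHg gg'; apply: invariantV gg' fu IHg.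
Qed.

End Invariance.
End Words.

Section WordMap.
Variables (A B : comPzRingType) (i : {rmorphism A -> B}).

Lemma word_map f : word f -> word (lmap i f).
Proof.
elim=> {f}.
- by move=> c cu; rewrite lmap_const; apply/word_const/invertible_map.
- by move=> a; rewrite rmorphB rmorph1 /= lmapZ lmap_monom rmorph1; exact: word_lin.
- move=> b nb; rewrite rmorphB /= lmap_monom rmorph1 lmap_const.
  by apply/word_root/nilpotent_map.
- by move=> f g _ wf _ wg; rewrite rmorphM; exact: word_mul.
- by move=> f g _ wf fg; apply: word_inv wf _; rewrite -rmorphM fg rmorph1.
Qed.

End WordMap.

Lemma word_split_prod (A : comPzRingType) (a : nat -> A) (N : nat) :
  exists (B : comPzRingType) (i : {rmorphism A -> B}), injective i /\
    word (lmap i (\prod_(1 <= k < N) (1 - monom (a k) k%:Z))).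
Proof.
elim: N => [|N [B [i [ii w]]]].
  exists A, (idfun : {rmorphism A -> A}); split=> //; rewrite big_geq // rmorph1.
  exact: word1.
have [N0|N0] := posnP N.
  exists A, (idfun : {rmorphism A -> A}); split=> //; rewrite big_geq ?rmorph1; last lia.
  exact: word1.
have [C [k [rs [ki krs]]]] := binomial_split (i (a N)) N0.
exists C, (k \o i : {rmorphism A -> C}); split; first exact: inj_comp.
rewrite -lmap_comp big_nat_recr //= !rmorphM /=; apply: word_mul; first exact: word_map.
rewrite !rmorphB !rmorph1 /= !lmap_monom (roots_pos krs); apply: word_prod => r.
by rewrite monomE; exact: word_lin.
Qed.

Lemma word_split (A : comPzRingType) (m : laurent A) (c : Gm A) (n : int)
    (a : nat -> A) (N : nat) : is_neg m ->
  exists (B : comPzRingType) (i : {rmorphism A -> B}), injective i /\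
    word (lmap i (m * (gm_val c *: monom 1 n) *
      \prod_(1 <= k < N) (1 - monom (a k) k%:Z))).
Proof.
move=> mn; have [B [i [rs [ii mrs]]]] := neg_split mn.
have [C [k [ki w]]] := word_split_prod (i \o a) N.
exists C, (k \o i : {rmorphism A -> C}); split; first exact: inj_comp.
rewrite -lmap_comp !rmorphM /=; apply: word_mul; first apply: word_mul.
- exact: neg_roots_word (neg_roots_map k mrs).
- rewrite !lmapZ !lmap_monom !rmorph1 scale_monomM; apply: word_mul.
    by apply: word_const; do 2 apply: invertible_map; exact: gm_invertible.
  exact: word_monom.
- move: w; rewrite !rmorph_prod; under eq_bigr do rewrite rmorphB rmorph1 /= lmap_monom.
  by under [in X in _ -> X]eq_bigr do
    rewrite !rmorphB !rmorph1 /= !lmap_monom.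
Qed.

Lemma pos_truncate (A : comPzRingType) (h : laurent A) : is_pos h ->
  exists a : nat -> A, forall N : nat, exists r, [/\ is_pos r, in_tpow N%:Z (r - 1)
    & h = \prod_(1 <= k < N) (1 - monom (a k) k%:Z) * r].
Proof.
move=> hp; have [a ah] := witt_pos hp; exists a => N.
set P := \prod_(1 <= k < N) _; have Pp : is_pos P.
  rewrite /P big_nat; apply: big_ind; [exact: is_pos1|exact: is_posM|].
  by move=> k /andP[k1 _]; exact: is_pos_monom.
have [P' Pp' PP'] := is_posV Pp.
exists (h * P'); split; first exact: is_posM.
  rewrite -PP' -mulrBl; apply: in_tpowMr; last by case: Pp'.
  exact/in_tpow_sym/ah.
by rewrite mulrCA PP' mulr1.
Qed.

(** * Factors of the ring cut out by idempotents *)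

Section Corner.
Variables (A : comPzRingType) (e : A) (ee : e * e = e).

(** This cuts out A e, a ring with unit [e]; the projection x e identifies it with the quotient of
    [A] by 1 - e. *)
Definition corner_pred : pred A := fun x => x * e == x.
Record corner := Corner { corner_val : A; _ : corner_pred corner_val }.
HB.instance Definition _ := [isSub for corner_val].
HB.instance Definition _ := [Choice of corner by <:].

Fact corner_zmod_closed : zmod_closed corner_pred.
Proof.
split; first by rewrite unfold_in /corner_pred mul0r.
by move=> x y; rewrite !unfold_in /corner_pred mulrBl => /eqP-> /eqP->.
Qed.
HB.instance Definition _ := GRing.isZmodClosed.Build A corner_pred corner_zmod_closed.
HB.instance Definition _ := [SubChoice_isSubZmodule of corner by <:].

Fact corner_proj_subproof x : corner_pred (x * e).
Proof. by rewrite /corner_pred -mulrA ee. Qed.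
Definition corner_proj x := Corner (corner_proj_subproof x).
Definition corner_mul (x y : corner) := corner_proj (corner_val x * corner_val y).
Definition corner_one := corner_proj 1.

Lemma corner_valP (x : corner) : corner_val x * e = corner_val x.
Proof. by case: x => x /= /eqP. Qed.

Fact corner_mulA : associative corner_mul.
Proof.
move=> x y z; apply: val_inj; rewrite /=; move: (corner_val x) => a.
by move: (corner_val y) (corner_val z) => b c; ring.
Qed.
Fact corner_mulC : commutative corner_mul.
Proof. by move=> x y; apply: val_inj; rewrite /= mulrC [X in _ * X]mulrC mulrC. Qed.
Fact corner_mul1 : left_id corner_one corner_mul.
Proof. by move=> x; apply: val_inj; rewrite /= mul1r mulrAC ee mulrC corner_valP. Qed.
Fact corner_mulDl : left_distributive corner_mul +%R.
Proof.
move=> x y z; apply: val_inj.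
rewrite -[LHS]/((corner_val x + corner_val y) * corner_val z * e).
rewrite -[RHS]/(corner_val x * corner_val z * e + corner_val y * corner_val z * e).
by rewrite !mulrDl.
Qed.

HB.instance Definition _ := GRing.Zmodule_isComPzRing.Build corner
  corner_mulA corner_mulC corner_mul1 corner_mulDl.

Fact corner_proj_zmod_morphism : zmod_morphism corner_proj.
Proof.
move=> x y; apply: val_inj.
by rewrite -[RHS]/(x * e - y * e) -mulrBl.
Qed.
Fact corner_proj_monoid_morphism : monoid_morphism corner_proj.
Proof.
split=> // x y; apply: val_inj; rewrite /=.
have -> : x * e * (y * e) * e = x * y * (e * e * e) by ring.
by rewrite !ee.
Qed.
HB.instance Definition _ := GRing.isZmodMorphism.Build A corner corner_proj
  corner_proj_zmod_morphism.
HB.instance Definition _ := GRing.isMonoidMorphism.Build A corner corner_proj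
  corner_proj_monoid_morphism.

Lemma corner_proj_idem : corner_proj e = 1.
Proof. by apply: val_inj; rewrite /= ee mul1r. Qed.

End Corner.

(* Passing to the factors A e of a product decomposition makes the orders
   constant. *)
Lemma corner_eq (A : comPzRingType) (I : finType) (e : I -> A) (eo : orth_family e)
    (x y : A) :
  (forall i, let: And3 _ ee _ := eo in corner_proj (ee i) x = corner_proj (ee i) y) ->
  x = y.
Proof.
case: eo => e1 ee eoo /= exy; rewrite -[x]mulr1 -[y]mulr1 -e1 !mulr_sumr.
by apply: eq_bigr => i _; have /(congr1 (@corner_val _ _)) := exy i.
Qed.

(** [e] becomes 1 in A e, so the primes of A e pull back to primes of [A] that miss [e], where [nu]
    equals n. *)
Lemma corner_weak (A : comPzRingType) (e : A) (ee : e * e = e) f nu c m h (n : int) :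
    weak_factorization f nu c m h -> (forall p : Spec A, ~ p e -> nu p = n) ->
  weak_factorization (lmap (corner_proj ee) f) (fun=> n) (Gm_map (corner_proj ee) c)
    (lmap (corner_proj ee) m) (lmap (corner_proj ee) h).
Proof.
move=> w nun; have := weak_factorization_map (corner_proj ee) w.
rewrite (_ : nu \o _ = fun=> n) //; apply/funext => p /=; apply: nun.
by rewrite Spec_mapE /= corner_proj_idem; exact: prime_mem1.
Qed.

Section SubstInvariance.

Definition symbol_invariant (A : comPzRingType) (u : Gm (laurent A)) : Prop :=
  forall f g, invertible f -> invertible g -> CC (lcomp f u) (lcomp g u) = CC f g.

Lemma cendo_tail (A : comPzRingType) (phi : laurent A -> laurent A) (n : nat) :
  is_cendo phi -> exists N : nat, forall r, is_pos r -> in_tpow N%:Z (r - 1) ->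
    is_pos (phi r) /\ in_tpow n%:Z (phi r - 1).
Proof.
move=> phiP; have [N NP] := cendo_cont phiP n.+1%:Z; exists (absz N) => r rp rN.
have : in_tpow n.+1%:Z (phi (r - 1)) by apply: NP; apply: in_tpowW rN; lia.
rewrite (cendoB phiP) (cendo1 phiP) => H; split; last by apply: in_tpowW H; lia.
split.
  rewrite -[phi r](subrK 1); apply: in_tpowD; last exact: in_tpow1.
  by apply: in_tpowW H; lia.
by have /eqP := H 0 isT; rewrite lcoefB lcoef1 subr_eq0 => /eqP->.
Qed.

(** Both plus parts are truncated in Witt coordinates, and the truncated series become words in an
    injective extension, where [invariant_word] applies. The hypothesis on [u] ranges over all ring
    morphisms because that extension depends on f and g. *)
Lemma symbol_invariant_cst (A : comPzRingType) (u : Gm (laurent A)) f g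
    (n n' : int) c c' m m' h h' :
    admissible (gm_val u) ->
    (forall (B : comPzRingType) (i : {rmorphism A -> B}),
       generic_symbols (lmap i (gm_val u))) ->
    weak_factorization f (fun=> n) c m h -> weak_factorization g (fun=> n') c' m' h' ->
  CC (lcomp f u) (lcomp g u) = CC f g.
Proof.
move=> uP ugen wf wg; have phiP := lcomp_cendo uP; pose phi f := lcomp f u.
have fu := weak_factorization_invertible wf; have gu := weak_factorization_invertible wg.
have pu := cendo_invertible phiP.
have trunc f1 g1 (k : int) d l q : weak_factorization f1 (fun=> k) d l q -> invertible g1 ->
    exists (a : nat -> A) (N : nat),
      let f2 := l * (gm_val d *: monom 1 k) * \prod_(1 <= j < N) (1 - monom (a j) j%:Z) in
      [/\ invertible f2, CC f1 g1 = CC f2 g1 & CC (phi f1) (phi g1) = CC (phi f2) (phi g1)].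
  move=> w g1u; have [_ ln qp _] := w; have [a aq] := pos_truncate qp.
  (* Order [N1] makes the symbol of the tail trivial, [N2] that of its image, and order [N3] of the
     tail forces order [N2] of the image. *)
  have [N1 N1P] := tail_CC g1u; have [N2 N2P] := tail_CC (pu _ g1u).
  have [N3 N3P] := cendo_tail N2 phiP.
  have [r [rp rN qE]] := aq (N1 + N3)%N; exists a, (N1 + N3)%N => f2.
  have f1E : f1 = f2 * r by rewrite (weak_factorization_cst_inv w) {1}qE mulrA.
  have f1u := weak_factorization_invertible w.
  have f2u : invertible f2 by apply: (@invertible_mull _ _ r); rewrite -f1E.
  have ru := is_pos_invertible rp.
  have [pr1 pr2] : is_pos (phi r) /\ in_tpow N2%:Z (phi r - 1).
    by apply: N3P => //; apply: in_tpowW rN; lia.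
  split=> //.
    by rewrite f1E CCMl // (N1P r) ?mulg1 //; apply: in_tpowW rN; lia.
  have -> : phi f1 = phi f2 * phi r by rewrite /phi f1E (cendoM phiP).
  rewrite CCMl; [|exact: pu|exact: pu|exact: pu].
  by rewrite (N2P (phi r)) ?mulg1.
have [a [N [f2u e1 e1']]] := trunc _ _ _ _ _ _ wf gu.
set f2 := _ * _ in f2u e1 e1'; have [b [K [g2u e2 e2']]] := trunc _ _ _ _ _ _ wg f2u.
set g2 := _ * _ in g2u e2 e2'.
rewrite e1 -/(phi f) -/(phi g) e1' (CC_anti (pu _ gu) (pu _ f2u)) e2'.
rewrite (CC_anti gu f2u) e2; congr (_^-1)%g.
have [_ mn _ _] := wf; have [_ mn' _ _] := wg.
have [B [i [ii wB]]] := word_split c n a N mn.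
have [C [k [ki wC]]] := word_split (Gm_map i c') n' (i \o b) K (is_neg_map i mn').
pose j : {rmorphism A -> C} := k \o i; have ji : injective j by exact: inj_comp.
have wf2 : word (lmap j f2) by rewrite -lmap_comp; exact: word_map.
have wg2 : word (lmap j g2).
  rewrite -lmap_comp; move: wC; set x := _ * _ => wC.
  suff -> : lmap i g2 = x by [].
  rewrite /g2 !rmorphM /= lmapZ lmap_monom rmorph1 rmorph_prod.
  by under eq_bigr do rewrite rmorphB rmorph1 /= lmap_monom.
pose v : Gm (laurent C) := Gm_map (lmap j : {rmorphism _ -> _}) u.
have vE : gm_val v = lmap j (gm_val u) by [].
have vP : admissible (gm_val v) by rewrite vE; exact: admissible_map.
have psiP := lcomp_cendo vP.
have jgm : injective (Gm_map j).
  by move=> x y /(congr1 (@gm_val _)) /ji; exact: gm_inj.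
apply: jgm; rewrite -!CC_map //; try exact: pu.
rewrite /phi !(lcomp_map _ uP vE); apply: (invariant_word psiP) => //.
by rewrite lcomp_t // vE.
Qed.

Lemma symbol_invariant_generic (A : comPzRingType) (u : Gm (laurent A)) :
    admissible (gm_val u) ->
    (forall (B : comPzRingType) (i : {rmorphism A -> B}),
       generic_symbols (lmap i (gm_val u))) ->
  symbol_invariant u.
Proof.
move=> uP ugen f g fu gu.
have [nu [c [m [h wf]]]] := weak_factorization_exists fu.
have [nu' [c' [m' [h' wg]]]] := weak_factorization_exists gu.
have [nulc _ _ _] := wf; have [nulc' _ _ _] := wg.
have [I [e [n [n' [eo en]]]]] := locally_constant_decomp2 nulc nulc'.
have phiP := lcomp_cendo uP; have pu := cendo_invertible phiP.
apply: gm_inj; apply: (@corner_eq _ _ _ eo) => l.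
case: (eo) => _ ee _; set i : {rmorphism A -> _} := corner_proj (ee l).
rewrite -!(gm_map_val i); congr gm_val.
rewrite -!CC_map //; try exact: pu.
pose v : Gm (laurent _) := Gm_map (lmap i : {rmorphism _ -> _}) u.
have vE : gm_val v = lmap i (gm_val u) by [].
have vP : admissible (gm_val v) by rewrite vE; exact: admissible_map.
rewrite !(lcomp_map _ uP vE).
have w1 := corner_weak (ee l) wf (fun p pe => proj1 (en l p pe)).
have w2 := corner_weak (ee l) wg (fun p pe => proj2 (en l p pe)).
apply: (symbol_invariant_cst vP _ w1 w2) => B k.
by rewrite vE lmap_comp; exact: ugen.
Qed.

Lemma lcomp_comp (A : comPzRingType) (p q u : Gm (laurent A)) f :
    admissible (gm_val p) -> admissible (gm_val q) -> admissible (gm_val u) ->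
    gm_val u = lcomp (gm_val q) p ->
  lcomp f u = lcomp (lcomp f q) p.
Proof.
move=> pP qP uP uE; have cP := cendo_comp (lcomp_cendo pP) (lcomp_cendo qP).
by rewrite (cendo_lcomp cP (u := u)) //= lcomp_t.
Qed.

Lemma symbol_invariant_comp (A : comPzRingType) (p q u : Gm (laurent A)) :
    admissible (gm_val p) -> admissible (gm_val q) -> admissible (gm_val u) ->
    gm_val u = lcomp (gm_val q) p ->
  symbol_invariant p -> symbol_invariant q -> symbol_invariant u.
Proof.
move=> pP qP uP uE ip iq f g fu gu.
have qu := cendo_invertible (lcomp_cendo qP).
by rewrite !(lcomp_comp _ pP qP uP uE) ip ?iq //; exact: qu.
Qed.

End SubstInvariance.

(** * Decomposition of an admissible series *)

Section Decomposition.
Variable A : comPzRingType.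
Implicit Types (p q u : laurent A).

(** [q] has a pole of exact order one with invertible leading coefficient, so its powers remove the
    polar terms of [x] one by one, starting from the deepest. *)
Lemma polar_split (s : seq A) (k : nat) q : in_tpow (- 1) q -> invertible (q (- 1)) ->
  forall (K : nat) (x : laurent A), coef_in s k x -> in_tpow (- K%:Z) x ->
  exists (d : nat -> A) (y : laurent A),
    [/\ forall j, ideal_pow s k (d j), coef_in s k y, in_tpow 0 y
      & x = y + \sum_(1 <= j < K.+1) d j *: q ^+ j].
Proof.
move=> q1 [b qb]; elim=> [|K IHK] x xk xK.
  exists (fun=> 0), x; split=> // [j|]; first exact: ideal_pow_0.
  by rewrite big_geq // addr0.
(* The leading coefficient of q^(K+1) is the (K + 1)-st power of that of [q], which [b] inverts. *)
pose y := x (- K.+1%:Z) * b ^+ K.+1.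
have qK k' : in_tpow (- k'%:Z) (q ^+ k') /\ (q ^+ k') (- k'%:Z) = q (- 1) ^+ k'.
  elim: k' => [|l [IH1 IH2]]; first by rewrite !expr0 lcoef1; split=> //; exact: in_tpow1.
  have -> : - l.+1%:Z = - 1 + - l%:Z by lia.
  by rewrite !exprS; split; [exact: in_tpowM | rewrite lcoef_lead // IH2].
have yk : ideal_pow s k y by apply: ideal_powMr.
have [||d [z [dk zk z0 e]]] := IHK (x - y *: q ^+ K.+1).
- apply: coef_inB => //; rewrite scale_monomM; apply: coef_inMr.
  exact: coef_in_monom.
- move=> i iK; rewrite lcoefB lcoefZ.
  have [iK1|iK1] := ltP i (- K.+1%:Z).
    by rewrite xK // (proj1 (qK _)) // mulr0 subr0.
  have -> : i = - K.+1%:Z by lia.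
  by rewrite (proj2 (qK _)) /y -mulrA -exprMn [b * _]mulrC qb expr1n mulr1 subrr.
exists (fun j => if j == K.+1 then y else d j), z; split=> //.
- by move=> j; case: eqP.
rewrite big_nat_recr //= eqxx addrA -[LHS](subrK (y *: q ^+ K.+1)) e.
congr (_ + _ + _); rewrite [LHS]big_nat [RHS]big_nat; apply: eq_bigr => j /andP[_ jK].
by rewrite ifF //; lia.
Qed.

Lemma coef_in_exp (s : seq A) k (p q : laurent A) n :
  coef_in s k (p - q) -> coef_in s k (p ^+ n - q ^+ n).
Proof. by move=> pq; rewrite subrXX; exact: coef_inMr. Qed.

Lemma coef_in_invB (s : seq A) k (p p' q q' : laurent A) : p * p' = 1 -> q * q' = 1 ->
  coef_in s k (q - p) -> coef_in s k (p' - q').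
Proof.
move=> pp' qq' qp; have -> : p' - q' = (q - p) * (p' * q').
  have -> : (q - p) * (p' * q') = (q * q') * p' - (p * p') * q' by ring.
  by rewrite pp' qq' !mul1r.
exact: coef_inMr.
Qed.

(* Newton iteration along the powers of the ideal generated by the nilpotent
   coefficients of u. *)
Lemma admissible_decomp u : admissible u ->
  exists (p p' : laurent A) (d : nat -> A) (L : nat),
  [/\ admissible p, in_tpow 0 p, p * p' = 1, forall j, nilpotent (d j)
    & u = p + \sum_(1 <= j < L) d j *: p' ^+ j].
Proof.
move=> [unil u1]; have [s nils us] := nil_tpow_list unil.
have [N JN] := ideal_pow_nilpotent nils.
pose p0 := lcut 1 u.
have p0P : admissible p0.
  split; last by rewrite lcoef_cut ltxx.
  by apply/in_nil_tpow/lcut_tpow.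
have [q pq] := admissible_invertible p0P.
have [q1 qu] : in_tpow (- 1) q /\ invertible (q (- 1)).
  pose f := monom 1 (- 1) * p0.
  have f0 : in_tpow 0 f by rewrite -[0](subrr 1); exact/in_tpow_shift/lcut_tpow.
  have fu : invertible (f 0) by rewrite lcoef_monomM mul1r sub0r opprK lcoef_cut ltxx.
  have [g [fg g0 gE]] := unit_pseries f0 fu.
  have -> : q = monom 1 (- 1) * g.
    apply: (inv_uniq pq); rewrite -fg /f; by ring.
  split; first by rewrite -[- 1]add0r; exact: in_tpow_shift.
  by rewrite lcoef_monomM mul1r subrr; exists (f 0); rewrite mulrC.
suff H k : exists (p p' : laurent A) (d : nat -> A) (L : nat),
    [/\ in_tpow 0 p /\ p * p' = 1, coef_in s 1 (p - p0), forall j, ideal_pow s 1 (d j),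
      forall j, (L <= j)%N -> d j = 0
    & coef_in s k.+1 (u - (p + \sum_(1 <= j < L) d j *: p' ^+ j))].
  have [p [p' [d [L [[pt pp'] pp0 d1 _ e]]]]] := H N; exists p, p', d, L; split=> //.
  - have pn i : nilpotent ((p - p0) i) by exact: ideal_pow1_nilpotent nils (pp0 i).
    have pE i : p i = p0 i + (p - p0) i by rewrite lcoefB addrC subrK.
    split=> [i i1|]; rewrite pE; last by apply: invertible_nilpD => //; case: p0P.
    by apply: nilpotentD => //; case: p0P => p0n _; exact: p0n.
  - by move=> j; exact: ideal_pow1_nilpotent nils (d1 j).
  - apply/eqP; rewrite -subr_eq0; apply/eqP/laurentP => i.
    exact/JN/ideal_powS/e.
elim: k => [|k [p [p' [d [L [[pt pp'] pp0 d1 dL e]]]]]].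
  exists p0, q, (fun=> 0), 1%N; split=> //.
  - split=> //; apply: in_tpowW (@lcut_tpow _ _ _); lia.
  - by rewrite subrr; exact: coef_in0.
  - by move=> j; exact: ideal_pow_0.
  - rewrite big_geq // addr0 => i; rewrite lcoef_cutN; case: ifP => [|_]; first exact: us.
    exact: ideal_pow_0.
(* The error is expanded in the fixed inverse [q] of [p0]; [y] is added to [p], and [dd] to [d].
   Then p' and q give way to the inverse of the new p: this multiplies [d] by elements of the (k +
   1)-st power and [dd] by elements of the ideal, so the error gains a power. *)
set x := u - _ in e; have [K xK] := laurent_boundN x.
have [dd [y [ddk yk y0 xE]]] := polar_split q1 qu e xK.
pose p2 := p + y.
have p2p0 : coef_in s 1 (p2 - p0).
  by rewrite /p2 addrAC; apply: coef_inD => //; apply: coef_in_le yk.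
have p2u : invertible p2.
  have pn i : nilpotent ((p2 - p0) i) by exact: ideal_pow1_nilpotent nils (p2p0 i).
  have pE i : p2 i = p0 i + (p2 - p0) i by rewrite lcoefB addrC subrK.
  apply: admissible_invertible; split=> [i i1|]; rewrite pE.
    by apply: nilpotentD => //; case: p0P => p0n _; exact: p0n.
  by apply: invertible_nilpD => //; case: p0P.
have [p2' pp2] := p2u.
pose M := (L + K).+1.
exists p2, p2', (fun j => d j + (if (j < K.+1)%N then dd j else 0)), M; split=> //.
- by split=> //; exact: in_tpowD.
- move=> j; apply: ideal_pow_add => //; case: ifP => _; last exact: ideal_pow_0.
  exact: ideal_pow_le (ddk j).
- by move=> j Mj; rewrite dL ?ifF ?addr0 //; lia.
have ext (F : nat -> A) (n : nat) (w : laurent A) : (1 <= n <= M)%N ->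
    (forall j, (n <= j)%N -> F j = 0) ->
    \sum_(1 <= j < n) F j *: w ^+ j = \sum_(1 <= j < M) F j *: w ^+ j.
  move=> /andP[n1 nM] Fn; rewrite [RHS](@big_cat_nat _ _ _ n) //=.
  rewrite [X in _ + X]big1_seq ?addr0 // => j.
  by rewrite /= mem_index_iota => /andP[nj _]; rewrite Fn // scale0r.
pose dd' j := if (j < K.+1)%N then dd j else 0.
have xE2 : x = y + \sum_(1 <= j < M) dd' j *: q ^+ j.
  rewrite xE -(ext dd' K.+1 q); [|lia|by move=> j Kj; rewrite /dd' ifF //; lia].
  congr (_ + _); rewrite [LHS]big_nat [RHS]big_nat; apply: eq_bigr => j /andP[_ jK].
  by rewrite /dd' jK.
have uE : u = p + \sum_(1 <= j < M) d j *: p' ^+ j + x.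
  rewrite /x -(ext d L.+1 p'); [|lia|by move=> j Lj; apply: dL; lia].
  have [L0|L0] := posnP L; first by rewrite L0 !big_geq //; ring.
  by rewrite big_nat_recr //= dL // scale0r addr0; ring.
have -> : u - (p2 + \sum_(1 <= j < M) (d j + dd' j) *: p2' ^+ j) =
    \sum_(1 <= j < M) d j *: (p' ^+ j - p2' ^+ j) +
    \sum_(1 <= j < M) dd' j *: (q ^+ j - p2' ^+ j).
  under eq_bigr do rewrite scalerDl.
  under [in RHS]eq_bigr do rewrite scalerBr.
  under [X in _ = _ + X]eq_bigr do rewrite scalerBr.
  rewrite big_split /= !sumrB uE {1}xE2 /p2; ring.
have dd'k j : ideal_pow s k.+1 (dd' j).
  by rewrite /dd'; case: ifP => _; [exact: ddk | exact: ideal_pow_0].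
apply: coef_inD; apply: coef_in_sum => j _; rewrite scale_monomM.
- rewrite -add1n; apply: coef_inM; first exact: coef_in_monom.
  apply/coef_in_exp/(coef_in_invB pp' pp2).
  by rewrite /p2 addrAC subrr add0r.
- rewrite -addn1; apply: coef_inM; first exact: coef_in_monom.
  by apply/coef_in_exp/(coef_in_invB pq pp2).
Qed.

Lemma admissible_symbol_invariant (u : Gm (laurent A)) : admissible (gm_val u) ->
  symbol_invariant u.
Proof.
move=> uP; have [p [p' [d [L [pP p0 pp' dn uE]]]]] := admissible_decomp uP.
pose pg := toGm (admissible_invertible pP).
(* The inner series is q = t U, whence the exponent -(j + 1); then q o p = p + sum of the d_j
   p^(-j), which is [u]. *)
pose U : laurent A := 1 + \sum_(1 <= j < L) monom (d j) (- j.+1%:Z).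
have Un : is_neg U.
  split.
  - apply: in_zpolyD; first exact: in_zpoly1.
    by apply: in_zpoly_sum => j _; apply: in_zpoly_monom; lia.
  - rewrite lcoefD lcoef1 eqxx lcoef_sum; under eq_bigr do rewrite lcoef_monom.
    by rewrite big1 ?addr0 // => j _; rewrite (_ : (_ == _) = false) //; lia.
  - move=> i i0; rewrite lcoefD lcoef1 lt_eqF // add0r lcoef_sum.
    apply: nilpotent_sum => j _; rewrite lcoef_monom.
    by case: eqP => _; [exact: dn | exact: nilpotent0].
have qE : monom 1 1 * U = monom 1 1 + \sum_(1 <= j < L) d j *: monom 1 (- j%:Z).
  rewrite /U mulrDr mulr1 mulr_sumr; congr (_ + _); apply: eq_bigr => j _.
  by rewrite monomM mul1r -monomE; congr (monom _ _); lia.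
have qP : admissible (monom 1 1 * U).
  have [_ U1 Unil] := Un; split=> [i i1|]; rewrite lcoef_monomM mul1r.
    by apply: Unil; lia.
  by rewrite subrr U1; exact: invertible1.
pose qg := toGm (admissible_invertible qP).
apply: (@symbol_invariant_comp _ pg qg) => //.
- have pgP : admissible (gm_val pg) by [].
  rewrite /qg toGmK qE lcompD // lcomp_t // uE; congr (_ + _).
  have -> : lcomp (\sum_(1 <= j < L) d j *: monom 1 (- j%:Z)) pg =
      \sum_(1 <= j < L) lcomp (d j *: monom 1 (- j%:Z)) pg.
    exact: (cendo_sum (lcomp_cendo pgP)).
  apply: eq_bigr => j _; rewrite lcompZ // lcomp_monom // scale1r; congr (_ *: _).
  apply/esym; rewrite zpowN; apply: gm_valV_uniq => /=.
  by rewrite gm_valX /= -exprMn pp' expr1n.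
- apply: symbol_invariant_generic => // B i; apply: pseries_generic.
    exact: admissible_map.
  exact: lmap_tpow.
- apply: symbol_invariant_generic => // B i; rewrite /qg toGmK rmorphM /= lmap_monom rmorph1.
  by apply: zpoly_generic; exact: is_neg_map.
Qed.

End Decomposition.

(** * The cocycle *)

Lemma contAut_CC (A : comPzRingType) (phi : contAut A) f g :
  invertible f -> invertible g -> CC (phi f) (phi g) = CC f g.
Proof.
move=> fu gu; rewrite !contAut_lcomp.
exact: (admissible_symbol_invariant (contAut_admissible phi)).
Qed.

Lemma contAut_invertible (A : comPzRingType) (phi : contAut A) f :
  invertible f -> invertible (phi f).
Proof. exact: (cendo_invertible (contAut_cendo phi)). Qed.

Lemma base_change_tau (A B : comPzRingType) (h : {rmorphism A -> B}) phi psi :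
  base_change h phi psi -> tau psi = lmap h (tau phi).
Proof.
move=> e; rewrite /tau lmap_deriv; congr lderiv; apply/laurentP => i; exact: e.
Qed.

Lemma base_change_app (A B : comPzRingType) (h : {rmorphism A -> B}) phi psi f :
  base_change h phi psi -> psi (lmap h f) = lmap h (phi f).
Proof.
move=> e; rewrite !contAut_lcomp (lcomp_map _ (contAut_admissible phi) (v := tilde psi)) //.
by apply/laurentP => i; exact: e.
Qed.

Lemma Bhat_cocycle : is_two_cocycle Bhat.
Proof.
split=> [A B h phi1 phi2 psi1 psi2 e1 e2|A g1 g2 g3].
  rewrite /Bhat (base_change_tau e1) (base_change_tau e2) (base_change_app _ e1).
  by apply: CC_map; [exact: tau_invertible | exact/contAut_invertible/tau_invertible].
have t1 := tau_invertible g1; have t2 := tau_invertible g2.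
have t3 := tau_invertible g3.
have g1t2 := contAut_invertible g1 t2; have g2t3 := contAut_invertible g2 t3.
have g1g2t3 := contAut_invertible g1 g2t3.
rewrite /Bhat !tauM -[(g1 * g2)%g (tau g3)]/(g1 (g2 (tau g3))).
have [_ [_ g1M] _] := contAut_prop g1; rewrite g1M CCMl // CCMr // contAut_CC //.
(* The four values of the cochain are [a], [b * a], [c * b] and [c]. *)
set a := CC (tau g2) _; set b := CC (tau g1) (g1 (g2 _)); set c := CC (tau g1) _.
apply: gm_inj; rewrite gm_invM !gm_valM.
transitivity ((gm_val a * gm_val a^-1%g) * (gm_val b * gm_val b^-1%g) *
  (gm_val c * gm_val c^-1%g)); first by ring.
by rewrite !gm_valV !mulr1.
Qed.

(** [CC] and [lcomp] are total functions with default values, so well-definedness is asserted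
    separately: both arguments are invertible, the symbol has exactly one value, the composition
    series converges to phi1 (tau phi2), and the two expressions for the cocycle agree. *)
Theorem proposition2p3 :
  (forall (A : comPzRingType) (phi1 phi2 : contAut A),
     [/\ invertible (tau phi1),
         invertible (phi1 (tau phi2)),
         exists! c : Gm A, is_CC (tau phi1) (phi1 (tau phi2)) c,
         lcomp_partial (tau phi2) (tilde phi1) @ \oo --> phi1 (tau phi2)
       & Bhat phi1 phi2 = CC (tau phi1) (lcomp (tau phi2) (tilde phi1))])
  /\ is_two_cocycle Bhat.
Proof.
split; last exact: Bhat_cocycle.
move=> A phi1 phi2; have t1 := tau_invertible phi1.
have t2 := contAut_invertible phi1 (tau_invertible phi2); split=> //.
- exact: CC_uniq.
- by apply/tadic_cvgP; exact: contAut_lcomp_lim.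
- by rewrite /Bhat contAut_lcomp.
Qed.
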